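(* Let $X$ be a locally compact Hadamard space and let $G$ be a totally disconnected topological group acting continuously, properly and cocompactly by isometries on $X$. Let $H < G$ be a closed subgroup. Then $H$ is amenable if and only if the LF-radical $\mathrm{Rad}_{\mathscr{LF}}(H)$ is open in $H$ and the quotient $H/\mathrm{Rad}_{\mathscr{LF}}(H)$ is virtually abelian.
   Context: A Hadamard space is a complete $\mathrm{CAT}(0)$ space. The action of $G$ on $X$ is proper if for every compact $C \subset X$ the set $\{g \in G : gC \cap C \neq \varnothing\}$ is compact (in particular $G$ is then locally compact); it is cocompact if $X/G$ is compact. A subgroup $H$ of a topological group $G$ is topologically locally finite if the closure (in $G$) of every finitely generated subgroup of $H$ is compact. The LF-radical $\mathrm{Rad}_{\mathscr{LF}}(H)$ of a locally compact group $H$ is its maximal normal topologically locally finite subgroup; it is closed. Virtually abelian means having an abelian subgroup of finite index. *)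

(* Defs.v *)
From HB Require Import structures.
From mathcomp Require Import all_boot all_order all_algebra.
From mathcomp Require Import all_classical all_reals topology normedtype.
Import Order.TTheory GRing.Theory Num.Theory.
Import numFieldTopology.Exports numFieldNormedType.Exports.

Set Implicit Arguments.
Unset Strict Implicit.
Unset Printing Implicit Defensive.

Local Open Scope classical_set_scope.
Local Open Scope quotient_scope.
Local Open Scope ring_scope.

(** * CAT(0) and Hadamard spaces *)

Definition edist {R : realType} (u v : R * R) : R :=
  Num.sqrt ((u.1 - v.1) ^+ 2 + (u.2 - v.2) ^+ 2).

Definition segpt {R : realType} (u v : R * R) (l : R) : R * R :=
  (u.1 + l * (v.1 - u.1), u.2 + l * (v.2 - u.2)).

Section CAT0.
Context {R : realType} (X : metricType R).

Definition geodesic (x y : X) (c : R -> X) : Prop :=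
  [/\ c 0 = x, c (mdist x y) = y &
      forall s t, 0 <= s <= mdist x y -> 0 <= t <= mdist x y ->
        mdist (c s) (c t) = `|s - t|].

Definition geodesic_space : Prop := forall x y : X, exists c, geodesic x y c.

(* Since p, q, r are arbitrary, comparing points of the two sides issued from p
   covers every pair of points of a geodesic triangle.  The point of [p, q] at
   distance [l * d(p, q)] from p has [segpt p' q' l] as comparison point. *)
Definition CAT0_inequality : Prop :=
  forall (p q r : X) (cq cr : R -> X) (p' q' r' : R * R) (l m : R),
    geodesic p q cq -> geodesic p r cr ->
    edist p' q' = mdist p q -> edist p' r' = mdist p r ->
    edist q' r' = mdist q r ->
    0 <= l <= 1 -> 0 <= m <= 1 ->
    mdist (cq (l * mdist p q)) (cr (m * mdist p r)) <=
      edist (segpt p' q' l) (segpt p' r' m).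

Definition CAT0 : Prop := geodesic_space /\ CAT0_inequality.

(* [completeType] is not used because it comes with a distinguished point. *)
Definition complete_space : Prop :=
  forall F : set_system X, ProperFilter F -> cauchy F -> exists x : X, F --> x.

Definition Hadamard : Prop := [/\ [set: X] !=set0, complete_space & CAT0].

End CAT0.

(** * Subgroups and quotients of abstract groups *)

Record subgroup (G : groupType) := Subgroup {
  subgroup_set :> set G ;
  subgroup_closed : group_closed [in subgroup_set] }.

Definition generated (G : groupType) (S : set G) : set G :=
  smallest [set A : set G | group_closed [in A]] S.

HB.instance Definition _ (T : choiceType) (A : set T) :=
  SubChoice.copy (set_type A) {x : T | x \in A}.

HB.instance Definition _ (G : groupType) (H : subgroup G) :=
  SubChoice_isSubGroup.Build G [in subgroup_set H] (set_type (subgroup_set H))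
    (subgroup_closed H).

Record nsubgroup (G : groupType) := NSubgroup {
  nsubgroup_sub :> subgroup G ;
  nsubgroup_normal : forall x g : G,
    subgroup_set nsubgroup_sub x -> subgroup_set nsubgroup_sub (x ^ g)%g }.

Section TrivialSubgroup.
Variable G : groupType.

Lemma trivial_group_closed : group_closed [in [set 1%g : G]].
Proof.
split; first by rewrite in_setE.
by move=> x y; rewrite !in_setE => /= -> ->; rewrite mulgV.
Qed.

Lemma trivial_normal (x g : G) : [set 1%g] x -> [set 1%g] (x ^ g)%g.
Proof. by move=> /= ->; rewrite conj1g. Qed.

Definition trivial_nsubgroup : nsubgroup G :=
  @NSubgroup G (Subgroup trivial_group_closed) trivial_normal.

End TrivialSubgroup.

Section QuotientGroup.
Context {G : groupType} (N : nsubgroup G).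

Definition coset_rel (x y : G) : bool := (x^-1 * y)%g \in (N : set G).

Lemma coset_rel_equiv : equiv_class_of coset_rel.
Proof.
have [N1 ND] := subgroup_closed N.
have NV x : x \in (N : set G) -> (x^-1)%g \in (N : set G).
  by move=> Nx; rewrite -[(x^-1)%g]mul1g; exact: ND.
split=> [x|x y|y x z]; rewrite /coset_rel.
- by rewrite mulVg.
- by apply/idP/idP => /NV; rewrite invgM invgK.
- move=> Nxy Nyz; have := ND _ _ Nxy (NV _ Nyz).
  by rewrite invgK mulgA mulgK.
Qed.

Canonical coset_rel_equiv_rel := EquivRelPack coset_rel_equiv.
Canonical coset_rel_encModRel := defaultEncModRel coset_rel.

Definition quotg := {eq_quot coset_rel}.

HB.instance Definition _ : EqQuotient G coset_rel quotg := EqQuotient.on quotg.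
HB.instance Definition _ := Choice.on quotg.

Lemma quotgP (x y : G) :
  reflect (x = y %[mod quotg]) ((x^-1 * y)%g \in (N : set G)).
Proof. by apply: (iffP idP) => [?|/eqP]; [apply/eqP|]; rewrite piE. Qed.

Definition quotg_one : quotg := lift_cst quotg 1%g.
Definition quotg_mul : quotg -> quotg -> quotg :=
  lift_op2 quotg (fun x y : G => (x * y)%g).
Definition quotg_inv : quotg -> quotg := lift_op1 quotg (fun x : G => (x^-1)%g).

Lemma pi_quotg_mul : {morph \pi_quotg : x y / (x * y)%g >-> quotg_mul x y}.
Proof.
move=> x y; unlock quotg_mul; apply/quotgP.
set x' := repr _; set y' := repr _.
have [N1 ND] := subgroup_closed N.
have NV z : z \in (N : set G) -> (z^-1)%g \in (N : set G).
  by move=> Nz; rewrite -[(z^-1)%g]mul1g; exact: ND.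
have Nx : (x^-1 * x')%g \in (N : set G) by apply/quotgP; rewrite reprK.
have Ny : (y^-1 * y')%g \in (N : set G) by apply/quotgP; rewrite reprK.
have Nxy : ((x^-1 * x') ^ y)%g \in (N : set G).
  by rewrite in_setE; apply: nsubgroup_normal; rewrite -in_setE.
have := ND _ _ Nxy (NV _ Ny).
by rewrite invgK /conjg invgM -!mulgA mulVKg.
Qed.

Lemma quotg_mulA : associative quotg_mul.
Proof.
move=> x y z; rewrite -[x]reprK -[y]reprK -[z]reprK.
by rewrite -!pi_quotg_mul mulgA.
Qed.

Lemma quotg_mul1 : left_id quotg_one quotg_mul.
Proof.
by move=> x; unlock quotg_one; rewrite -[x]reprK -pi_quotg_mul mul1g.
Qed.

Lemma quotg_mulr1 : right_id quotg_one quotg_mul.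
Proof.
by move=> x; unlock quotg_one; rewrite -[x]reprK -pi_quotg_mul mulg1.
Qed.

Lemma quotg_mulV : left_inverse quotg_one quotg_inv quotg_mul.
Proof.
move=> x; unlock quotg_one quotg_inv.
by rewrite -[X in quotg_mul _ X]reprK -pi_quotg_mul mulVg.
Qed.

Lemma quotg_mulrV : right_inverse quotg_one quotg_inv quotg_mul.
Proof.
move=> x; unlock quotg_one quotg_inv.
by rewrite -[X in quotg_mul X _]reprK -pi_quotg_mul mulgV.
Qed.

HB.instance Definition _ := isGroup.Build quotg
  quotg_mulA quotg_mul1 quotg_mulr1 quotg_mulV quotg_mulrV.

End QuotientGroup.

Definition virtually_abelian (Q : groupType) : Prop :=
  exists A : subgroup Q,
    {in (A : set Q) &, forall x y : Q, commute x y} /\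
    finite_set (range (fun g : Q => [set (g * a)%g | a in (A : set Q)])).

(** * Topological groups *)

HB.mixin Record Topological_isTopologicalGroup G
    of Topological G & Group G := {
  mulg_continuous : continuous (fun x : G * G => (x.1 * x.2)%g) ;
  invg_continuous : continuous (fun x : G => (x^-1)%g) }.

#[short(type="topologicalGroupType")]
HB.structure Definition TopologicalGroup :=
  {G of Topological G & Group G & Topological_isTopologicalGroup G}.

Section SubgroupTopology.
Context {G : topologicalGroupType} (H : subgroup G).
Local Notation T := (set_type (subgroup_set H)).

Let continuous_val (S : topologicalType) (f : S -> T) :
  continuous (val \o f : S -> G) -> continuous f.
Proof.
move=> /continuousP vf; apply/continuousP => _ [V oV <-].
by rewrite -comp_preimage; exact: vf.
Qed.

Let val_cvg (x : T) : (val : T -> G) @ x --> val x.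
Proof. exact: initial_continuous. Qed.

Lemma subgroup_mulg_continuous : continuous (fun x : T * T => (x.1 * x.2)%g).
Proof.
apply: continuous_val => x.
apply: (@continuous_comp _ _ _ (fun x : T * T => (val x.1, val x.2) : G * G)
  (fun x => (x.1 * x.2)%g)); last exact: mulg_continuous.
apply: cvg_pair; apply: continuous_comp.
- exact: cvg_fst.
- exact: val_cvg.
- exact: cvg_snd.
- exact: val_cvg.
Qed.

Lemma subgroup_invg_continuous : continuous (fun x : T => (x^-1)%g).
Proof.
apply: continuous_val => x.
apply: (@continuous_comp _ _ _ (val : T -> G) (fun x => (x^-1)%g)).
  exact: val_cvg.
exact: invg_continuous.
Qed.

HB.instance Definition _ := Topological_isTopologicalGroup.Build T
  subgroup_mulg_continuous subgroup_invg_continuous.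

End SubgroupTopology.

Definition top_loc_finite (G : topologicalGroupType) (H : set G) : Prop :=
  forall S : set G, finite_set S -> S `<=` H -> compact (closure (generated S)).

Definition is_LF_radical (G : topologicalGroupType) (N : nsubgroup G) : Prop :=
  top_loc_finite N /\
  forall M : nsubgroup G, top_loc_finite M -> (M : set G) `<=` N.

(* The maximal normal topologically locally finite subgroup exists in every
   locally compact group; the default value is for the other groups. *)
Definition LF_radical (G : topologicalGroupType) : nsubgroup G :=
  if pselect (exists N : nsubgroup G, is_LF_radical N) is left radP
  then sval (cid radP) else trivial_nsubgroup G.

Definition bounded_continuous (R : realType) (T : topologicalType)
    (f : T -> R) : Prop :=
  continuous f /\ exists M : R, forall x, `|f x| <= M.

(* For locally compact groups, the existence of a left-invariant mean on bounded
   continuous functions is equivalent to that of one on [L^oo]. *)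
Definition amenable (R : realType) (G : topologicalGroupType) : Prop :=
  exists mean : (G -> R) -> R, [/\
    forall (a : R) f g, bounded_continuous f -> bounded_continuous g ->
      mean (fun x => a * f x + g x) = a * mean f + mean g,
    forall f, bounded_continuous f -> (forall x, 0 <= f x) -> 0 <= mean f,
    mean (fun=> 1) = 1 &
    forall f (h : G), bounded_continuous f ->
      mean (fun x => f (h * x)%g) = mean f].

(** * Group actions *)

Record isometric_action (R : realType) (G : topologicalGroupType)
    (X : metricType R) := IsometricAction {
  act :> G -> X -> X ;
  act1 : forall x, act 1%g x = x ;
  actM : forall g h x, act (g * h)%g x = act g (act h x) ;
  act_isometry : forall g x y, mdist (act g x) (act g y) = mdist x y ;
  act_continuous : continuous (fun p : G * X => act p.1 p.2) }.

Section Action.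
Context {R : realType} {G : topologicalGroupType} {X : metricType R}.
Variable a : isometric_action G X.

Definition proper_action : Prop :=
  forall C : set X, compact C ->
    compact [set g : G | (a g @` C) `&` C !=set0].

Definition orbit_rel (x y : X) : bool := `[< exists g : G, a g x = y >].

Lemma orbit_rel_equiv : equiv_class_of orbit_rel.
Proof.
have aV g x y : a g x = y -> a g^-1%g y = x.
  by move=> <-; rewrite -actM mulVg act1.
split=> [x|x y|y x z].
- by apply/asboolP; exists 1%g; exact: act1.
- by apply/asboolP/asboolP => -[g /aV gxy]; exists g^-1%g.
- move=> /asboolP[g <-] /asboolP[h <-].
  by apply/asboolP; exists (h * g)%g; rewrite actM.
Qed.

Canonical orbit_rel_equiv_rel := EquivRelPack orbit_rel_equiv.
Canonical orbit_rel_encModRel := defaultEncModRel orbit_rel.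

Definition orbit_space := quotient_topology {eq_quot orbit_rel}.

Definition cocompact_action : Prop := compact [set: orbit_space].

End Action.

(* Main.v *)
Require Import Defs.
From mathcomp Require Import all_boot all_order all_algebra.
From mathcomp Require Import all_classical all_reals topology normedtype.
From mathcomp Require Import sequences derive.
From mathcomp Require Import ring lra.
Import Order.TTheory GRing.Theory Num.Theory.
Import numFieldTopology.Exports numFieldNormedType.Exports.

(* Suppose that H is amenable.  Among all pairs of a pointwise limit phi : H -> G
   of conjugates of the inclusion and a flat whose points are moved by phi(H), up
   to a rotation of the flat, by no more than its origin, choose one of maximal
   dimension and minimal displacement.  The union of the flats parallel to the
   chosen one is a product of R^k by a convex set Y on which H acts, and the
   invariant mean turns d(x, y) into a convex function on Y that H preserves up
   to constants.  Either its resolvents displace a point arbitrarily far, which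
   by minimality yields a limit configuration of dimension k + 1; or it attains
   its minimum on a set containing a flat, which again raises k, unless H has a
   bounded orbit.  So phi(H) fixes a point of Y, i.e. it preserves a flat R^k.
   Because G is totally disconnected, the isometries of R^k induced by phi(H)
   form a discrete group, so that those with small rotation part commute, as in
   the proof of Bieberbach's theorem.  The kernel is topologically locally
   finite, because finitely many of its elements have conjugates in a compact
   open subgroup of G, and so is its closure, which is open.
   Conversely, topologically locally finite groups and abelian groups carry
   invariant means obtained as limits of finite averages, and these are composed
   along the extension. *)

Set Implicit Arguments.
Unset Strict Implicit.
Unset Printing Implicit Defensive.

Local Open Scope classical_set_scope.
Local Open Scope ring_scope.

(** * CAT(0) geometry *)

(** [H] need not act cocompactly, so a sequence of ever better base points may leave every compact
    set. Cocompactness of [G] brings these points back, at the price of conjugating; this is why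
    pairs of a limit [phi] of conjugates and a flat are considered, which are stable under
    ultralimits. Such a [phi] is a homomorphism of abstract groups that may fail to be continuous,
    injective or proper. Two devices compensate. A compact open subgroup [U] of [H] fixes the base
    point of every configuration, so orbit maps are locally constant and a mean on the bounded
    continuous functions of [H] integrates every bounded function on an orbit. And on each finite
    set [phi] is close to a conjugate of the inclusion, which is all that topological local
    finiteness asks for. No boundary at infinity is built: ultrafilters on [X] containing all sets
    of full measure play the role of the boundary points in the support of the mean. Dimensions are
    bounded by counting 1-separated points in unit balls. *)

Lemma eq_ler (R : numDomainType) (x y : R) : x = y -> x <= y.
Proof. by move=> ->. Qed.

Lemma comparison_triangle (R : realType) (a b c : R) :
  0 <= a -> 0 <= b -> 0 <= c -> a <= b + c -> b <= a + c -> c <= a + b ->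
  exists p q r : R * R, [/\ Defs.edist p q = a, Defs.edist p r = b & Defs.edist q r = c].
Proof.
move=> a0 b0 c0 abc bac cab.
have [az|anz] := eqVneq a 0.
  exists (0, 0), (0, 0), (b, 0); have cb : c = b by apply/eqP; rewrite eq_le; apply/andP; split; lra.
  have S (x y z : R) : 0 <= z -> x ^+ 2 + y ^+ 2 = z ^+ 2 -> Num.sqrt (x ^+ 2 + y ^+ 2) = z.
    by move=> z0 ->; rewrite sqrtr_sqr ger0_norm.
  by split; rewrite /Defs.edist /=; apply: S => //; rewrite ?az ?cb; ring.
have a_gt0 : 0 < a by rewrite lt_neqAle eq_sym anz.
(* Abscissa of the third vertex, by the law of cosines; its ordinate is real because Heron's product
   below is nonnegative. *)
pose u := (a ^+ 2 + b ^+ 2 - c ^+ 2) / (2 * a).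
have uE : u * (2 * a) = a ^+ 2 + b ^+ 2 - c ^+ 2 by rewrite /u mulfVK// mulf_neq0// pnatr_eq0.
have vP : 0 <= b ^+ 2 - u ^+ 2.
  rewrite subr_ge0 -(ler_pM2r (_ : 0 < (2 * a) ^+ 2)); last by rewrite exprn_gt0//; lra.
  rewrite -!exprMn uE.
  have : 0 <= (2 * a * b - (a ^+ 2 + b ^+ 2 - c ^+ 2)) * (2 * a * b + (a ^+ 2 + b ^+ 2 - c ^+ 2)).
    apply: mulr_ge0.
      have -> : 2 * a * b - (a ^+ 2 + b ^+ 2 - c ^+ 2) = (c - (a - b)) * (c + (a - b)) by ring.
      by apply: mulr_ge0; lra.
    have -> : 2 * a * b + (a ^+ 2 + b ^+ 2 - c ^+ 2) = (a + b - c) * (a + b + c) by ring.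
    by apply: mulr_ge0; lra.
  move=> h; rewrite -subr_ge0.
  by have -> : (b * (2 * a)) ^+ 2 - (a ^+ 2 + b ^+ 2 - c ^+ 2) ^+ 2 = (2 * a * b - (a ^+ 2 + b ^+ 2 - c ^+ 2)) * (2 * a * b + (a ^+ 2 + b ^+ 2 - c ^+ 2)) by ring.
exists (0, 0), (a, 0), (u, Num.sqrt (b ^+ 2 - u ^+ 2)); rewrite /Defs.edist /=.
have S (z w : R) : 0 <= z -> w = z ^+ 2 -> Num.sqrt w = z.
  by move=> z0 ->; rewrite sqrtr_sqr ger0_norm.
by split; apply: S => //; rewrite ?sub0r ?sqrrN ?sqr_sqrtr//; lra.
Qed.

Section Hadamard.
Context {R : realType} {X : metricType R}.
Hypothesis X_Hadamard : Hadamard X.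
Implicit Types (x y z p q r : X) (t s : R).
Local Notation d := (@mdist R X).

Let geodesic_exists x y : exists c, geodesic x y c.
Proof. by case: X_Hadamard => _ _ []. Qed.

(** Parametrised on [0, 1] proportionally to arc length. By [geo_unique] the chosen geodesic is the
    only one. *)
Definition geo x y t : X := sval (cid (geodesic_exists x y)) (t * d x y).

Let geoP x y : geodesic x y (sval (cid (geodesic_exists x y))).
Proof. exact: svalP. Qed.

Let inseg t x y : 0 <= t <= 1 -> 0 <= t * d x y <= d x y.
Proof.
by move=> /andP[t0 t1]; rewrite mulr_ge0 ?mdist_ge0//= ler_piMl ?mdist_ge0.
Qed.

Lemma geo_dist x y s t : 0 <= s <= 1 -> 0 <= t <= 1 ->
  d (geo x y s) (geo x y t) = `|s - t| * d x y.
Proof.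
move=> s01 t01; have [_ _ ->] := geoP x y; rewrite ?inseg//.
by rewrite -mulrBl normrM (ger0_norm (mdist_ge0 _ _)).
Qed.

Lemma geo0 x y : geo x y 0 = x.
Proof. by rewrite /geo mul0r; case: (geoP x y). Qed.

Lemma geo1 x y : geo x y 1 = y.
Proof. by rewrite /geo mul1r; case: (geoP x y). Qed.

Lemma geo_distl x y t : 0 <= t <= 1 -> d x (geo x y t) = t * d x y.
Proof.
move=> t01; have := @geo_dist x y 0 t; rewrite geo0 lexx ler01 => -> //.
by rewrite sub0r normrN ger0_norm//; case/andP: t01.
Qed.

Lemma geo_distr x y t : 0 <= t <= 1 -> d (geo x y t) y = (1 - t) * d x y.
Proof.
move=> t01; have := @geo_dist x y t 1; rewrite geo1 lexx ler01 => -> //.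
by rewrite distrC ger0_norm// subr_ge0; case/andP: t01.
Qed.

Let comparison_inequality p q r l m : 0 <= l <= 1 -> 0 <= m <= 1 ->
  exists p' q' r' : R * R, [/\ Defs.edist p' q' = d p q, Defs.edist p' r' = d p r,
    Defs.edist q' r' = d q r &
    d (geo p q l) (geo p r m) <= Defs.edist (segpt p' q' l) (segpt p' r' m)].
Proof.
move=> l01 m01.
have [p' [q' [r' [pq pr qr]]]] := @comparison_triangle R (d p q) (d p r) (d q r)
  (mdist_ge0 _ _) (mdist_ge0 _ _) (mdist_ge0 _ _)
  ltac:(by rewrite [d q r]metric_sym metric_triangle)
  ltac:(by rewrite metric_triangle)
  ltac:(by rewrite [d p q]metric_sym metric_triangle).
exists p', q', r'; split => //.
by case: X_Hadamard => _ _ [_ /(_ p q r)]; apply=> //; exact: geoP.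
Qed.

Lemma geo_convex_from p q r t : 0 <= t <= 1 ->
  d (geo p q t) (geo p r t) <= t * d q r.
Proof.
move=> t01; have [p' [q' [r' [_ _ <- /le_trans]]]] := comparison_inequality p q r t01 t01.
apply; rewrite /Defs.edist /segpt /=.
set e := (X in Num.sqrt X <= _).
have -> : e = t ^+ 2 * ((q'.1 - r'.1) ^+ 2 + (q'.2 - r'.2) ^+ 2) by rewrite /e; ring.
by rewrite sqrtrM ?sqr_ge0// sqrtr_sqr ger0_norm//; case/andP: t01.
Qed.

Let edist_sqr (u v : R * R) : Defs.edist u v ^+ 2 = (u.1 - v.1) ^+ 2 + (u.2 - v.2) ^+ 2.
Proof. by rewrite sqr_sqrtr// addr_ge0// sqr_ge0. Qed.

(** Stewart's identity in the comparison triangle; for [t] = 1/2 this is the CN inequality of Bruhat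
    and Tits. *)
Lemma CN z x y t : 0 <= t <= 1 ->
  d z (geo x y t) ^+ 2 <=
    (1 - t) * d z x ^+ 2 + t * d z y ^+ 2 - t * (1 - t) * d x y ^+ 2.
Proof.
move=> t01; have o01 : 0 <= (1 : R) <= 1 by rewrite ler01 lexx.
have [p' [q' [r' [pq pr qr h]]]] := comparison_inequality x y z t01 o01.
rewrite geo1 [X in X <= _]metric_sym in h.
apply: (@le_trans _ _ (Defs.edist (segpt p' q' t) (segpt p' r' 1) ^+ 2)).
  by rewrite ler_sqr ?nnegrE ?mdist_ge0 ?sqrtr_ge0// metric_sym.
rewrite [d z x]metric_sym [d z y]metric_sym -pq -pr -qr !edist_sqr /=.
apply: eq_ler; rewrite /=; ring.
Qed.

Lemma geo_unique x y p t : 0 <= t <= 1 ->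
  d x p = t * d x y -> d p y = (1 - t) * d x y -> p = geo x y t.
Proof.
move=> t01 xp py; apply: mdist_positivity; apply/eqP.
rewrite -sqrf_eq0 eq_le sqr_ge0 andbT (le_trans (CN _ _ _ t01))//.
by rewrite [d p x]metric_sym xp py; apply: eq_ler; ring.
Qed.

Lemma geo_sym x y t : 0 <= t <= 1 -> geo x y t = geo y x (1 - t).
Proof.
move=> t01; have t01' : 0 <= 1 - t <= 1 by case/andP: t01 => *; apply/andP; split; lra.
apply: geo_unique => //; first by rewrite metric_sym geo_distr// [d y x]metric_sym.
by rewrite metric_sym geo_distl// subKr metric_sym.
Qed.

Lemma geo_convex x y x' y' t : 0 <= t <= 1 ->
  d (geo x y t) (geo x' y' t) <= (1 - t) * d x x' + t * d y y'.
Proof.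
move=> t01; have t01' : 0 <= 1 - t <= 1 by case/andP: t01 => *; apply/andP; split; lra.
apply: (le_trans (metric_triangle _ (geo x y' t) _)); rewrite addrC lerD//.
  by rewrite !(geo_sym _ y')// geo_convex_from.
exact: geo_convex_from.
Qed.

Lemma geo_dist_convex z x y t : 0 <= t <= 1 ->
  d z (geo x y t) <= (1 - t) * d z x + t * d z y.
Proof.
move=> t01; have zz : z = geo z z t by apply: geo_unique => //; rewrite mdistxx mulr0.
by rewrite [X in d X _ <= _]zz; exact: geo_convex.
Qed.

(* The inequality [CN] at the point of [x2, x4] dividing it in the ratio
   d(x1, x2) : d(x3, x4), seen from x1 and from x3. *)
Lemma four_point x1 x2 x3 x4 :
  d x1 x3 ^+ 2 + d x2 x4 ^+ 2 <=
    d x1 x4 ^+ 2 + d x2 x3 ^+ 2 + 2 * d x1 x2 * d x3 x4.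
Proof.
have [/mdist_positivity ->|a0] := eqVneq (d x1 x2) 0.
  by rewrite mdistxx mulr0 mul0r addr0 addrC.
have [/mdist_positivity ->|c0] := eqVneq (d x3 x4) 0.
  by rewrite mdistxx mulr0 addr0.
have {}a0 : 0 < d x1 x2 by rewrite lt_neqAle eq_sym a0 mdist_ge0.
have {}c0 : 0 < d x3 x4 by rewrite lt_neqAle eq_sym c0 mdist_ge0.
set a := d x1 x2 in a0 *; set c := d x3 x4 in c0 *.
pose t := a / (a + c); have ac0 : 0 < a + c by exact: addr_gt0.
have tE : t * (a + c) = a by rewrite /t mulfVK// gt_eqF.
have t0 : 0 < t by rewrite divr_gt0.
have t1 : t < 1 by rewrite ltr_pdivrMr// mul1r ltrDl.
have t01 : 0 <= t <= 1 by rewrite !ltW.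
have h1 := CN x1 x2 x4 t01; have h3 := CN x3 x2 x4 t01.
have h13 : d x1 x3 <= d x1 (geo x2 x4 t) + d x3 (geo x2 x4 t).
  by rewrite [d x3 _]metric_sym metric_triangle.
rewrite -/a [d x3 x2]metric_sym -/c in h1 h3.
set u := d x1 (geo _ _ _) in h1 h13; set v := d x3 (geo _ _ _) in h3 h13.
have {}h13 : t * (1 - t) * d x1 x3 ^+ 2 <= (1 - t) * u ^+ 2 + t * v ^+ 2.
  apply: (@le_trans _ _ (t * (1 - t) * (u + v) ^+ 2)).
    rewrite ler_wpM2l//; first by rewrite mulr_ge0 ?subr_ge0 ?(ltW t0) ?(ltW t1).
    by rewrite ler_sqr// nnegrE ?addr_ge0 ?mdist_ge0.
  by rewrite -subr_ge0; have := sqr_ge0 ((1 - t) * u - t * v); congr (_ <= _); ring.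
have s0 : 0 < 1 - t by rewrite subr_gt0.
have k : (1 - t) * a = t * c by move: tE; rewrite mulrDr mulrBl mul1r; lra.
have e : (1 - t) ^+ 2 * a ^+ 2 + t ^+ 2 * c ^+ 2 = 2 * a * c * (t * (1 - t)).
  have -> : (1 - t) ^+ 2 * a ^+ 2 + t ^+ 2 * c ^+ 2 = ((1 - t) * a) * ((1 - t) * a) + (t * c) * (t * c) by ring.
  by rewrite [in X in X + _]k -[in X in (t * c) * X + _]k -[in X in _ + X * _]k; ring.
have h1' := ler_wpM2l (ltW s0) h1; have h3' := ler_wpM2l (ltW t0) h3.
rewrite -(ler_pM2l (_ : 0 < t * (1 - t))); last exact: mulr_gt0.
rewrite mulrDr; set A := d x1 x3 in h13 *; set B := d x2 x4 in h1' h3' *.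
have : t * (1 - t) * A ^+ 2 <= (1 - t) ^+ 2 * a ^+ 2 + t ^+ 2 * c ^+ 2 +
   t * (1 - t) * (d x1 x4 ^+ 2 + d x2 x3 ^+ 2 - B ^+ 2).
  apply: le_trans h13 _; apply: le_trans (lerD h1' h3') _; apply: eq_ler; ring.
rewrite e -lerBrDr => /le_trans; apply; apply: eq_ler; ring.
Qed.

End Hadamard.

(** * Limits along filters and ultrafilters *)

Lemma cvg_le_to (R : realType) (I : Type) (F : set_system I) {FF : ProperFilter F}
    (f g : I -> R) (a b : R) :
  f i @[i --> F] --> a -> g i @[i --> F] --> b ->
  (\forall i \near F, f i <= g i) -> a <= b.
Proof.
move=> fa gb fg; rewrite -subr_ge0.
apply: (@cvgr_to_ge _ F _ _ (fun i => g i - f i)); first exact: cvgB.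
by near=> i; rewrite subr_ge0; near: i.
Unshelve. all: by end_near. Qed.

Lemma cvg_mdist_lt (R : realType) (X : metricType R) (I : Type) (F : set_system I)
    {FF : ProperFilter F} (u : I -> X) (l : X) (e : R) :
  u i @[i --> F] --> l -> 0 < e -> \forall i \near F, mdist l (u i) < e.
Proof. by move=> ul e0; exact: (metricType_numDomainType.cvgr_dist_lt ul). Qed.

Lemma cvg_mdist_le (R : realType) (X : metricType R) (I : Type) (F : set_system I)
    {FF : ProperFilter F} (u : I -> X) (l : X) (e : R) :
  u i @[i --> F] --> l -> 0 < e -> \forall i \near F, mdist l (u i) <= e.
Proof. by move=> ul e0; exact: (metricType_numDomainType.cvgr_dist_le ul). Qed.

Lemma mdist_cvg (R : realType) (X : metricType R) (I : Type) (F : set_system I)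
    {FF : ProperFilter F} (u v : I -> X) (l m : X) :
  u i @[i --> F] --> l -> v i @[i --> F] --> m ->
  mdist (u i) (v i) @[i --> F] --> mdist l m.
Proof.
move=> ul vm; apply/cvgrPdist_le => e e0.
have e2 : 0 < e / 2 by rewrite divr_gt0.
have Hu := cvg_mdist_le ul e2; have Hv := cvg_mdist_le vm e2.
near=> i; have hu : mdist l (u i) <= e / 2 by near: i; exact: Hu.
have hv : mdist m (v i) <= e / 2 by near: i; exact: Hv.
have t1 := metric_triangle l (u i) m; have t2 := metric_triangle (u i) (v i) m.
have t3 := metric_triangle (u i) l (v i); have t4 := metric_triangle l m (v i).
rewrite [mdist (v i) m]metric_sym in t2; rewrite [mdist (u i) l]metric_sym in t3.
by rewrite ler_norml; apply/andP; split; lra.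
Unshelve. all: by end_near. Qed.

Lemma fmap_ultra (I T : Type) (F : set_system I) (f : I -> T) :
  UltraFilter F -> UltraFilter (f @ F).
Proof.
move=> FU; split; first exact: fmap_proper_filter.
move=> G GP FG; apply/seteqP; split => // A GA.
have [//|FnA] := in_ultra_setVsetC (f @^-1` A) FU.
have GnA : G (~` A) by exact: FG.
have : G set0 by rewrite -(setICr A); exact: filterI.
by move=> /filter_not_empty.
Qed.

Lemma compact_ultra_cvg (I : Type) (T : topologicalType) (F : set_system I)
    (f : I -> T) (K : set T) :
  UltraFilter F -> compact K -> (\forall i \near F, K (f i)) ->
  exists2 l, K l & f i @[i --> F] --> l.
Proof.
rewrite compact_ultra => FU cK FK.
by have [l [Kl Fl]] := cK _ (fmap_ultra f FU) FK; exists l.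
Qed.

Lemma bounded_ultra_cvg (R : realType) (I : Type) (F : set_system I)
    (f : I -> R) (M : R) :
  UltraFilter F -> (\forall i \near F, `|f i| <= M) ->
  exists2 l : R, `|l| <= M & f i @[i --> F] --> l.
Proof.
move=> FU fM.
have [l lM fl] : exists2 l, `[-M, M]%classic l & f i @[i --> F] --> l.
  apply: compact_ultra_cvg; first exact: segment_compact.
  by near=> i; rewrite /= in_itv /= -ler_norml; near: i.
by exists l => //; move: lM; rewrite /= in_itv /= -ler_norml.
Unshelve. all: by end_near. Qed.

Lemma cvg_to_eq (R : realType) (I : Type) (F : set_system I) {FF : ProperFilter F}
    (f : I -> R) (a b : R) :
  f i @[i --> F] --> a -> (\forall i \near F, f i = b) -> a = b.
Proof.
move=> fa fb; apply/eqP; rewrite eq_le; apply/andP; split.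
  by apply: (cvgr_to_le fa); near=> i; rewrite (near fb i).
by apply: (cvgr_to_ge fa); near=> i; rewrite (near fb i).
Unshelve. all: by end_near. Qed.

Lemma cvg_sumr (R : realType) (I J : Type) (F : set_system I) {FF : Filter F}
    (r : seq J) (f : J -> I -> R) (a : J -> R) :
  (forall j, f j i @[i --> F] --> a j) ->
  \sum_(j <- r) f j i @[i --> F] --> \sum_(j <- r) a j.
Proof.
move=> fa; elim: r => [|j r IH].
  rewrite big_nil (_ : (fun i => _) = fun=> 0); first exact: cvg_cst.
  by apply/funext => i; rewrite big_nil.
rewrite big_cons (_ : (fun i => _) = fun i => f j i + \sum_(k <- r) f k i).
  exact: cvgD.
by apply/funext => i; rewrite big_cons.
Qed.

(** * Convex functions on the line *)

Lemma convex_bounded_nonincreasing (R : realType) (g : R -> R) (M : R) :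
  (forall a b t, 0 <= a -> 0 <= b -> 0 <= t <= 1 ->
    g ((1 - t) * a + t * b) <= (1 - t) * g a + t * g b) ->
  (forall a, 0 <= a -> g a <= M) ->
  forall a b, 0 <= a -> a <= b -> g b <= g a.
Proof.
move=> gc gM a b a0 ab.
have [->//|ba] := eqVneq a b; have {}ab : a < b by rewrite lt_neqAle ba ab.
(* [b] is the point at parameter [t] of a segment from [a] to a far point [c], at which [g] is at
   most [M]. *)
have key t : 0 < t <= 1 -> g b - g a <= t * (M - g a).
  move=> /andP[t0 t1]; pose c := a + (b - a) / t.
  have ca : a <= c by rewrite lerDl divr_ge0 ?subr_ge0 ?ltW.
  have -> : b = (1 - t) * a + t * c by rewrite /c; field; rewrite gt_eqF.
  have t01 : 0 <= t <= 1 by rewrite (ltW t0).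
  have := gc a c t a0 (le_trans a0 ca) t01.
  have := ler_wpM2l (ltW t0) (gM c (le_trans a0 ca)).
  by lra.
rewrite -subr_le0; apply/ler_addgt0Pr => e e0; rewrite add0r.
have P0 : 0 <= M - g a by rewrite subr_ge0 gM.
pose t := Num.min 1 (e / (M - g a + 1)).
have Q0 : 0 < M - g a + 1 by lra.
have t0 : 0 < t by rewrite lt_min ltr01 divr_gt0.
apply: le_trans (key t _) _; first by rewrite t0 ge_min lexx.
apply: (@le_trans _ _ (e / (M - g a + 1) * (M - g a))).
  by rewrite ler_wpM2r// ge_min lexx orbT.
by rewrite mulrAC ler_pdivrMr// ler_wpM2l ?(ltW e0)//; lra.
Qed.

Lemma convex_bounded_constant (R : realType) (g : R -> R) (M : R) :
  (forall a b t, 0 <= t <= 1 ->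
    g ((1 - t) * a + t * b) <= (1 - t) * g a + t * g b) ->
  (forall a, g a <= M) -> forall a b, g a = g b.
Proof.
move=> gc gM.
have le a b : g b <= g a.
  wlog ab : g gc gM a b / a <= b.
    move=> H; have [/H|ba] := leP a b; first exact.
    have := H (fun s => g (- s)) _ _ (- a) (- b); rewrite !opprK lerN2; apply.
    - by move=> s t u u01; rewrite opprD -!mulrN gc.
    - by move=> s; exact: gM.
    - exact: ltW.
  have := @convex_bounded_nonincreasing R (fun s => g (a + s)) M _ _ 0 (b - a).
  rewrite addr0 addrCA subrr addr0; apply => //; last by rewrite subr_ge0.
  move=> s t u _ _ u01.
  have -> : a + ((1 - u) * s + u * t) = (1 - u) * (a + s) + u * (a + t) by ring.
  exact: gc.
by move=> a b; apply/eqP; rewrite eq_le !le.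
Qed.

(** Convexity at the midpoint of [a] and [- a] gives the opposite of the last hypothesis, so [L] is
    odd; the convexity inequality, applied to [t] and to [- t], then becomes an equality. *)
Lemma convex_odd_linear (R : realType) (L : R -> R) :
  (forall a b t, 0 <= t <= 1 ->
    L ((1 - t) * a + t * b) <= (1 - t) * L a + t * L b) ->
  L 0 = 0 -> (forall a, L a + L (- a) <= 0) -> forall a, L a = a * L 1.
Proof.
move=> Lc L0 Lo.
have LN a : L (- a) = - L a.
  have h01 : 0 <= (2^-1 : R) <= 1 by apply/andP; split; lra.
  have := Lc a (- a) 2^-1 h01; have -> : (1 - 2^-1) * a + 2^-1 * - a = 0 by field.
  by rewrite L0 => h; have := Lo a; lra.
have Ls s t : 0 <= s <= 1 -> L (s * t) = s * L t.
  move=> s01; have h1 := Lc 0 t s s01; have h2 := Lc 0 (- t) s s01.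
  rewrite L0 !(mulr0, add0r) in h1; rewrite L0 !(mulr0, add0r) mulrN !LN mulrN lerN2 in h2.
  by apply/eqP; rewrite eq_le h1.
have Lp a : 0 <= a -> L a = a * L 1.
  move=> a0; have [a1|a1] := leP a 1; first by rewrite -[in LHS](mulr1 a) Ls ?a0.
  have an0 : a != 0 by rewrite gt_eqF// (lt_trans ltr01).
  have : L (a^-1 * a) = a^-1 * L a by apply: Ls; rewrite invr_ge0 a0 invf_le1 ?ltW// (lt_trans ltr01).
  by rewrite mulVf// => ->; rewrite mulrA divff// mul1r.
move=> a; have [/Lp//|/ltW a0] := leP 0 a.
by rewrite -[in LHS](opprK a) LN Lp ?oppr_ge0// mulNr opprK.
Qed.

(** As [s] grows, [u s] is [s + al / 2 + o(1)] and [w s] is [s + al' / 2 + o(1)]. In this way the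
    linear coefficients of squared distances along rays are compared like Busemann functions,
    without limits of distances. *)
Lemma quadratic_asymptotics (R : realType) (u w : R -> R) (D al c al' c' : R) :
  (forall s, 0 <= s -> 0 <= u s) -> (forall s, 0 <= s -> 0 <= w s) ->
  (forall s, 0 <= s -> u s ^+ 2 = s ^+ 2 + al * s + c) ->
  (forall s, 0 <= s -> w s ^+ 2 = s ^+ 2 + al' * s + c') ->
  (forall s, 0 <= s -> u s <= w s + D) -> al <= al' + 2 * D.
Proof.
move=> u0 w0 uE wE uw; rewrite leNgt; apply/negP => gap.
pose eta := al - al' - 2 * D; have eta0 : 0 < eta by rewrite /eta; lra.
pose K := `|al'| + `|c'|.
have wK s : 1 <= s -> `|w s - s| <= K.
  move=> s1; have s0 : 0 <= s by exact: le_trans s1.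
  have ws : 1 <= w s + s by have := w0 s s0; lra.
  have wss : (w s - s) * (w s + s) = al' * s + c'.
    by rewrite -subr_sqr wE//; ring.
  have : `|w s - s| * (w s + s) <= K * (w s + s).
    rewrite -[X in _ * X <= _]ger0_norm ?(le_trans _ ws)// -normrM wss /K mulrDl.
    apply: le_trans (ler_normD _ _) _; rewrite normrM (ger0_norm s0); apply: lerD.
      by rewrite ler_wpM2l// lerDr w0.
    by rewrite ler_peMr.
  by rewrite ler_pM2r// (lt_le_trans ltr01).
(* At this [s] the term [eta * s] exceeds everything that stays bounded in the squared
   inequality. *)
pose s := 1 + (2 * `|D| * K + `|c'| + D ^+ 2 + `|c|) / eta.
have N0 : 0 <= 2 * `|D| * K + `|c'| + D ^+ 2 + `|c|.
  by rewrite !addr_ge0 ?sqr_ge0// !mulr_ge0// addr_ge0.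
have s1 : 1 <= s by rewrite lerDl divr_ge0// ltW.
have s0 : 0 <= s by exact: le_trans s1.
have h : u s ^+ 2 <= (w s + D) ^+ 2.
  by rewrite ler_sqr ?nnegrE ?u0// ?(le_trans (u0 s s0))// uw.
have e : (w s + D) ^+ 2 = w s ^+ 2 + 2 * (D * (w s - s)) + 2 * D * s + D ^+ 2 by ring.
rewrite {}e uE// wE// in h.
have DK : D * (w s - s) <= `|D| * K.
  by apply: le_trans (ler_norm _) _; rewrite normrM ler_wpM2l// wK.
have es : eta * s = eta + (2 * `|D| * K + `|c'| + D ^+ 2 + `|c|).
  by rewrite /s mulrDr mulr1 mulrC mulfVK// gt_eqF.
have c1 := ler_norm (- c); have c2 := ler_norm c'; rewrite normrN in c1.
move: h es DK c1 c2 eta0; rewrite /eta -[2 * `|D| * K]mulrA !mulrBl.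
set DD := D ^+ 2; set s2 := s ^+ 2; set DW := D * _; set aK := `|D| * K; lra.
Qed.

(** * Asymptotic and parallel rays *)

Section Rays.
Context {R : realType} {X : metricType R}.
Hypothesis X_Hadamard : Hadamard X.
Local Notation d := (@mdist R X).
Local Notation geo := (geo X_Hadamard).

Definition is_ray (c : R -> X) := forall s t, 0 <= s -> 0 <= t -> d (c s) (c t) = `|s - t|.

Lemma ray_geo c a b t : is_ray c -> 0 <= a -> 0 <= b -> 0 <= t <= 1 ->
  c ((1 - t) * a + t * b) = geo (c a) (c b) t.
Proof.
move=> cr a0 b0 /[dup] t01 /andP[t0 t1].
have m0 : 0 <= (1 - t) * a + t * b by rewrite addr_ge0// mulr_ge0// subr_ge0.
apply: geo_unique => //; rewrite !cr//.
  have -> : a - ((1 - t) * a + t * b) = t * (a - b) by ring.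
  by rewrite normrM ger0_norm.
have -> : ((1 - t) * a + t * b) - b = (1 - t) * (a - b) by ring.
by rewrite normrM ger0_norm// subr_ge0.
Qed.

Lemma rays_dist_convex c c' a b t : is_ray c -> is_ray c' ->
  0 <= a -> 0 <= b -> 0 <= t <= 1 ->
  d (c ((1 - t) * a + t * b)) (c' ((1 - t) * a + t * b)) <=
    (1 - t) * d (c a) (c' a) + t * d (c b) (c' b).
Proof. by move=> cr cr' a0 b0 t01; rewrite !ray_geo// geo_convex. Qed.

Lemma asymptotic_rays_nonincreasing c c' M : is_ray c -> is_ray c' ->
  (forall s, 0 <= s -> d (c s) (c' s) <= M) ->
  forall a b, 0 <= a -> a <= b -> d (c b) (c' b) <= d (c a) (c' a).
Proof.
move=> cr cr' cM; apply: (@convex_bounded_nonincreasing _ (fun s => d (c s) (c' s)) M) => //.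
by move=> a b t a0 b0 t01; exact: rays_dist_convex.
Qed.

Lemma asymptotic_rays_eq c c' M : is_ray c -> is_ray c' ->
  (forall s, 0 <= s -> d (c s) (c' s) <= M) -> c 0 = c' 0 ->
  forall s, 0 <= s -> c s = c' s.
Proof.
move=> cr cr' cM c0 s s0; apply/mdist_positivity/eqP.
rewrite eq_le mdist_ge0 andbT.
have := @asymptotic_rays_nonincreasing c c' M cr cr' cM 0 s (lexx _) s0.
by rewrite c0 mdistxx.
Qed.

(* Up to the term [(b - a) ^+ 2], the squared distance is a convex function of
   [b - a] by [CN], and it is bounded above by an odd one by [four_point]. *)
Lemma parallel_rays_dist p q : is_ray p -> is_ray q ->
  (forall a b c, 0 <= a -> 0 <= b -> 0 <= c -> d (p (a + c)) (q (b + c)) = d (p a) (q b)) ->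
  exists al, forall a b, 0 <= a -> 0 <= b ->
    d (p a) (q b) ^+ 2 = (b - a) ^+ 2 + al * (b - a) + d (p 0) (q 0) ^+ 2.
Proof.
move=> pr qr pq.
pose G s := if 0 <= s then d (p 0) (q s) ^+ 2 else d (p (- s)) (q 0) ^+ 2.
have GE a b : 0 <= a -> 0 <= b -> d (p a) (q b) ^+ 2 = G (b - a).
  move=> a0 b0; rewrite /G subr_ge0; case: leP => ab.
    by have := pq 0 (b - a) a (lexx _); rewrite add0r subrK => ->//; rewrite subr_ge0.
  by have := pq (a - b) 0 b; rewrite add0r subrK opprB => -> //; rewrite subr_ge0 ltW.
pose L s := G s - s ^+ 2 - G 0.
have LE : forall s, L s = s * L 1.
  apply: convex_odd_linear.
  - move=> a b t /[dup] t01 /andP[t0 t1].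
    pose c := `|a| + `|b|.
    have c0 : 0 <= c by rewrite addr_ge0.
    have ca : 0 <= c + a by have := ler_norm (- a); have := normr_ge0 b; rewrite normrN /c; lra.
    have cb : 0 <= c + b by have := ler_norm (- b); have := normr_ge0 a; rewrite normrN /c; lra.
    have := CN X_Hadamard (p c) (q (c + a)) (q (c + b)) t01.
    rewrite -ray_geo// qr//.
    have -> : (1 - t) * (c + a) + t * (c + b) = c + ((1 - t) * a + t * b) by ring.
    rewrite !GE//; last by rewrite [X in 0 <= X](_ : _ = (1 - t) * (c + a) + t * (c + b)); [rewrite addr_ge0// mulr_ge0// subr_ge0 | ring].
    have e (x : R) : c + x - c = x by ring.
    rewrite !e real_normK ?num_real// => h; rewrite /L.
    rewrite -subr_ge0; rewrite -subr_ge0 in h; apply: le_trans h _; apply: eq_ler; ring.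
  - by rewrite /L expr0n /= subr0 subrr.
  - suff H a : 0 <= a -> L a + L (- a) <= 0.
      move=> a; have [/H//|/ltW a0] := leP 0 a.
      by have := H (- a); rewrite opprK addrC; apply; rewrite oppr_ge0.
    move=> a0; have := four_point X_Hadamard (p 0) (p a) (q a) (q 0).
    rewrite !GE// pr// qr// !subr0 sub0r subrr normrN ger0_norm// /L sqrrN => h.
    move: h; rewrite -mulrA -expr2; lra.
exists (L 1) => a b a0 b0; rewrite !GE// subrr mulrC -LE /L; ring.
Qed.

End Rays.

(** * Euclidean norm and parallel flats *)

Section Euclidean.
Context {R : realType} {k : nat}.
Implicit Types u v w : 'rV[R]_k.

(** The norm that ['rV[R]_k] carries is the maximum of the absolute values of the coordinates, hence
    a separate Euclidean norm. *)
Definition dot u v : R := (u *m v^T) 0 0.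
Definition enorm u : R := Num.sqrt (dot u u).

Lemma dotE u v : dot u v = \sum_i u 0 i * v 0 i.
Proof. by rewrite /dot mxE; apply: eq_bigr => i _; rewrite mxE. Qed.

Lemma dotC u v : dot u v = dot v u.
Proof. by rewrite !dotE; apply: eq_bigr => i _; rewrite mulrC. Qed.

Lemma dotDl u v w : dot (u + v) w = dot u w + dot v w.
Proof. by rewrite /dot mulmxDl mxE. Qed.

Lemma dotNl u w : dot (- u) w = - dot u w.
Proof. by rewrite /dot mulNmx mxE. Qed.

Lemma dotBl u v w : dot (u - v) w = dot u w - dot v w.
Proof. by rewrite dotDl dotNl. Qed.

Lemma dotZl a u w : dot (a *: u) w = a * dot u w.
Proof. by rewrite /dot -scalemxAl mxE. Qed.

Lemma dotDr u v w : dot u (v + w) = dot u v + dot u w.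
Proof. by rewrite dotC dotDl !(dotC u). Qed.

Lemma dotNr u w : dot u (- w) = - dot u w.
Proof. by rewrite dotC dotNl dotC. Qed.

Lemma dotBr u v w : dot u (v - w) = dot u v - dot u w.
Proof. by rewrite dotDr dotNr. Qed.

Lemma dotZr a u w : dot u (a *: w) = a * dot u w.
Proof. by rewrite dotC dotZl dotC. Qed.

Lemma dot0l u : dot 0 u = 0.
Proof. by rewrite /dot mul0mx mxE. Qed.

Lemma dot0r u : dot u 0 = 0.
Proof. by rewrite dotC dot0l. Qed.

Lemma dotvv_ge0 u : 0 <= dot u u.
Proof. by rewrite dotE sumr_ge0// => i _; rewrite -expr2 sqr_ge0. Qed.

Lemma dotvv_eq0 u : dot u u = 0 -> u = 0.
Proof.
move=> uu; apply/rowP => i; rewrite mxE; apply/eqP; rewrite -sqrf_eq0.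
move: uu; rewrite dotE => /eqP; rewrite psumr_eq0 => [/allP/(_ i)|j _].
  by rewrite mem_index_enum expr2 => /(_ isT).
by rewrite -expr2 sqr_ge0.
Qed.

Lemma enorm_ge0 u : 0 <= enorm u.
Proof. exact: sqrtr_ge0. Qed.

Lemma enorm_sqr u : enorm u ^+ 2 = dot u u.
Proof. by rewrite sqr_sqrtr// dotvv_ge0. Qed.

Lemma enorm0 : enorm 0 = 0.
Proof. by rewrite /enorm dot0l sqrtr0. Qed.

Lemma enorm_eq0 u : enorm u = 0 -> u = 0.
Proof. by move=> u0; apply: dotvv_eq0; rewrite -enorm_sqr u0 expr0n. Qed.

Lemma enormN u : enorm (- u) = enorm u.
Proof. by rewrite /enorm dotNl dotNr opprK. Qed.

Lemma enormZ a u : enorm (a *: u) = `|a| * enorm u.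
Proof. by rewrite /enorm dotZl dotZr mulrA -expr2 sqrtrM ?sqr_ge0// sqrtr_sqr. Qed.

Lemma enorm_unit u : u != 0 -> enorm ((enorm u)^-1 *: u) = 1.
Proof.
move=> u0; rewrite enormZ normfV ger0_norm ?enorm_ge0// mulVf//.
by apply: contraNneq u0 => /enorm_eq0 ->.
Qed.

Lemma dot_unit_le0 b : (forall e, enorm e = 1 -> dot b e <= 0) -> b = 0.
Proof.
move=> H; have [//|b0] := eqVneq b 0; have := H _ (enorm_unit b0).
have nb0 : 0 < enorm b.
  by rewrite lt_neqAle enorm_ge0 andbT eq_sym; apply: contraNneq b0 => /enorm_eq0 ->.
rewrite dotZr -enorm_sqr expr2 mulrA mulVf ?gt_eqF// mul1r => h.
by move: (lt_le_trans nb0 h); rewrite ltxx.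
Qed.

Lemma dot_inj u v : (forall w, dot u w = dot v w) -> u = v.
Proof.
move=> H; apply/eqP; rewrite -subr_eq0; apply/eqP/dotvv_eq0.
by rewrite dotBl H subrr.
Qed.

Lemma dot_enorm u v : dot u v <= enorm u * enorm v.
Proof.
have [->|u0] := eqVneq u 0; first by rewrite dot0l enorm0 mul0r.
have [->|v0] := eqVneq v 0; first by rewrite dot0r enorm0 mulr0.
have h := dotvv_ge0 ((enorm u)^-1 *: u - (enorm v)^-1 *: v).
have nu := enorm_unit u0; have nv := enorm_unit v0.
move: h; rewrite dotBl !dotBr -enorm_sqr nu -[dot (_ *: v) (_ *: v)]enorm_sqr nv.
rewrite [dot (_ *: v) _]dotC expr1n dotZl dotZr.
have pu : 0 < enorm u.
  by rewrite lt_neqAle enorm_ge0 andbT eq_sym; apply: contraNneq u0 => /enorm_eq0 ->.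
have pv : 0 < enorm v.
  by rewrite lt_neqAle enorm_ge0 andbT eq_sym; apply: contraNneq v0 => /enorm_eq0 ->.
move=> h; have {}h : (enorm u)^-1 * ((enorm v)^-1 * dot u v) <= 1 by lra.
by move: h; rewrite mulrA -invfM ler_pdivrMl ?mulr_gt0// mulr1.
Qed.

Lemma enormD u v : enorm (u + v) <= enorm u + enorm v.
Proof.
rewrite -ler_sqr ?nnegrE ?addr_ge0 ?enorm_ge0// sqrrD !enorm_sqr.
rewrite dotDl !dotDr (dotC v u) -mulr_natl; have := dot_enorm u v; lra.
Qed.

Lemma enormB_triangle u v w : enorm (u - w) <= enorm (u - v) + enorm (v - w).
Proof. by have := enormD (u - v) (v - w); rewrite addrA subrK. Qed.

Lemma linear_dot (K : 'rV[R]_k -> R) :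
  (forall u v, K (u + v) = K u + K v) -> (forall a u, K (a *: u) = a * K u) ->
  forall w, K w = dot (\row_i K (delta_mx 0 i)) w.
Proof.
move=> KD KZ w; rewrite [in LHS](row_sum_delta w) dotE.
have K0 : K 0 = 0 by rewrite -(scale0r 0) KZ mul0r.
rewrite (big_morph K KD K0); apply: eq_bigr => i _.
by rewrite KZ !mxE mulrC.
Qed.

Lemma enorm_delta i : enorm (delta_mx 0 i) = 1.
Proof.
rewrite /enorm dotE (bigD1 i)//= big1 => [|j ji]; rewrite !mxE !eqxx.
  by rewrite mulr1 addr0 sqrtr1.
by rewrite (negbTE ji) andbF mul0r.
Qed.

End Euclidean.

Section ProperSpace.
Context {R : realType} {X : metricType R}.
Local Notation d := (@mdist R X).

Definition proper_space := forall (x : X) (r : R), compact [set y | d x y <= r].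

Lemma proper_ultra_cvg (I : Type) (F : set_system I) (u : I -> X) x r :
  proper_space -> UltraFilter F -> (\forall i \near F, d x (u i) <= r) ->
  exists2 l, d x l <= r & u i @[i --> F] --> l.
Proof. by move=> Xp FU ur; apply: compact_ultra_cvg => //; exact: Xp. Qed.

Lemma metric_cvg_unique (I : Type) (F : set_system I) (u : I -> X) (l m : X) :
  ProperFilter F -> u i @[i --> F] --> l -> u i @[i --> F] --> m -> l = m.
Proof. by move=> FF ul um; apply: (cvg_unique (@metric_hausdorff _ X) ul um). Qed.

Lemma closureP (A : set X) y : closure A y <-> forall e : R, 0 < e -> exists2 z, A z & d y z < e.
Proof.
split=> [cA e e0|H B].
  have [|z [Az yz]] := cA [set z | d y z < e]; last by exists z.
  by rewrite -metricType_numDomainType.nbhs_nbhs_mdist; exists e.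
rewrite -metricType_numDomainType.nbhs_nbhs_mdist => -[e /= e0 eB].
by have [z Az yz] := H e e0; exists z; split => //; apply: eB.
Qed.

(** The ultrafilter lives on [X] itself and replaces a sequence of points of [A] tending to [y]. *)
Lemma closure_ultra (A : set X) y : closure A y ->
  exists w : set_system X, [/\ UltraFilter w, w A & z @[z --> w] --> y].
Proof.
move=> cA; have PF : ProperFilter (within A (nbhs y)).
  apply: Build_ProperFilter_ex => B /cA [z [Az Bz]].
  by exists z; exact: Bz.
have [w [wU sw]] := ultraFilterLemma PF; exists w; split => //.
  by apply: sw; rewrite /within /=; near=> z.
by apply: cvg_trans sw _; exact: cvg_within.
Unshelve. all: by end_near. Qed.

End ProperSpace.

(** * The product decomposition of the union of the flats parallel to a given one *)

Section ParallelFlats.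
Context {R : realType} {X : metricType R}.
Hypothesis X_Hadamard : Hadamard X.
Hypothesis X_proper : proper_space (X := X).
Local Notation d := (@mdist R X).
Local Notation geo := (geo X_Hadamard).

Definition convex_set (C : set X) :=
  forall y z t, C y -> C z -> 0 <= t <= 1 -> C (geo y z t).

Context {k : nat}.
Implicit Types (f g : 'rV[R]_k -> X) (u v w e : 'rV[R]_k).

Definition flat f := forall v w, d (f v) (f w) = enorm (v - w).

Lemma flat_geo f v w t : flat f -> 0 <= t <= 1 ->
  f ((1 - t) *: v + t *: w) = geo (f v) (f w) t.
Proof.
move=> ff /[dup] t01 /andP[t0 t1]; apply: geo_unique => //; rewrite !ff.
  have -> : v - ((1 - t) *: v + t *: w) = t *: (v - w).
    by rewrite scalerBr scalerBl scale1r opprD opprB addrA addrCA subrr addr0.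
  by rewrite enormZ ger0_norm.
have -> : (1 - t) *: v + t *: w - w = (1 - t) *: (v - w).
  by rewrite scalerBr (scalerBl 1 t w) scale1r opprB addrA.
by rewrite enormZ ger0_norm// subr_ge0.
Qed.

(** Along a line the distance is a bounded convex function. *)
Lemma parallel_flats_dist f g M : flat f -> flat g ->
  (forall v, d (f v) (g v) <= M) -> forall v w, d (f v) (g v) = d (f w) (g w).
Proof.
move=> ff fg fgM v w.
pose h s := d (f ((1 - s) *: v + s *: w)) (g ((1 - s) *: v + s *: w)).
have := @convex_bounded_constant _ h M _ _ 0 1.
rewrite /h subr0 subrr !scale1r !scale0r addr0 add0r; apply => // a b t t01.
have -> : (1 - ((1 - t) * a + t * b)) *: v + ((1 - t) * a + t * b) *: w =
  (1 - t) *: ((1 - a) *: v + a *: w) + t *: ((1 - b) *: v + b *: w).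
  rewrite !scalerDr !scalerA addrACA -!scalerDl.
  by congr (_ *: _ + _ *: _); ring.
by rewrite (flat_geo _ _ ff t01) (flat_geo _ _ fg t01); exact: geo_convex.
Qed.

Lemma flat_ray f v e : flat f -> enorm e = 1 -> is_ray (fun s => f (v + s *: e)).
Proof.
move=> ff e1 s t _ _; rewrite ff opprD addrACA subrr add0r -scalerBl.
by rewrite enormZ e1 mulr1.
Qed.

Lemma flat_shift f v : flat f -> flat (fun w => f (w + v)).
Proof. by move=> ff u w; rewrite ff opprD addrACA subrr addr0. Qed.

Lemma shifted_parallel_flats_dist f g M : flat f -> flat g ->
  (forall v, d (f v) (g v) <= M) ->
  forall v w u, d (f (v + u)) (g (w + u)) = d (f v) (g w).
Proof.
move=> ff fg fgM v w u.
have fg' a : d (f (a + v)) (g (a + w)) <= M + enorm (v - w).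
  apply: le_trans (metric_triangle _ (g (a + v)) _) _; apply: lerD => //.
  by rewrite fg opprD addrACA subrr add0r.
have := parallel_flats_dist (flat_shift v ff) (flat_shift w fg) fg' u 0.
by rewrite !add0r ![u + _]addrC.
Qed.

(** [parallel_rays_dist] covers [s >= 0] and, after a translation of both flats by [- s *: e], also
    [s <= 0]. *)
Lemma parallel_flats_line f g M v w e : flat f -> flat g ->
  (forall v, d (f v) (g v) <= M) -> enorm e = 1 ->
  exists al, forall s, d (f v) (g (w + s *: e)) ^+ 2 =
    s ^+ 2 + al * s + d (f v) (g w) ^+ 2.
Proof.
move=> ff fg fgM e1.
have [||a b c a0 b0 c0|al alE] := parallel_rays_dist X_Hadamard
    (p := fun s => f (v + s *: e)) (q := fun s => g (w + s *: e)).
- exact: flat_ray.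
- exact: flat_ray.
- by rewrite !scalerDl !addrA (shifted_parallel_flats_dist ff fg fgM).
exists al => s; have [s0|/ltW s0] := leP 0 s.
  by have := alE 0 s (lexx _) s0; rewrite !scale0r !addr0 subr0.
have := alE (- s) 0 _ (lexx _); rewrite !scale0r !addr0 sub0r opprK oppr_ge0 => <- //.
rewrite -(shifted_parallel_flats_dist ff fg fgM _ _ (- s *: e)) -addrA -scalerDl.
by rewrite subrr scale0r addr0.
Qed.

(** Without its leading term [dot w w], the squared distance is affine on every line, hence
    affine. *)
Lemma parallel_flats_quadratic f g M : flat f -> flat g ->
  (forall v, d (f v) (g v) <= M) ->
  exists b, forall w, d (f 0) (g w) ^+ 2 = dot w w - 2 * dot b w + d (f 0) (g 0) ^+ 2.
Proof.
move=> ff fg fgM; pose H w := d (f 0) (g w) ^+ 2 - dot w w.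
have Hline w u s : H (w + s *: u) = H w + s * (H (w + u) - H w).
  have [->|u0] := eqVneq u 0; first by rewrite scaler0 addr0 subrr mulr0 addr0.
  have [al alE] := parallel_flats_line 0 w ff fg fgM (enorm_unit u0).
  have E r : H (w + r *: u) = H w + r * (al * enorm u - 2 * dot w u).
    have nu : enorm u != 0 by apply: contraNneq u0 => /enorm_eq0 ->.
    have := alE (r * enorm u); rewrite scalerA mulfK// /H => ->.
    by rewrite dotDl !dotDr !dotZr !dotZl (dotC u w) -(enorm_sqr u); ring.
  have := E 1; rewrite scale1r mul1r => E1; rewrite E E1; ring.
pose K w := H w - H 0.
have KZ a u : K (a *: u) = a * K u by rewrite /K -[a *: u]add0r Hline add0r; ring.
have KD u v : K (u + v) = K u + K v.
  have -> : u + v = 2 *: (u + 2^-1 *: (v - u)).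
    rewrite scalerDr scalerA divff ?scale1r ?pnatr_eq0// scaler_nat mulr2n -addrA.
    by rewrite [u + (v - u)]addrC subrK.
  by rewrite KZ /K Hline addrC [u + (v - u)]addrC subrK; field.
exists (- 2^-1 *: \row_i K (delta_mx 0 i)) => w.
by rewrite dotZl -(linear_dot KD KZ) /K /H dot0r subr0; field.
Qed.

Variable f : 'rV[R]_k -> X.
Hypothesis f_flat : flat f.

Definition parallel_through y g :=
  [/\ flat g, g 0 = y & exists M, forall v, d (g v) (f v) <= M].

Definition parallel_set : set X := [set y | exists g, parallel_through y g].

(** The translation action of [R^k] along the parallel flats. By [tau_unique] the chosen flat is the
    only one through [y]; off the parallel set, [y] is a default value. *)
Definition tau v y : X :=
  if pselect (exists g, parallel_through y g) is left h then sval (cid h) v else y.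

Local Notation C := parallel_set.

Lemma tauP y : C y -> parallel_through y (tau^~ y).
Proof.
move=> Cy; rewrite /tau; case: pselect => // h.
by case: (svalP (cid h)) => ? ? ?; split.
Qed.

Lemma tau_bounded y z : C y -> C z -> exists M, forall v, d (tau v y) (tau v z) <= M.
Proof.
move=> /tauP[_ _ [M My]] /tauP[_ _ [N Nz]]; exists (M + N) => v.
apply: le_trans (metric_triangle _ (f v) _) _; apply: lerD => //.
by rewrite metric_sym.
Qed.

Lemma tau_flat y : C y -> flat (tau^~ y).
Proof. by case/tauP. Qed.

Lemma tau0 y : C y -> tau 0 y = y.
Proof. by case/tauP. Qed.

Lemma tau_isometric v y z : C y -> C z -> d (tau v y) (tau v z) = d y z.
Proof.
move=> Cy Cz; have [M h] := tau_bounded Cy Cz.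
by rewrite (parallel_flats_dist (tau_flat Cy) (tau_flat Cz) h v 0) !tau0.
Qed.

Lemma tau_dist v w y : C y -> d (tau v y) (tau w y) = enorm (v - w).
Proof. by move=> /tau_flat. Qed.

Lemma tau_unique y g : parallel_through y g -> forall v, tau v y = g v.
Proof.
move=> py v; have Cy : C y by exists g.
case: (py) => gf g0 [M gM]; have [_ _ [N tN]] := tauP Cy.
have h w : d (tau w y) (g w) <= N + M.
  apply: le_trans (metric_triangle _ (f w) _) _; apply: lerD => //.
  by rewrite metric_sym.
apply: mdist_positivity.
by rewrite (parallel_flats_dist (tau_flat Cy) gf h v 0) tau0// g0 mdistxx.
Qed.

Lemma parallel_through_tau v y : C y -> parallel_through (tau v y) (fun w => tau (w + v) y).
Proof.
move=> Cy; have [yf y0 [M yM]] := tauP Cy; split; first exact: (flat_shift v yf).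
  by rewrite add0r.
exists (enorm v + M) => w; apply: le_trans (metric_triangle _ (tau w y) _) _.
by apply: lerD => //; rewrite tau_dist// [w + v]addrC addrK.
Qed.

Lemma tau_parallel_set v y : C y -> C (tau v y).
Proof. by move=> /(parallel_through_tau v); exists (fun w => tau (w + v) y). Qed.

Lemma tauD v w y : C y -> tau w (tau v y) = tau (w + v) y.
Proof. by move=> Cy; exact: tau_unique (parallel_through_tau v Cy) w. Qed.

Lemma parallel_set_base : C (f 0).
Proof.
by exists f; split => //; exists 0 => v; rewrite mdistxx.
Qed.

Lemma tau_base v : tau v (f 0) = f v.
Proof. by apply: tau_unique; split => //; exists 0 => w; rewrite mdistxx. Qed.

Lemma parallel_set_closed : closed C.
Proof.
move=> y /closure_ultra[w [wU wC wy]].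
have near1 : \forall z \near w, d y z <= 1.
  exact: (cvg_mdist_le (u := id) wy ltr01).
have lim v : exists l : X, tau v z @[z --> w] --> l.
  have [|l _ ?] := @proper_ultra_cvg _ _ _ w (tau v) y (1 + enorm v) X_proper wU; last by exists l.
  near=> z; have Cz : C z by near: z.
  apply: le_trans (metric_triangle _ z _) _; apply: lerD; first by near: z.
  by rewrite -{1}(tau0 Cz) tau_dist// sub0r enormN.
have [g gE] := choice lim.
exists g; split.
- move=> v u; apply: (cvg_to_eq (mdist_cvg (gE v) (gE u))).
  by near=> z; rewrite tau_dist//; near: z.
- apply: (metric_cvg_unique _ (gE 0)).
  apply: cvg_trans wy; apply: near_eq_cvg.
  by near=> z; rewrite tau0//; near: z.
exists (1 + d y (f 0)) => v.
apply: (cvgr_to_le (mdist_cvg (gE v) (cvg_cst (f v)))).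
near=> z; have Cz : C z by near: z.
rewrite -{1}(tau_base v) tau_isometric//; last exact: parallel_set_base.
apply: le_trans (metric_triangle _ y _) _; apply: lerD => //.
by rewrite metric_sym; near: z.
Unshelve. all: by end_near. Qed.

(** The coefficient [b] of [parallel_flats_quadratic], read off at the basis vectors. As
    [tau (beta y z) z] is the point nearest to [y] on the flat through [z], [beta y z] is the
    difference of the [R^k]-coordinates of [y] and [z]. *)
Definition beta y z : 'rV[R]_k :=
  \row_i ((1 + d y z ^+ 2 - d y (tau (delta_mx 0 i) z) ^+ 2) / 2).

Lemma tau_dist_beta y z w : C y -> C z ->
  d y (tau w z) ^+ 2 = dot w w - 2 * dot (beta y z) w + d y z ^+ 2.
Proof.
move=> Cy Cz; have [M h] := tau_bounded Cy Cz.
have [b bE] := parallel_flats_quadratic (tau_flat Cy) (tau_flat Cz) h.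
rewrite !tau0// in bE; rewrite bE.
suff -> : beta y z = b by [].
apply/rowP => i; rewrite mxE bE -enorm_sqr enorm_delta.
have -> : dot b (delta_mx 0 i) = b 0 i.
  rewrite dotE (bigD1 i)//= big1 => [|j ji]; rewrite !mxE !eqxx ?mulr1 ?addr0//.
  by rewrite (negbTE ji) andbF mulr0.
by field.
Qed.

Lemma tau_dist_beta2 v w y z : C y -> C z ->
  d (tau v y) (tau w z) ^+ 2 =
    dot (w - v) (w - v) - 2 * dot (beta y z) (w - v) + d y z ^+ 2.
Proof.
move=> Cy Cz; rewrite -tau_dist_beta// -[in RHS](tau_isometric v)//; last exact: tau_parallel_set.
by rewrite tauD// addrCA subrr addr0.
Qed.

Lemma betaC y z : C y -> C z -> beta z y = - beta y z.
Proof.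
move=> Cy Cz; apply: dot_inj => w; have := tau_dist_beta w Cz Cy.
have := tau_dist_beta2 w 0 Cy Cz.
rewrite tau0// sub0r metric_sym => ->.
by rewrite !dotNl !dotNr opprK [d z y]metric_sym; lra.
Qed.

Lemma beta_tauR u y z : C y -> C z -> beta y (tau u z) = beta y z - u.
Proof.
move=> Cy Cz; apply: dot_inj => w.
have := tau_dist_beta w Cy (tau_parallel_set u Cz).
rewrite tauD// !tau_dist_beta// dotDl !dotDr (dotC u w) dotBl.
by rewrite ?(dotC u w); lra.
Qed.

Lemma beta_tauL u y z : C y -> C z -> beta (tau u y) z = beta y z + u.
Proof.
move=> Cy Cz; rewrite betaC//; last exact: tau_parallel_set.
by rewrite beta_tauR// betaC// opprD !opprK.
Qed.

(** The triangle inequality through the point [tau (r *: e) x], with [r] going to infinity: the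
    Busemann function of this ray is 1-Lipschitz. *)
Let asymptotic_bound x y z e s : C x -> C y -> C z -> enorm e = 1 -> 0 <= s ->
  s + (dot (beta z x) e - dot (beta y x) e) <= d y (tau (s *: e) z).
Proof.
move=> Cx Cy Cz e1 s0.
have ee : dot e e = 1 by rewrite -enorm_sqr e1 expr1n.
have := @quadratic_asymptotics R (fun r => d y (tau (r *: e) x))
  (fun r => d (tau (s *: e) z) (tau (r *: e) x)) (d y (tau (s *: e) z))
  (- 2 * dot (beta y x) e) (d y x ^+ 2) (- 2 * s - 2 * dot (beta z x) e)
  (s ^+ 2 + 2 * s * dot (beta z x) e + d z x ^+ 2).
move=> H; suff : - 2 * dot (beta y x) e <= - 2 * s - 2 * dot (beta z x) e + 2 * d y (tau (s *: e) z) by lra.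
apply: H => [r _|r _|r _|r _|r _].
- exact: mdist_ge0.
- exact: mdist_ge0.
- by rewrite tau_dist_beta// dotZl !dotZr ee; ring.
- by rewrite tau_dist_beta2// -scalerBl dotZl !dotZr ee; ring.
- by rewrite addrC metric_triangle.
Qed.

(* Busemann functions of parallel rays differ by a constant. *)
Lemma beta_cocycle x y z : C x -> C y -> C z -> beta y z = beta y x + beta x z.
Proof.
move=> Cx Cy Cz; apply/eqP; rewrite -subr_eq0; apply/eqP/dot_unit_le0 => e e1.
rewrite (betaC Cz Cx) dotBl dotBl.
have ee : dot e e = 1 by rewrite -enorm_sqr e1 expr1n.
have := @quadratic_asymptotics R (fun s => s) (fun s => d y (tau (s *: e) z))
  (dot (beta y x) e - dot (beta z x) e) 0 0 (- 2 * dot (beta y z) e) (d y z ^+ 2).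
move=> H; suff : 0 <= - 2 * dot (beta y z) e + 2 * (dot (beta y x) e - dot (beta z x) e) by lra.
apply: H => [//|s _|s _|s _|s s0].
- exact: mdist_ge0.
- by rewrite mul0r !addr0.
- by rewrite tau_dist_beta// dotZl !dotZr ee; ring.
- have := asymptotic_bound Cx Cy Cz e1 s0; lra.
Qed.

Lemma enorm_beta y z : C y -> C z -> enorm (beta y z) <= d y z.
Proof.
move=> Cy Cz; rewrite -ler_sqr ?nnegrE ?enorm_ge0 ?mdist_ge0// enorm_sqr.
have := tau_dist_beta (beta y z) Cy Cz; have := sqr_ge0 (d y (tau (beta y z) z)); lra.
Qed.

Lemma betaxx y : C y -> beta y y = 0.
Proof.
by move=> Cy; apply: enorm_eq0; apply/eqP; rewrite eq_le enorm_ge0 andbT -(mdistxx y) enorm_beta.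
Qed.

(** The map [g] is 1-Lipschitz. If it brought [v] and [w] closer, passing through [g v] and [g w]
    would be a shortcut between distant points of the line through [tau v y] and [tau w y]. *)
Lemma parallel_set_convex : convex_set C.
Proof.
move=> y z t Cy Cz /[dup] t01 /andP[t0 t1].
pose g v := geo (tau v y) (tau v z) t.
exists g; split; last 2 first.
- by rewrite /g !tau0.
- have [_ _ [M yM]] := tauP Cy; have [_ _ [N zN]] := tauP Cz.
  exists ((1 - t) * M + t * N) => v; rewrite metric_sym.
  apply: le_trans (geo_dist_convex _ _ _ _ t01) _.
  by apply: lerD; apply: ler_wpM2l; rewrite ?subr_ge0// metric_sym.
move=> v w; have gle a b : d (g a) (g b) <= enorm (a - b).
  apply: le_trans (geo_convex _ _ _ _ _ t01) _.
  by rewrite !tau_dist// -mulrDl subrK mul1r.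
apply/eqP; rewrite eq_le gle /=.
have [->|wv] := eqVneq w v; first by rewrite subrr enorm0 mdist_ge0.
rewrite leNgt; apply/negP => lt_gL.
have wv0 : w - v != 0 by rewrite subr_eq0.
pose e := (enorm (w - v))^-1 *: (w - v).
have e1 : enorm e = 1 by exact: enorm_unit.
have ee : dot e e = 1 by rewrite -enorm_sqr e1 expr1n.
have wvE : w - v = enorm (w - v) *: e.
  by rewrite scalerA divff ?scale1r//; apply: contraNneq wv0 => /enorm_eq0 ->.
clearbody e; rewrite -[enorm (v - w)]enormN opprB in lt_gL.
set L := enorm (w - v) in wvE lt_gL; set de := d (g v) (g w) in lt_gL.
set D := d y z; pose bb := dot (beta y z) e.
have L0 : 0 <= L by exact: enorm_ge0.
(* [CN] bounds [a ^+ 2] and [b ^+ 2] by [n ^+ 2] plus terms linear in [n] that cancel in the sum and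
   bounded ones. So [a + b] exceeds [2 * n] by O(1/n) only, whereas [ab] requires an excess of
   [L - de]. *)
have bound n : 0 <= n -> 4 * n * (L - de) <= 4 * D ^+ 2.
  move=> n0; set a := d (tau (v - n *: e) y) (g v); set b := d (g w) (tau (w + n *: e) y).
  have ab : 2 * n + L <= a + de + b.
    have -> : 2 * n + L = d (tau (v - n *: e) y) (tau (w + n *: e) y).
      rewrite tau_dist// -enormN !opprB [n *: e - v]addrC addrACA wvE -!scalerDl enormZ e1 mulr1.
      by rewrite ger0_norm; [ring | rewrite !addr_ge0].
    apply: le_trans (metric_triangle _ (g w) _) _; rewrite lerD2r.
    exact: metric_triangle.
  have aE : a ^+ 2 <= n ^+ 2 - 2 * t * n * bb + t ^+ 2 * D ^+ 2.
    apply: le_trans (CN _ _ _ _ t01) _.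
    rewrite tau_dist_beta2// tau_dist_beta2// betaxx// mdistxx dot0l tau_isometric//.
    rewrite opprB addrCA subrr addr0 -/D dotZl !dotZr ee -/bb.
    by apply: eq_ler; ring.
  have bE : b ^+ 2 <= n ^+ 2 + 2 * t * n * bb + t ^+ 2 * D ^+ 2.
    rewrite /b metric_sym; apply: le_trans (CN _ _ _ _ t01) _.
    rewrite tau_dist_beta2// tau_dist_beta2// betaxx// mdistxx dot0l tau_isometric//.
    rewrite opprD addrA subrr sub0r dotNl !dotNr -/D dotZl !dotZr ee -/bb.
    by apply: eq_ler; ring.
  have t2 : t ^+ 2 <= 1 by rewrite expr_le1.
  have tD : t ^+ 2 * D ^+ 2 <= D ^+ 2 by rewrite ler_piMl// sqr_ge0.
  have h : (2 * n + (L - de)) ^+ 2 <= (a + b) ^+ 2.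
    rewrite ler_sqr ?nnegrE; first lra.
      by rewrite addr_ge0 ?mulr_ge0// subr_ge0 ltW.
    by rewrite addr_ge0 ?mdist_ge0.
  have := sqr_ge0 (a - b); have := sqr_ge0 (L - de).
  have -> : (a - b) ^+ 2 = 2 * a ^+ 2 + 2 * b ^+ 2 - (a + b) ^+ 2 by ring.
  have e4 : (2 * n + (L - de)) ^+ 2 = 4 * n ^+ 2 + 4 * n * (L - de) + (L - de) ^+ 2 by ring.
  by rewrite e4 in h; lra.
have g0 : 0 < L - de by rewrite subr_gt0.
have N0 : 0 <= (D ^+ 2 + 1) / (L - de) by rewrite divr_ge0 ?(ltW g0)// addr_ge0 ?sqr_ge0.
by have := bound _ N0; rewrite -mulrA mulfVK ?gt_eqF//; lra.
Qed.

(** The second factor: the points with the same [R^k]-coordinate as [x]. [fiber_dist] is the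
    Pythagorean theorem of the product. *)
Definition fiber x : set X := [set y | C y /\ beta y x = 0].

Lemma fiber_base x : C x -> fiber x x.
Proof. by move=> Cx; split => //; exact: betaxx. Qed.

Lemma fiber_beta x y z : C x -> fiber x y -> fiber x z -> beta y z = 0.
Proof.
by move=> Cx [Cy yx] [Cz zx]; rewrite (beta_cocycle Cx)// (betaC Cz Cx) zx yx oppr0 addr0.
Qed.

Lemma fiber_dist x y z v w : C x -> fiber x y -> fiber x z ->
  d (tau v y) (tau w z) ^+ 2 = enorm (v - w) ^+ 2 + d y z ^+ 2.
Proof.
move=> Cx Yy Yz; rewrite tau_dist_beta2//; [|by case: Yy|by case: Yz].
by rewrite (fiber_beta Cx)// dot0l mulr0 subr0 -enormN opprB enorm_sqr.
Qed.

Lemma fiber_closed x : C x -> closed (fiber x).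
Proof.
move=> Cx y cy; have Cy : C y.
  by apply: parallel_set_closed; apply: closureS cy => z [].
split => //; apply: enorm_eq0; apply/eqP; rewrite eq_le enorm_ge0 andbT.
apply/ler_addgt0Pr => e e0; rewrite add0r.
have [z [Cz zx] yz] := (closureP _ _).1 cy e e0.
by rewrite (beta_cocycle Cz)// zx addr0 (le_trans (enorm_beta _ _))// ltW.
Qed.

(** Both [y] and [z] are within [sqrt (s ^+ 2 + c)] of [tau (s *: e) x], hence so is every point
    between them. Comparing linear terms in [s], its [beta] has a nonnegative product with every
    unit vector [e], and therefore vanishes. *)
Lemma fiber_convex x : C x -> convex_set (fiber x).
Proof.
move=> Cx y z t [Cy yx] [Cz zx] /[dup] t01 /andP[t0 t1].
have Cg : C (geo y z t) by exact: parallel_set_convex.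
split => //; apply/eqP; rewrite -oppr_eq0; apply/eqP/dot_unit_le0 => e e1.
have ee : dot e e = 1 by rewrite -enorm_sqr e1 expr1n.
pose c := Num.max (d y x ^+ 2) (d z x ^+ 2).
have c0 : 0 <= c by rewrite le_max sqr_ge0.
have := @quadratic_asymptotics R (fun s => d (geo y z t) (tau (s *: e) x))
  (fun s => Num.sqrt (s ^+ 2 + c)) 0 (- 2 * dot (beta (geo y z t) x) e)
  (d (geo y z t) x ^+ 2) 0 c.
move=> H; rewrite dotNl; suff : - 2 * dot (beta (geo y z t) x) e <= 0 + 2 * 0 by lra.
apply: H => [s _|s _|s _|s _|s _].
- exact: mdist_ge0.
- exact: sqrtr_ge0.
- by rewrite tau_dist_beta// dotZl !dotZr ee; ring.
- by rewrite sqr_sqrtr ?mul0r ?addr0// addr_ge0// sqr_ge0.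
rewrite addr0 metric_sym; apply: le_trans (geo_dist_convex _ _ _ _ t01) _.
have le y' : C y' -> beta y' x = 0 -> d y' x ^+ 2 <= c ->
    d (tau (s *: e) x) y' <= Num.sqrt (s ^+ 2 + c).
  move=> Cy' y'x y'c; rewrite -ler_sqr ?nnegrE ?mdist_ge0 ?sqrtr_ge0//.
  rewrite sqr_sqrtr ?addr_ge0 ?sqr_ge0// metric_sym tau_dist_beta// y'x dot0l.
  by rewrite dotZl dotZr ee; lra.
set sq := Num.sqrt _ in le *.
have -> : sq = (1 - t) * sq + t * sq by ring.
by apply: lerD; apply: ler_wpM2l; rewrite ?subr_ge0//; apply: le; rewrite // le_max lexx ?orbT.
Qed.

Definition fiber_proj x y : X := tau (- beta y x) y.

Lemma fiber_proj_fiber x y : C x -> C y -> fiber x (fiber_proj x y).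
Proof.
by move=> Cx Cy; split; [exact: tau_parallel_set | rewrite beta_tauL// subrr].
Qed.

Lemma fiber_projK x y : C y -> tau (beta y x) (fiber_proj x y) = y.
Proof. by move=> Cy; rewrite tauD// subrr tau0. Qed.

Lemma fiber_proj_id x y : fiber x y -> fiber_proj x y = y.
Proof. by move=> [Cy yx]; rewrite /fiber_proj yx oppr0 tau0. Qed.

Lemma fiber_proj_tau x u y : C x -> C y -> fiber_proj x (tau u y) = fiber_proj x y.
Proof.
move=> Cx Cy; rewrite /fiber_proj beta_tauL// tauD//; congr (tau _ y).
by rewrite opprD subrK.
Qed.

End ParallelFlats.

(** * Invariant means and convex functions *)

Lemma le0_of_small (R : realType) (a b : R) :
  (forall t, 0 < t <= 1 -> a <= t * b) -> a <= 0.
Proof.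
move=> H; rewrite leNgt; apply/negP => a0.
have ab : a <= b by have := H 1; rewrite ltr01 lexx mul1r; exact.
have b0 : 0 < b by exact: lt_le_trans ab.
have t0 : 0 < a / (2 * b) by rewrite divr_gt0// mulr_gt0.
have t1 : a / (2 * b) <= 1 by rewrite ler_pdivrMr ?mulr_gt0// mul1r; lra.
have := H _ (introT andP (conj t0 t1)).
have -> : a / (2 * b) * b = a / 2 by field; rewrite gt_eqF.
lra.
Qed.

Lemma coercive_min (R : realType) (X : metricType R) (Y : set X) (f : X -> R) y0 r :
  proper_space (X := X) -> closed Y -> continuous f -> Y y0 ->
  (forall z, Y z -> f z <= f y0 -> mdist y0 z <= r) ->
  exists2 p, Y p & forall z, Y z -> f p <= f z.
Proof.
move=> Xp Yc fc Yy0 fr; pose K := [set z | mdist y0 z <= r] `&` Y.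
have Ky0 : K y0 by split => //; exact: fr.
have cK : compact K.
  by apply: compact_closedI; [exact: Xp | exact: Yc].
have [p /set_mem[_ Yp] pmin] := compact_EVT_min (ex_intro _ _ Ky0) cK (continuous_subspaceT fc).
exists p => // z Yz; have [fz|/ltW fz] := leP (f z) (f y0).
  by apply: pmin; apply/mem_set; split => //; exact: fr.
by apply: le_trans fz; apply: pmin; exact/mem_set.
Qed.

Lemma mdist_continuous (R : realType) (X : metricType R) (y : X) :
  continuous (fun z => mdist z y).
Proof. by move=> z; apply: mdist_cvg; [exact: cvg_id | exact: cvg_cst]. Qed.

Lemma lipschitz1_continuous (R : realType) (X : metricType R) (f : X -> R) :
  (forall x y, f x - f y <= mdist x y) -> continuous f.
Proof.
move=> fl x; apply/cvgrPdist_le => e e0.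
have h := cvg_mdist_le (u := id) (@cvg_id _ (nbhs x)) e0.
near=> y; have xy : mdist x y <= e by near: y; exact: h.
have h1 := fl x y; have h2 := fl y x; rewrite [mdist y x]metric_sym in h2.
by rewrite ler_norml; apply/andP; split; lra.
Unshelve. all: by end_near. Qed.

(** * Fixed points of groups with a bounded orbit *)

Section FixedPoint.
Context {R : realType} {X : metricType R}.
Hypothesis X_Hadamard : Hadamard X.
Hypothesis X_proper : proper_space (X := X).
Context {Gam : groupType} (rho : Gam -> X -> X) (A : set Gam) (Y : set X).
Local Notation d := (@mdist R X).
Hypothesis Y_closed : closed Y.
Hypothesis Y_convex : convex_set X_Hadamard Y.
Hypothesis A1 : A 1%g.
Hypothesis AV : forall g, A g -> A g^-1%g.
Hypothesis AM : forall g h, A g -> A h -> A (g * h)%g.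
Hypothesis rho_Y : forall g y, A g -> Y y -> Y (rho g y).
Hypothesis rhoM : forall g h y, Y y -> rho (g * h)%g y = rho g (rho h y).
Hypothesis rho_isometric : forall g y z, A g -> Y y -> Y z -> d (rho g y) (rho g z) = d y z.

(* The circumcentre of the orbit is fixed. *)
Lemma bounded_orbit_fixed_point x B : Y x -> (forall g, A g -> d (rho g x) x <= B) ->
  exists2 y, Y y & forall g, A g -> rho g y = y.
Proof.
move=> Yx orbB.
pose S z := [set d (rho g x) z | g in A].
have S0 z : S z !=set0 by exists (d (rho 1%g x) z); exists 1%g.
have Sub z : ubound (S z) (B + d x z).
  move=> _ [g Ag <-]; apply: le_trans (metric_triangle _ x _) _.
  by rewrite lerD2r orbB.
have Sbd z : has_ubound (S z) by exists (B + d x z).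
pose r z := sup (S z).
have rge g z : A g -> d (rho g x) z <= r z.
  by move=> Ag; apply: ub_le_sup => //; exists g.
have rle z t : (forall g, A g -> d (rho g x) z <= t) -> r z <= t.
  by move=> H; apply: ge_sup => // _ [g Ag <-]; exact: H.
have r0 z : 0 <= r z by exact: le_trans (mdist_ge0 _ _) (rge 1%g z A1).
have rlip : forall y z, r y - r z <= d y z.
  move=> y z; rewrite lerBlDr; apply: rle => g Ag.
  apply: le_trans (metric_triangle _ z _) _; rewrite addrC lerD//; last exact: rge.
  by rewrite metric_sym.
have [|p Yp pmin] := @coercive_min R X Y r x (B + r x) X_proper Y_closed (lipschitz1_continuous rlip) Yx.
  move=> z Yz zx; apply: le_trans (metric_triangle _ (rho 1%g x) _) _.
  by rewrite metric_sym lerD// ?orbB//; exact: le_trans (rge _ _ A1) zx.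
have uniq q : Y q -> r q <= r p -> q = p.
  move=> Yq rq; have h01 : 0 <= (2^-1 : R) <= 1 by apply/andP; split; lra.
  pose m := geo X_Hadamard q p 2^-1.
  have Ym : Y m by exact: Y_convex.
  have rm : r m ^+ 2 <= r p ^+ 2 - 4^-1 * d q p ^+ 2.
    have mg g : A g -> d (rho g x) m ^+ 2 <= r p ^+ 2 - 4^-1 * d q p ^+ 2.
      move=> Ag; apply: le_trans (CN _ _ _ _ h01) _.
      have h1 : d (rho g x) q ^+ 2 <= r p ^+ 2.
        by rewrite ler_sqr ?nnegrE ?mdist_ge0// (le_trans (rge _ _ Ag)).
      have h2 : d (rho g x) p ^+ 2 <= r p ^+ 2.
        by rewrite ler_sqr ?nnegrE ?mdist_ge0// rge.
      have -> : (2^-1 : R) * (1 - 2^-1) = 4^-1 by field.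
      have -> : 1 - 2^-1 = (2^-1 : R) by field.
      by lra.
    have s0 := le_trans (sqr_ge0 _) (mg _ A1).
    rewrite -[leRHS]sqr_sqrtr// ler_sqr ?nnegrE ?sqrtr_ge0//.
    apply: rle => g Ag; rewrite -ler_sqr ?nnegrE ?mdist_ge0 ?sqrtr_ge0//.
    by rewrite sqr_sqrtr// mg.
  have pm : r p ^+ 2 <= r m ^+ 2 by rewrite ler_sqr ?nnegrE// pmin.
  apply: mdist_positivity; apply/eqP; rewrite -sqrf_eq0 eq_le sqr_ge0 andbT; lra.
exists p => // g Ag; apply: uniq; first exact: rho_Y.
apply: rle => h Ah.
have -> : rho h x = rho g (rho (g^-1 * h)%g x) by rewrite -rhoM// mulVKg.
by rewrite rho_isometric//; [apply: rge; exact: AM (AV Ag) Ah | apply: rho_Y => //; exact: AM (AV Ag) Ah].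
Qed.

End FixedPoint.

Definition bounded_fun (T : Type) (R : realType) (f : T -> R) :=
  exists B, forall x, `|f x| <= B.

(** * The average of the distance functions and its resolvents *)

Section AmenableAction.
Context {R : realType} {X : metricType R}.
Hypothesis X_Hadamard : Hadamard X.
Hypothesis X_proper : proper_space (X := X).
Context {Gam : groupType} (rho : Gam -> X -> X) (Y : set X) (x0 : X).
Local Notation d := (@mdist R X).
Local Notation geo := (geo X_Hadamard).
Hypothesis Y_closed : closed Y.
Hypothesis Y_convex : convex_set X_Hadamard Y.
Hypothesis Y_base : Y x0.
Hypothesis rho_Y : forall g y, Y y -> Y (rho g y).
Hypothesis rho1 : forall y, Y y -> rho 1%g y = y.
Hypothesis rhoM : forall g h y, Y y -> rho (g * h)%g y = rho g (rho h y).
Hypothesis rho_isometric : forall g y z, Y y -> Y z -> d (rho g y) (rho g z) = d y z.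

Lemma rho_geo g y z t : Y y -> Y z -> 0 <= t <= 1 ->
  rho g (geo y z t) = geo (rho g y) (rho g z) t.
Proof.
move=> Yy Yz t01; have Yg := Y_convex Yy Yz t01; apply: geo_unique => //.
  by rewrite !rho_isometric// geo_distl.
by rewrite !rho_isometric// geo_distr.
Qed.

Lemma rhoKV g y : Y y -> rho g (rho g^-1%g y) = y.
Proof. by move=> Yy; rewrite -rhoM// mulgV rho1. Qed.

Variable mean : (X -> R) -> R.
Hypothesis mean_linear : forall a f g, bounded_fun f -> bounded_fun g ->
  mean (fun q => a * f q + g q) = a * mean f + mean g.
Hypothesis mean_ge0 : forall f, bounded_fun f ->
  (forall g, 0 <= f (rho g x0)) -> 0 <= mean f.
Hypothesis mean1 : mean (fun=> 1) = 1.
Hypothesis mean_inv : forall f g, bounded_fun f ->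
  mean (fun q => f (rho g q)) = mean f.

Let bounded_cst (c : R) : bounded_fun (fun _ : X => c).
Proof. by exists `|c|. Qed.

Let bounded_comb a (f g : X -> R) : bounded_fun f -> bounded_fun g ->
  bounded_fun (fun q => a * f q + g q).
Proof.
move=> [A fA] [B gB]; exists (`|a| * A + B) => q.
by apply: le_trans (ler_normD _ _) _; rewrite lerD// normrM ler_wpM2l.
Qed.

Lemma mean_cst c : mean (fun=> c) = c.
Proof.
have m0 : mean (fun=> 0) = 0.
  have := mean_linear 1 (bounded_cst 0) (bounded_cst 0).
  by rewrite mulr0 addr0 mul1r => h; apply: (addrI (mean (fun=> 0))); rewrite addr0.
have := mean_linear c (bounded_cst 1) (bounded_cst 0).
by rewrite m0 mean1 !mulr1 !addr0.
Qed.

Lemma mean_le f g : bounded_fun f -> bounded_fun g ->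
  (forall h, f (rho h x0) <= g (rho h x0)) -> mean f <= mean g.
Proof.
move=> fB gB fg; rewrite -subr_ge0.
have := mean_linear (-1) fB gB; rewrite mulN1r addrC => <-.
by apply: mean_ge0 => [|h]; [exact: bounded_comb | rewrite mulN1r addrC subr_ge0].
Qed.

Lemma mean_eq f g : bounded_fun f -> bounded_fun g ->
  (forall h, f (rho h x0) = g (rho h x0)) -> mean f = mean g.
Proof.
move=> fB gB fg; apply/eqP; rewrite eq_le !mean_le// => h; exact: eq_ler.
Qed.

Lemma mean_lin a f g : bounded_fun f -> bounded_fun g ->
  mean (fun q => a * f q + g q) = a * mean f + mean g.
Proof. exact: mean_linear. Qed.

(** Normalised at [x0], the distance to [z] is bounded as a function of [q], so that the mean
    applies to it. *)
Definition horo (q z : X) : R := d q z - d q x0.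

Lemma horo_lip q y z : horo q y - horo q z <= d y z.
Proof. by rewrite /horo; have := metric_triangle q z y; rewrite [d z y]metric_sym; lra. Qed.

Lemma horo_bounded z : bounded_fun (horo^~ z).
Proof.
exists (d z x0) => q; have := horo_lip q z x0; have := horo_lip q x0 z.
rewrite /horo subrr sub0r subr0 [d x0 z]metric_sym => h1 h2.
by rewrite ler_norml; apply/andP; split; lra.
Qed.

Definition meanF z := mean (horo^~ z).

Lemma meanF_lip y z : meanF y - meanF z <= d y z.
Proof.
rewrite lerBlDr /meanF -[d y z]mulr1 -mean1 -mean_lin; [|exact: bounded_cst|exact: horo_bounded].
apply: mean_le => [||h]; [exact: horo_bounded| |].
  by apply: bounded_comb; [exact: bounded_cst | exact: horo_bounded].
by rewrite mulr1 -lerBlDr; exact: horo_lip.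
Qed.

Lemma meanF_convex y z t : 0 <= t <= 1 ->
  meanF (geo y z t) <= (1 - t) * meanF y + t * meanF z.
Proof.
move=> t01; have Bz : bounded_fun (fun q => t * horo q z + 0) by apply: bounded_comb => //; exact: horo_bounded.
have -> : t * meanF z = mean (fun q => t * horo q z + 0).
  by rewrite mean_lin ?mean_cst ?addr0//; exact: horo_bounded.
rewrite -mean_lin//; last exact: horo_bounded.
apply: mean_le => [||h]; [exact: horo_bounded| |].
  by apply: bounded_comb => //; exact: horo_bounded.
rewrite addr0 /horo; have := @geo_dist_convex _ _ X_Hadamard (rho h x0) y z t t01; lra.
Qed.

(** Moving [z] by [g] amounts to moving [q] by the inverse, which only changes the normalisation in
    [horo]; the resulting constant does not depend on [z]. *)
Lemma meanF_rho g z : Y z -> meanF (rho g z) = meanF z + meanF (rho g x0).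
Proof.
move=> Yz; rewrite /meanF.
have Bcomp u : bounded_fun (fun q => horo (rho g q) u).
  by have [B uB] := horo_bounded u; exists B => q; exact: uB.
rewrite -(mean_inv g (horo_bounded (rho g z))) -(mean_inv g (horo_bounded (rho g x0))).
rewrite -[X in X + _]mul1r -mean_lin; [|exact: horo_bounded|exact: Bcomp].
apply: mean_eq; [exact: Bcomp| |move=> h].
  by apply: bounded_comb; [exact: horo_bounded|exact: Bcomp].
by rewrite mul1r /horo !rho_isometric//; do ?exact: rho_Y; ring.
Qed.

Lemma meanF_continuous : continuous meanF.
Proof. exact: (lipschitz1_continuous meanF_lip). Qed.

(** The proximal point of the convex function [meanF]. It exists because [meanF] is 1-Lipschitz,
    which confines the candidates to the ball of radius [c^-1]. *)
Lemma resolvent_ex c y : 0 < c -> Y y ->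
  exists2 p, Y p & forall z, Y z -> meanF p + c * d p y ^+ 2 <= meanF z + c * d z y ^+ 2.
Proof.
move=> c0 Yy.
apply: (@coercive_min _ _ _ (fun z => meanF z + c * d z y ^+ 2) y c^-1) => //.
  move=> z; apply: cvgD; first exact: meanF_continuous.
  apply: cvgM; first exact: cvg_cst.
  by apply: (cvgM (@mdist_continuous R X y z) (@mdist_continuous R X y z)).
move=> z Yz; rewrite mdistxx expr0n mulr0 addr0 => h.
have h2 := meanF_lip y z; have [->|yz0] := eqVneq y z; first by rewrite mdistxx invr_ge0 ltW.
have {}yz0 : 0 < d y z by rewrite mdist_gt0.
have {h h2} : c * d z y ^+ 2 <= d y z by lra.
rewrite [d z y]metric_sym expr2 mulrA -[leRHS]mul1r ler_pM2r//.
by rewrite -ler_pdivlMl// mulr1.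
Qed.

(** The variational inequality of the minimiser: [p] is compared with points of the geodesic to [q]
    that tend to [p], with [CN] for the quadratic term. *)
Lemma resolvent_le c y p q : 0 < c ->
  Y p -> (forall z, Y z -> meanF p + c * d p y ^+ 2 <= meanF z + c * d z y ^+ 2) ->
  Y q -> meanF p - meanF q <= c * (d q y ^+ 2 - d p y ^+ 2 - d p q ^+ 2).
Proof.
move=> c0 Yp pmin Yq; rewrite -subr_le0; apply: (@le0_of_small _ _ (c * d p q ^+ 2)).
move=> t /andP[t0 t1]; have t01 : 0 <= t <= 1 by rewrite ltW.
have h1 := pmin _ (Y_convex Yp Yq t01).
have h2 := meanF_convex p q t01.
have h3 := CN X_Hadamard y p q t01; rewrite !(metric_sym y) in h3.
have h4 := ler_wpM2l (ltW c0) h3.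
rewrite -(ler_pM2l t0).
set A := d p q ^+ 2 in h4 *; set B := d q y ^+ 2 in h4 *; set D := d p y ^+ 2 in h1 h4 *.
set E := d _ y ^+ 2 in h1 h4.
set fp := meanF p in h1 h2 *; set fq := meanF q in h2 *; set fg := meanF _ in h1 h2.
have h5 : fp + c * D <= (1 - t) * fp + t * fq + c * ((1 - t) * D + t * B - t * (1 - t) * A) by lra.
rewrite -subr_ge0; rewrite -subr_ge0 in h5; apply: le_trans h5 _; apply: eq_ler; ring.
Qed.

Definition nonexpansive_on (T : X -> X) :=
  [/\ forall y, Y y -> Y (T y),
      forall y z, Y y -> Y z -> d (T y) (T z) <= d y z &
      forall g y, Y y -> T (rho g y) = rho g (T y)].

Lemma resolvent c : 0 < c -> exists T, nonexpansive_on T /\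
  forall y z, Y y -> Y z -> meanF (T y) + c * d (T y) y ^+ 2 <= meanF z + c * d z y ^+ 2.
Proof.
move=> c0.
have H y : exists p, Y y -> Y p /\ forall z, Y z -> meanF p + c * d p y ^+ 2 <= meanF z + c * d z y ^+ 2.
  have [Yy|nYy] := pselect (Y y); last by exists y.
  by have [p Yp pmin] := resolvent_ex c0 Yy; exists p.
have [T TP] := choice H; exists T.
(* Stated for arbitrary minimisers: the case [y = z] is their uniqueness. Equivariance follows,
   since [rho g] carries a minimiser at [y] to a minimiser at [rho g y]. *)
have nonexp y z p q : Y p -> Y q ->
    (forall z', Y z' -> meanF p + c * d p y ^+ 2 <= meanF z' + c * d z' y ^+ 2) ->
    (forall z', Y z' -> meanF q + c * d q z ^+ 2 <= meanF z' + c * d z' z ^+ 2) ->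
    d p q <= d y z.
  move=> Yp Yq pm qm.
  have h1 := resolvent_le c0 Yp pm Yq; have h2 := resolvent_le c0 Yq qm Yp.
  have h3 := lerD h1 h2.
  rewrite [d q p]metric_sym -mulrDr (_ : meanF p - meanF q + (meanF q - meanF p) = 0) in h3; last by ring.
  rewrite pmulr_rge0// in h3.
  have [->|pq0] := eqVneq p q; first by rewrite mdistxx mdist_ge0.
  have {}pq0 : 0 < d p q by rewrite mdist_gt0.
  have {h3}: d p q ^+ 2 <= d y z * d p q.
    have := four_point X_Hadamard p q z y.
    rewrite [d z y]metric_sym; lra.
  by rewrite expr2 ler_pM2r.
split; first split.
- by move=> y /TP[].
- by move=> y z /TP[Yp pm] /TP[Yq qm]; exact: nonexp pm qm.
- move=> g y Yy; have [Yp pm] := TP _ Yy; have [Yq qm] := TP _ (rho_Y g Yy).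
  apply/mdist_positivity/eqP; rewrite eq_le mdist_ge0 andbT -(mdistxx (rho g y)).
  apply: (nonexp (rho g y) (rho g y)) => //; first exact: rho_Y.
  move=> z Yz; have Yz' := rho_Y g^-1%g Yz; rewrite rho_isometric//.
  rewrite -(rhoKV g Yz) (meanF_rho g Yp) (meanF_rho g Yz') rho_isometric//.
  by have := pm _ Yz'; lra.
by move=> y z /TP[_ pm]; exact: pm.
Qed.

(** If the displacements of [x0] stay bounded, the resolvents with [c] tending to 0 send [x0] to
    points that have a limit, where [meanF] is minimal. By equivariance the stabiliser of [x0] fixes
    these points and their limit. *)
Lemma resolvent_dichotomy :
  (forall n : R, exists2 T, nonexpansive_on T & n <= d x0 (T x0)) \/
  exists p, [/\ Y p, forall z, Y z -> meanF p <= meanF z &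
    forall g, rho g x0 = x0 -> rho g p = p].
Proof.
have [?|/existsNP[n nT]] := pselect (forall n : R, exists2 T, nonexpansive_on T & n <= d x0 (T x0)).
  by left.
right; have c0 (i : nat) : 0 < (i.+1%:R : R)^-1 by rewrite invr_gt0.
have [T TP] := choice (fun i => resolvent (c0 i)).
have Tn i : d x0 (T i x0) <= n.
  rewrite leNgt; apply/negP => /ltW h; apply: nT; exists (T i) => //; exact: (TP i).1.
have [w [wU sw]] := ultraFilterLemma (eventually_filter : ProperFilter eventually).
have [|p _ Tp] := @proper_ultra_cvg R X nat w (fun i => T i x0) x0 n X_proper wU.
  by apply: filterE.
have Yp : Y p.
  apply: (closed_cvg Y Y_closed _ _ Tp).
  by apply: filterE => i; have [[h _ _] _] := TP i; exact: h.
exists p; split.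
- exact: Yp.
- move=> z Yz; apply: (@cvg_le_to _ _ w _ (fun i => meanF (T i x0)) (fun i => meanF z + (i.+1%:R)^-1 * d z x0 ^+ 2)).
  + by apply: continuous_cvg; [exact: meanF_continuous|].
  + rewrite -[X in _ --> X]addr0; apply: cvgD; first exact: cvg_cst.
    rewrite -(mul0r (d z x0 ^+ 2)); apply: cvgMr_tmp.
    exact: cvg_trans (cvg_app _ sw) (@cvg_harmonic R).
  + apply: filterE => i; have [_ h] := TP i; have := h x0 z Y_base Yz.
    apply: le_trans; rewrite lerDl mulr_ge0 ?sqr_ge0// ltW//; exact: c0.
- move=> g gx0; apply: (metric_cvg_unique (F := w) (u := fun i => T i x0)) => //.
  apply/metricType_numDomainType.cvgrPdist_le => e e0.
  have h := cvg_mdist_le Tp e0.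
  near=> i; have hi : d p (T i x0) <= e by near: i; exact: h.
  have [[hY _ hg] _] := TP i.
  by rewrite -gx0 hg// rho_isometric//; exact: hY.
Unshelve. all: by end_near. Qed.

(** [A'] records the inverse of [A]; linearity is a consequence, drawn in [rotation_mx]. *)
Definition rotation_pair k (A A' : 'rV[R]_k -> 'rV[R]_k) :=
  [/\ forall v w, enorm (A v - A w) = enorm (v - w), A 0 = 0,
      cancel A A' & cancel A' A].

(** It bounds the dimension of flats and the number of orthogonal directions at infinity, since
    orthonormal vectors are 1-separated points of the unit ball. *)
Definition packing_bound (N : nat) := forall n (s : 'I_n -> X) (c : X),
  (forall i, d c (s i) <= 1) -> (forall i j, i != j -> 1 <= d (s i) (s j)) -> (n <= N)%N.

(** * Flats in the set where the average of the distance functions is minimal *)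

Section MinimumSet.
Variable p : X.
Hypothesis Yp : Y p.
Hypothesis p_min : forall z, Y z -> meanF p <= meanF z.
Hypothesis orbit_unbounded : forall B, exists g, B < d (rho g x0) x0.

(** The constant of [meanF_rho] is additive in [g]; minimality of [p] makes it nonnegative for [g]
    and for its inverse. *)
Let chi0 g : meanF (rho g x0) = 0.
Proof.
have chi_ge0 h : 0 <= meanF (rho h x0).
  by have := p_min (rho_Y h Yp); rewrite meanF_rho// lerDl.
apply/eqP; rewrite eq_le chi_ge0 andbT.
have := meanF_rho g (rho_Y g^-1%g Yp); rewrite rhoKV// (meanF_rho g^-1%g)//.
by have := chi_ge0 g^-1%g; lra.
Qed.

Let C : set X := [set y | Y y /\ meanF y <= meanF p].

Let CY y : C y -> Y y. Proof. by case. Qed.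

Let CF y : C y -> meanF y = meanF p.
Proof. by move=> [Yy yp]; apply/eqP; rewrite eq_le yp p_min. Qed.

Let Cp : C p. Proof. by split. Qed.

Let C_convex : convex_set X_Hadamard C.
Proof.
move=> y z t Cy Cz t01; split; first exact: Y_convex (CY Cy) (CY Cz) t01.
by apply: le_trans (meanF_convex _ _ t01) _; rewrite !CF//; apply: eq_ler; ring.
Qed.

Let C_closed : closed C.
Proof.
move=> y cy; have Yy : Y y by apply: Y_closed; apply: closureS cy => z [].
split => //; apply/ler_addgt0Pr => e e0.
have [z Cz yz] := (closureP _ _).1 cy e e0.
have := meanF_lip y z; rewrite (CF Cz); lra.
Qed.

Let C_rho g y : C y -> C (rho g y).
Proof.
move=> Cy; split; first exact/rho_Y/CY.
by rewrite meanF_rho ?chi0 ?addr0 ?CF//; exact: CY.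
Qed.

Definition ind (A : set X) (q : X) : R := `[< A q >]%:R.

Let indT (A : set X) q : A q -> ind A q = 1.
Proof. by move=> Aq; rewrite /ind asboolT. Qed.

Let indF (A : set X) q : ~ A q -> ind A q = 0.
Proof. by move=> Aq; rewrite /ind asboolF. Qed.

Let ind_ge0 A q : 0 <= ind A q.
Proof. by rewrite /ind ler0n. Qed.

Let ind_bounded A : bounded_fun (ind A).
Proof. by exists 1 => q; rewrite /ind; case: asboolP => _; rewrite ?normr1 ?normr0. Qed.

(** The null sets of the finitely additive measure defined by the mean, which only sees the orbit of
    [x0]. *)
Definition null (A : set X) := mean (ind A) = 0.

Let null_le (A : set X) : mean (ind A) <= 0 -> null A.
Proof.
by move=> A0; apply/eqP; rewrite eq_le A0; apply: mean_ge0 => // h; exact: ind_ge0.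
Qed.

Let null_sub (A B : set X) : (forall h, A (rho h x0) -> B (rho h x0)) -> null B -> null A.
Proof.
move=> AB B0; apply: null_le; rewrite -B0; apply: mean_le => // h.
have [/[dup] /AB Bh Ah|nA] := pselect (A (rho h x0)); first by rewrite !indT.
by rewrite indF.
Qed.

Let null_setU (A B : set X) : null A -> null B -> null (A `|` B).
Proof.
move=> A0 B0; apply: null_le; apply: (@le_trans _ _ (mean (fun q => 1 * ind A q + ind B q))).
  apply: mean_le => [//||h]; first exact: bounded_comb.
  rewrite mul1r; have [Ah|nA] := pselect (A (rho h x0)).
    by rewrite (indT Ah) indT; [rewrite lerDl | left].
  have [Bh|nB] := pselect (B (rho h x0)).
    by rewrite (indT Bh) indT; [rewrite lerDr | right].
  by rewrite indF ?addr_ge0// => -[].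
by rewrite mean_lin// A0 B0 mulr0 addr0.
Qed.

Let null_markov f e : bounded_fun f -> (forall h, 0 <= f (rho h x0)) -> 0 < e ->
  mean f <= 0 -> null [set q | e <= f q].
Proof.
move=> fB f0 e0 mf; apply: null_le; rewrite -(pmulr_rle0 _ e0).
apply: le_trans mf; rewrite -[e * _]addr0 -(mean_cst 0) -mean_lin//.
apply: mean_le => // [|h]; first exact: bounded_comb.
rewrite addr0; have [ef|nef] := pselect (e <= f (rho h x0)); first by rewrite indT ?mulr1.
by rewrite indF ?mulr0.
Qed.

Let full : set_system X := [set A | null (~` A)].

Let full_proper : ProperFilter full.
Proof.
apply: Build_ProperFilter.
  rewrite /full /= setC0 /null => m1; have := @oner_neq0 R.
  rewrite -mean1 -m1 (_ : ind setT = fun=> 1) ?eqxx//.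
  by apply/funext => q; rewrite indT.
split.
- rewrite /full /= setCT /null (_ : ind set0 = fun=> 0) ?mean_cst//.
  by apply/funext => q; rewrite indF.
- by move=> A B fA fB; rewrite /full /= setCI; exact: null_setU.
- by move=> A B AB; apply: null_sub => h nB /AB.
Qed.

(* Disjoint translates of a set have the same measure. *)
Let null_ball (y : X) r : null [set q | d q y <= r].
Proof.
apply: (@null_sub _ [set q | d q x0 <= r + d y x0]).
  by move=> h /= hr; apply: le_trans (metric_triangle _ y _) _; rewrite lerD2r.
move: (r + _) => {}r; set B := [set q | _]; apply: null_le.
rewrite leNgt; apply/negP => c0; set c := mean (ind B) in c0.
pose S s q : R := \sum_(g <- s) ind B (rho g^-1%g q).
have SB s : bounded_fun (S s).
  elim: s => [|g s [M sM]]; first by exists 0 => q; rewrite /S big_nil normr0.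
  have [N hN] := ind_bounded B; exists (N + M) => q; rewrite /S big_cons.
  by apply: le_trans (ler_normD _ _) _; apply: lerD; [exact: hN | exact: sM].
have mS s : mean (S s) = (size s)%:R * c.
  elim: s => [|g s IH].
    by rewrite mul0r -[RHS](mean_cst 0); congr mean; apply/funext => q; rewrite /S big_nil.
  rewrite (_ : S (g :: s) = fun q => 1 * ind B (rho g^-1%g q) + S s q); last first.
    by apply/funext => q; rewrite /S big_cons mul1r.
  rewrite mean_lin ?IH//; last by have [N hN] := ind_bounded B; exists N => q; exact: hN.
  by rewrite mean_inv// mul1r -natr1 mulrDl mul1r addrC.
pose far g s := forall h, h \in s -> 2 * r < d (rho g x0) (rho h x0).
have [s [ss sc]] : exists s, (forall h, S s (rho h x0) <= 1) /\ 1 < (size s)%:R * c.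
  have H n : exists s, (size s = n /\ forall h, S s (rho h x0) <= 1).
    elim: n => [|n [s [<- Ss]]].
      by exists [::]; split => // h; rewrite /S big_nil ler01.
    have [g gB] := orbit_unbounded (2 * r + \sum_(h <- s) d (rho h x0) x0).
    exists (g :: s); split => // h; rewrite /S big_cons.
    have [Bg|nBg] := pselect (B (rho g^-1%g (rho h x0))); last by rewrite indF// add0r Ss.
    rewrite indT// big_seq big1 ?addr0// => k ks; apply: indF => Bk.
    have near_B u : B (rho u^-1%g (rho h x0)) -> d (rho h x0) (rho u x0) <= r.
      have Yh := rho_Y h Y_base.
      by rewrite /B /= -(rho_isometric u (rho_Y _ Yh) Y_base) rhoKV.
    have d1 := near_B _ Bg; have d2 := near_B _ Bk.
    have d3 := metric_triangle (rho g x0) (rho h x0) x0.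
    have d4 := metric_triangle (rho h x0) (rho k x0) x0.
    have d5 : d (rho k x0) x0 <= \sum_(h <- s) d (rho h x0) x0.
      by rewrite (big_rem k)//= lerDl sumr_ge0// => *; exact: mdist_ge0.
    rewrite [d (rho g x0) (rho h x0)]metric_sym in d3.
    by move: gB d1 d2 d3 d4 d5; lra.
  have [s [ss Ss]] := H (Num.bound c^-1); exists s; split => //.
  rewrite ss -ltr_pdivrMr// mul1r; apply: archi_boundP; rewrite invr_ge0; exact: ltW.
have : mean (S s) <= 1.
  by rewrite -[X in _ <= X]mean1; apply: mean_le => //; exact: bounded_cst.
by rewrite mS leNgt sc.
Qed.

(** Balls are null, so such an ultrafilter leaves every ball. It stands for a point at infinity in
    the support of the mean, and defines the Busemann function [buse] and the rays [flow]. *)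
Definition at_infinity (w : set_system X) := UltraFilter w /\ full `<=` w.

Let Omega := {w : set_system X | at_infinity w}.
Implicit Types w : Omega.

Let OmU w : UltraFilter (sval w). Proof. by case: (svalP w). Qed.
Let OmF w : full `<=` sval w. Proof. by case: (svalP w). Qed.
Local Existing Instance OmU.

Let Om_orbit w (A : set X) : (forall h, A (rho h x0)) -> sval w A.
Proof.
move=> AO; apply: OmF; apply: null_le; rewrite -(mean_cst 0).
by apply: mean_le => // h; rewrite indF// => nA; exact: nA.
Qed.

Let Om_far w y r : \forall q \near sval w, r < d q y.
Proof.
apply: OmF; apply: null_sub (null_ball y r) => h /= nr.
by rewrite leNgt; apply/negP.
Qed.

Let buse w y : R := lim (horo q y @[q --> sval w]).

Let buse_cvg w y : horo q y @[q --> sval w] --> buse w y.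
Proof.
have [M yM] := horo_bounded y.
have [l _ yl] := @bounded_ultra_cvg R X (sval w) (horo^~ y) M (OmU w) (filterE _ yM).
by rewrite /buse; move/cvg_lim: (yl) => ->.
Qed.

Arguments buse_cvg : clear implicits.

Let buse_lip w y z : buse w y - buse w z <= d y z.
Proof.
apply: (cvg_le_to (cvgB (buse_cvg w y) (buse_cvg w z)) (cvg_cst (d y z))).
by apply: filterE => q; exact: horo_lip.
Qed.

(** [meanF] is constant on [C], so the nonnegative convexity defect [delta] has mean 0; by Markov's
    inequality it is small off a null set, hence tends to 0 along [w]. *)
Let buse_mid w y z : C y -> C z -> buse w (geo y z 2^-1) = 2^-1 * (buse w y + buse w z).
Proof.
move=> Cy Cz; have h01 : 0 <= (2^-1 : R) <= 1 by apply/andP; split; lra.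
pose m := geo y z 2^-1; have Cm : C m by exact: C_convex.
pose delta q := horo q y + horo q z - 2 * horo q m.
have delta_ge0 q : 0 <= delta q.
  rewrite /delta /horo; have := @geo_dist_convex _ _ X_Hadamard q y z _ h01.
  rewrite -/m; lra.
have deltaE : delta = (fun q => (-2) * horo q m + (1 * horo q y + horo q z)).
  by apply/funext => q; rewrite /delta; ring.
have B1 : bounded_fun (fun q => 1 * horo q y + horo q z).
  by apply: bounded_comb; exact: horo_bounded.
have deltaB : bounded_fun delta.
  by rewrite deltaE; apply: bounded_comb => //; exact: horo_bounded.
have mdelta : mean delta <= 0.
  rewrite deltaE mean_lin ?mean_lin//; do ?exact: horo_bounded.
  by rewrite -/(meanF m) -/(meanF y) -/(meanF z) !CF//; lra.
suff : buse w y + buse w z - 2 * buse w m = 0 by rewrite -/m; lra.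
have dl : delta q @[q --> sval w] --> buse w y + buse w z - 2 * buse w m.
  by apply: cvgB; [apply: cvgD; exact: buse_cvg | apply: cvgM; [exact: cvg_cst | exact: buse_cvg]].
apply/eqP; rewrite eq_le; apply/andP; split; last first.
  by apply: (cvgr_to_ge dl); apply: filterE => q; exact: delta_ge0.
apply/ler_addgt0Pr => e e0; rewrite add0r; apply: (cvgr_to_le dl).
apply: OmF; apply: null_sub (null_markov deltaB (fun h => delta_ge0 _) e0 mdelta) => h /= nh.
by rewrite leNgt; apply/negP => /ltW.
Qed.

Let buse_convex w y z t : 0 <= t <= 1 ->
  buse w (geo y z t) <= (1 - t) * buse w y + t * buse w z.
Proof.
move=> t01.
have c1 : (1 - t) * horo q y + t * horo q z @[q --> sval w] -->
    (1 - t) * buse w y + t * buse w z.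
  by apply: cvgD; apply: cvgM; [exact: cvg_cst|exact: buse_cvg|exact: cvg_cst|exact: buse_cvg].
apply: (cvg_le_to (buse_cvg w _) c1); apply: filterE => q; rewrite /horo.
by have := @geo_dist_convex _ _ X_Hadamard q y z t t01; lra.
Qed.

Let toward s y q := geo y q (s / d q y).

Let toward01 s y q : 0 <= s -> s < d q y -> 0 <= s / d q y <= 1.
Proof.
move=> s0 sq; have q0 : 0 < d q y by exact: le_lt_trans sq.
by rewrite divr_ge0 ?mdist_ge0//= ler_pdivrMr// mul1r ltW.
Qed.

Let toward_distl s y q : 0 <= s -> s < d q y -> d y (toward s y q) = s.
Proof.
move=> s0 sq; rewrite geo_distl ?toward01// [d y q]metric_sym mulfVK//.
by rewrite gt_eqF// (le_lt_trans s0).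
Qed.

Let toward_distr s y q : 0 <= s -> s < d q y -> d q (toward s y q) = d q y - s.
Proof.
move=> s0 sq; rewrite metric_sym geo_distr ?toward01// [d y q]metric_sym mulrBl mul1r mulfVK//.
by rewrite gt_eqF// (le_lt_trans s0).
Qed.

Definition flow w s y : X := xget y [set l | toward s y q @[q --> sval w] --> l].

Let flow_cvg w s y : 0 <= s -> toward s y q @[q --> sval w] --> flow w s y.
Proof.
move=> s0; rewrite /flow; have [|l _ yl] := @proper_ultra_cvg R X X (sval w) (toward s y) y s X_proper (OmU w).
  have := Om_far w y s; apply: filterS => q sq; by rewrite toward_distl.
by case: xgetP => [//|/(_ l)]; last by move/(_ yl).
Qed.

Arguments flow_cvg w {s} y _.

Let flow_near w s y e : 0 <= s -> 0 < e ->
  \forall q \near sval w, d (flow w s y) (toward s y q) < e.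
Proof. by move=> s0 e0; exact: (cvg_mdist_lt (flow_cvg w y s0)). Qed.

Let flow_eq w s y l : 0 <= s -> toward s y q @[q --> sval w] --> l -> flow w s y = l.
Proof. by move=> s0 yl; exact: (metric_cvg_unique _ (flow_cvg w y s0) yl). Qed.

(** The orbit points of [x0] are at distance [r] from points of the orbit of [p], which lies in [C].
    The geodesics from [y] to the two are at most [s * r / d q y] apart at parameter [s / d q y]. *)
Let flow_C w s y : 0 <= s -> C y -> C (flow w s y).
Proof.
move=> s0 Cy; apply: C_closed; apply/closureP => e e0.
pose r := d x0 p.
have Fl := flow_near w y s0 (divr_gt0 e0 (ltr0Sn _ 1)).
have Fo : sval w [set q | exists g, q = rho g x0] by apply: Om_orbit => h; exists h.
have [q [[/= hq sq] [g qE]]] := filter_ex (filterI (filterI Fl (Om_far w y (s + 2 * s * r / e))) Fo).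
have r0 : 0 <= r by exact: mdist_ge0.
have sr0 : 0 <= 2 * s * r / e by rewrite !mulr_ge0// invr_ge0 ltW.
have sq1 : s < d q y by apply: le_lt_trans sq; rewrite lerDl.
have q0 : 0 < d q y by exact: le_lt_trans sq1.
exists (geo y (rho g p) (s / d q y)).
  by apply: C_convex => //; [exact: C_rho | exact: toward01].
apply: le_lt_trans (metric_triangle _ (toward s y q) _) _.
rewrite [ltRHS]splitr; apply: ltr_leD => //.
apply: le_trans (geo_convex_from _ _ _ _ _) _; first exact: toward01.
rewrite qE rho_isometric// -qE -/r mulrAC ler_pdivrMr// mulrAC ler_pdivlMr//.
have : 2 * s * r / e < d q y by apply: le_lt_trans sq; rewrite lerDr.
rewrite ltr_pdivrMr// => /ltW; lra.
Qed.

Let flow_dist w s t y : 0 <= s -> 0 <= t -> d (flow w s y) (flow w t y) = `|s - t|.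
Proof.
move=> s0 t0; apply: (cvg_to_eq (mdist_cvg (flow_cvg w y s0) (flow_cvg w y t0))).
apply: (@filterS _ _ _ _ _ _ (filterI (Om_far w y s) (Om_far w y t))) => q [/= sq tq].
have q0 : 0 < d q y by exact: le_lt_trans sq.
rewrite /toward geo_dist ?toward01// -mulrBl normrM normfV (ger0_norm (mdist_ge0 _ _)).
by rewrite [d y q]metric_sym mulfVK// gt_eqF.
Qed.

Let flow_ray w y : is_ray (fun s => flow w s y).
Proof. by move=> s t; exact: flow_dist. Qed.

Let flow0 w y : flow w 0 y = y.
Proof.
apply: flow_eq => //; rewrite (_ : toward 0 y = fun=> y); first exact: cvg_cst.
by apply/funext => q; rewrite /toward mul0r geo0.
Qed.

Let flow_disp w s y : 0 <= s -> d y (flow w s y) = s.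
Proof.
by move=> s0; rewrite -[X in d X _](flow0 w) flow_dist// sub0r normrN ger0_norm.
Qed.

Let buse_flow w s y : 0 <= s -> buse w (flow w s y) = buse w y - s.
Proof.
move=> s0.
have H : horo q (flow w s y) - horo q (toward s y q) @[q --> sval w] --> (0 : R).
  apply/cvgrPdist_le => e e0.
  have := flow_near w y s0 e0; apply: filterS => q /= /ltW hq; rewrite sub0r normrN.
  have h1 := horo_lip q (flow w s y) (toward s y q).
  have h2 := horo_lip q (toward s y q) (flow w s y).
  by rewrite metric_sym in h2; rewrite ler_norml; apply/andP; split; lra.
have H2 : horo q (flow w s y) - (horo q (flow w s y) - horo q (toward s y q)) @[q --> sval w]
   --> buse w (flow w s y) - 0 by apply: cvgB H; exact: buse_cvg.
have H3 : horo q y - s @[q --> sval w] --> buse w y - s.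
  by apply: cvgB; [exact: buse_cvg | exact: cvg_cst].
rewrite subr0 in H2; apply/eqP; rewrite -subr_eq0; apply/eqP.
apply: (cvg_to_eq (cvgB H2 H3)); have := Om_far w y s; apply: filterS => q /= sq.
by rewrite subKr !fctE /horo toward_distr//; ring.
Qed.

(* If the flow brought y and z closer, the Busemann function would be too small
   at their midpoint. *)
Let flow_isometric w s y z : 0 <= s -> C y -> C z -> d (flow w s y) (flow w s z) = d y z.
Proof.
move=> s0 Cy Cz; have h01 : 0 <= (2^-1 : R) <= 1 by apply/andP; split; lra.
pose y' := flow w s y; pose z' := flow w s z.
pose m := geo y z 2^-1; pose m' := geo y' z' 2^-1.
have hm : s <= d m m'.
  have h1 := buse_lip w m m'; have h2 := buse_convex w y' z' h01.
  rewrite /y' /z' !buse_flow// -/y' -/z' -/m' in h2.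
  by rewrite [X in X - _]buse_mid// in h1; lra.
have h2 : 1 - 2^-1 = 2^-1 :> R by field.
have c1 := CN X_Hadamard m y' z' h01; have c2 := CN X_Hadamard y' y z h01.
have c3 := CN X_Hadamard z' y z h01.
have f4 := four_point X_Hadamard y z z' y'.
rewrite h2 -/m -/m' in c1 c2 c3.
rewrite ![d m _]metric_sym [d y' y]metric_sym [d z' z]metric_sym [d z' y]metric_sym in c1 c2 c3.
rewrite [d z' y']metric_sym in f4; rewrite [d y' z]metric_sym in c2.
rewrite !flow_disp// in c2 c3 f4.
have hm2 : s ^+ 2 <= d m' m ^+ 2 by rewrite metric_sym ler_sqr ?nnegrE ?mdist_ge0.
have : (d y z - d y' z') ^+ 2 <= 0.
  move: c1 c2 c3 f4 hm2; rewrite -/y' -/z'.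
  set a1 := d y' m ^+ 2; set a2 := d z' m ^+ 2; set a3 := d m' m ^+ 2.
  set a4 := d y z' ^+ 2; set a5 := d z y' ^+ 2; set a6 := s ^+ 2.
  by rewrite sqrrB -mulr_natl; lra.
move=> h; apply/eqP; rewrite eq_sym -subr_eq0 -sqrf_eq0 eq_le h sqr_ge0//.
Qed.

Let flowD w s t y : 0 <= s -> 0 <= t -> C y -> flow w s (flow w t y) = flow w (s + t) y.
Proof.
move=> s0 t0 Cy.
apply: (@asymptotic_rays_eq _ _ X_Hadamard (fun s => flow w s (flow w t y)) (fun s => flow w (s + t) y) (t + t)).
- exact: flow_ray.
- move=> a b a0 b0; rewrite flow_dist ?addr_ge0//; congr `|_|; ring.
- move=> a a0; apply: le_trans (metric_triangle _ (flow w a y) _) _; apply: lerD.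
    by rewrite flow_isometric//; [rewrite metric_sym flow_disp | exact: flow_C].
  by rewrite flow_dist ?addr_ge0// opprD addrA subrr sub0r normrN ger0_norm.
- by rewrite flow0 add0r.
- exact: s0.
Qed.

(** For fixed [t] both sides are rays in [s] with the same origin, at bounded distance from
    [flow w s y]. *)
Let flow_comm w w' s t y : 0 <= s -> 0 <= t -> C y ->
  flow w s (flow w' t y) = flow w' t (flow w s y).
Proof.
move=> s0 t0 Cy.
apply: (@asymptotic_rays_eq _ _ X_Hadamard (fun s => flow w s (flow w' t y)) (fun s => flow w' t (flow w s y)) (t + t)).
- exact: flow_ray.
- by move=> a b a0 b0; rewrite flow_isometric ?flow_dist//; exact: flow_C.
- move=> a a0; apply: le_trans (metric_triangle _ (flow w a y) _) _; apply: lerD.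
    by rewrite flow_isometric//; [rewrite metric_sym flow_disp | exact: flow_C].
  by rewrite flow_disp.
- by rewrite !flow0.
- exact: s0.
Qed.

(** The linear coefficient supplied by [parallel_rays_dist] is identified by comparing distances
    with the 1-Lipschitz function [buse w], once from [y] to the ray of [z] and once the other way
    round. *)
Let flow_quadratic w s y z : 0 <= s -> C y -> C z ->
  d y (flow w s z) ^+ 2 = s ^+ 2 + 2 * s * (buse w y - buse w z) + d y z ^+ 2.
Proof.
move=> s0 Cy Cz.
have [||a b c a0 b0 c0|al alE] := parallel_rays_dist X_Hadamard
    (p := fun s => flow w s y) (q := fun s => flow w s z).
- exact: flow_ray.
- exact: flow_ray.
- by rewrite ![_ + c]addrC -!flowD// flow_isometric//; exact: flow_C.
rewrite !flow0 in alE.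
have bound y' z' be : C y' -> C z' ->
    (forall t, 0 <= t -> d y' (flow w t z') ^+ 2 = t ^+ 2 + be * t + d y' z' ^+ 2) ->
    2 * (buse w y' - buse w z') <= be.
  move=> Cy' Cz' beE.
  have := @quadratic_asymptotics R (fun t => t) (fun t => d y' (flow w t z'))
    (- (buse w y' - buse w z')) 0 0 be (d y' z' ^+ 2).
  move=> H; suff : 0 <= be + 2 * (- (buse w y' - buse w z')) by lra.
  apply: H => [//|t _|t _|t t0|t t0]; first exact: mdist_ge0.
  - by rewrite mul0r !addr0.
  - exact: beE.
  - by have := buse_lip w y' (flow w t z'); rewrite buse_flow//; lra.
have b1 : 2 * (buse w y - buse w z) <= al.
  apply: bound => // t t0; have := alE 0 t (lexx _) t0.
  by rewrite flow0 subr0.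
have b2 : 2 * (buse w z - buse w y) <= - al.
  apply: bound => // t t0; have := alE t 0 t0 (lexx _).
  by rewrite flow0 sub0r (metric_sym (flow w t y)) (metric_sym z y) sqrrN mulrN mulNr.
have := alE 0 s (lexx _) s0; rewrite flow0 subr0 => ->.
have -> : al = 2 * (buse w y - buse w z) by lra.
ring.
Qed.

Let buse_flow_diff w w' s y z : 0 <= s -> C y -> C z ->
  buse w (flow w' s y) - buse w (flow w' s z) = buse w y - buse w z.
Proof.
move=> s0 Cy Cz.
have h1 := @flow_quadratic w 1 y z ler01 Cy Cz.
have h2 := @flow_quadratic w 1 _ _ ler01 (flow_C w' s0 Cy) (flow_C w' s0 Cz).
rewrite flow_comm// !flow_isometric ?h1// in h2; last exact: flow_C.
by move: h2; lra.
Qed.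

(** The cosine of the angle between the directions [w] and [w']; by [buse_flow_diff] it would be the
    same at any other point of [C]. *)
Let gram w w' : R := buse w p - buse w (flow w' 1 p).

Let gram_aux w w' s u : 0 <= s -> 0 <= u ->
  s * (buse w p - buse w (flow w' u p)) = u * (buse w' p - buse w' (flow w s p)).
Proof.
move=> s0 u0.
have h1 := flow_quadratic w s0 (flow_C w' u0 Cp) Cp.
have h2 := flow_quadratic w' u0 (flow_C w s0 Cp) Cp.
rewrite metric_sym h2 [d (flow w s p) p]metric_sym [d (flow w' u p) p]metric_sym in h1.
rewrite !flow_disp// in h1.
by move: h1; lra.
Qed.

Let gramC w w' : gram w w' = gram w' w.
Proof. by have := gram_aux w w' ler01 ler01; rewrite !mul1r. Qed.

Let buse_flow_gram w w' s y : 0 <= s -> C y -> buse w (flow w' s y) = buse w y - s * gram w w'.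
Proof.
move=> s0 Cy; have := buse_flow_diff w w' s0 Cy Cp.
have H : buse w p - buse w (flow w' s p) = s * gram w w'.
  by have := gram_aux w w' ler01 s0; rewrite mul1r gramC; exact.
by lra.
Qed.

Let gram1 w : gram w w = 1.
Proof. by rewrite /gram buse_flow// subKr. Qed.

Let full_rho g A : full A -> full (rho g @^-1` A).
Proof.
rewrite /full /= /null => A0; rewrite -A0 -(mean_inv g (ind_bounded (~` A))).
by congr mean.
Qed.

Let act_infinity g w : at_infinity (rho g @ sval w).
Proof. by split; [exact: fmap_ultra | move=> A /(full_rho g); exact: OmF]. Qed.

Let actO g w : Omega := exist _ _ (act_infinity g w).

Let flow_rho g w s y : 0 <= s -> C y -> rho g (flow w s y) = flow (actO g w) s (rho g y).
Proof.
move=> s0 Cy; have Yf := CY (flow_C w s0 Cy); apply/esym/flow_eq => //.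
apply/metricType_numDomainType.cvgrPdist_lt => e e0.
have Fl := flow_near w y s0 e0.
have OY : sval w Y by apply: Om_orbit => h; exact: rho_Y.
apply: (@filterS _ _ _ _ _ _ (filterI (filterI Fl OY) (Om_far w y s))) => q [[/= fq Yq] sq].
rewrite /toward rho_isometric//; last exact: CY.
rewrite -rho_geo ?toward01//; last exact: CY.
by rewrite rho_isometric//; apply: Y_convex; [exact: CY | | exact: toward01].
Qed.

Let gram_act g w w' : gram (actO g w) (actO g w') = gram w w'.
Proof.
have Cg := C_rho g Cp.
have h1 := @flow_quadratic w 1 _ _ ler01 (flow_C w' ler01 Cp) Cp.
have h2 := @flow_quadratic (actO g w) 1 _ _ ler01 (flow_C (actO g w') ler01 Cg) Cg.
rewrite -!flow_rho// !rho_isometric// ?h1 in h2; do ?[exact: CY | apply: CY; exact: flow_C].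
rewrite flow_rho// !buse_flow_gram// in h2.
by move: h2; lra.
Qed.

(** Formal linear combinations of directions, on which [pair] turns out to be a positive
    semidefinite form. Those with nonnegative coefficients act on [C], as a flow only runs
    forward. *)
Let combo := seq (R * Omega).
Implicit Types l a c : combo.

Let lin l (h : Omega -> R) : R := \sum_(x <- l) x.1 * h x.2.
Let pair l l' : R := lin l (fun w => lin l' (gram w)).
Let nonneg l : bool := all (fun x => 0 <= x.1) l.
Let act l y : X := foldr (fun x z => flow x.2 x.1 z) y l.
Let scale (r : R) l : combo := [seq (r * x.1, x.2) | x <- l].

Let lin_cat l l' h : lin (l ++ l') h = lin l h + lin l' h.
Proof. by rewrite /lin big_cat. Qed.

Let lin_scale r l h : lin (scale r l) h = r * lin l h.
Proof. by rewrite /lin big_map mulr_sumr; apply: eq_bigr => x _; rewrite mulrA. Qed.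

Let pairC l l' : pair l l' = pair l' l.
Proof.
rewrite /pair /lin; under eq_bigr do rewrite mulr_sumr.
rewrite exchange_big; apply: eq_bigr => x _; rewrite mulr_sumr.
by apply: eq_bigr => z _; rewrite gramC; ring.
Qed.

Let pair_catl l l' c : pair (l ++ l') c = pair l c + pair l' c.
Proof. exact: lin_cat. Qed.

Let pair_scalel r l c : pair (scale r l) c = r * pair l c.
Proof. exact: lin_scale. Qed.

Let pair_catr l l' c : pair c (l ++ l') = pair c l + pair c l'.
Proof. by rewrite pairC pair_catl !(pairC c). Qed.

Let pair_scaler r l c : pair c (scale r l) = r * pair c l.
Proof. by rewrite pairC pair_scalel pairC. Qed.

Let act_C l y : nonneg l -> C y -> C (act l y).
Proof. by elim: l => [//|x l IH] /= /andP[x0' l0] Cy; apply: flow_C => //; exact: IH. Qed.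

Let act_isometric l y z : nonneg l -> C y -> C z -> d (act l y) (act l z) = d y z.
Proof.
move=> + Cy Cz; elim: l => [//|x l IH] /= /andP[x0' l0].
by rewrite flow_isometric ?IH//; exact: act_C.
Qed.

Let buse_act w l y : nonneg l -> C y -> buse w (act l y) = buse w y - lin l (gram w).
Proof.
move=> + Cy; elim: l => [|x l IH] /=; first by rewrite /lin big_nil subr0.
move=> /andP[x0' l0]; rewrite buse_flow_gram//; last exact: act_C.
by rewrite IH// /lin big_cons; ring.
Qed.

(** One flow is peeled off at a time with [flow_quadratic]. Thus [act^~ p] embeds the cone of
    nonnegative combinations isometrically for the seminorm of [pair]. *)
Let act_dist l l' : nonneg l -> nonneg l' ->
  d (act l p) (act l' p) ^+ 2 = pair l l - 2 * pair l l' + pair l' l'.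
Proof.
have cons_pair x a c : pair (x :: a) c = x.1 * lin c (gram x.2) + pair a c.
  by rewrite /pair /lin big_cons.
have cons_pairr x a c : pair c (x :: a) = x.1 * lin c (gram x.2) + pair c a.
  by rewrite pairC cons_pair pairC.
have nilr c : pair c [::] = 0 by rewrite pairC /pair /lin big_nil.
have lin_cons x a h : lin (x :: a) h = x.1 * h x.2 + lin a h by rewrite /lin big_cons.
have dist0 a : nonneg a -> d p (act a p) ^+ 2 = pair a a.
  elim: a => [|x a IH] /=; first by rewrite mdistxx expr0n nilr.
  move=> /andP[x0' a0]; rewrite flow_quadratic//; last exact: act_C.
  by rewrite buse_act// IH// cons_pair !cons_pairr lin_cons gram1; ring.
move=> l0; elim: l' => [|x l' IH] /=.
  by move=> _; rewrite metric_sym dist0// !nilr mulr0 subr0 addr0.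
move=> /andP[x0' l'0]; rewrite flow_quadratic//; do ?exact: act_C.
by rewrite !buse_act// IH// cons_pair !cons_pairr lin_cons gram1; ring.
Qed.

Let pos l : combo := [seq (Num.max x.1 0, x.2) | x <- l].
Let neg l : combo := [seq (Num.max (- x.1) 0, x.2) | x <- l].

Let pos_nonneg l : nonneg (pos l).
Proof. by elim: l => //= x l ->; rewrite le_max lexx orbT. Qed.

Let neg_nonneg l : nonneg (neg l).
Proof. by elim: l => //= x l ->; rewrite le_max lexx orbT. Qed.

Let lin_pos_neg l h : lin (pos l) h = lin (neg l) h + lin l h.
Proof.
rewrite /lin !big_map -big_split; apply: eq_bigr => x _ /=; rewrite -mulrDl; congr (_ * _).
have [x0'|x0'] := leP 0 x.1.
  by rewrite max_r ?add0r// oppr_le0.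
by rewrite max_l ?addNr// oppr_ge0 ltW.
Qed.

Let pair_pos_negl l c : pair (pos l) c = pair (neg l) c + pair l c.
Proof. exact: lin_pos_neg. Qed.

Let pair_pos_negr l c : pair c (pos l) = pair c (neg l) + pair c l.
Proof. by rewrite !(pairC c) pair_pos_negl. Qed.

(** Splitting [l] into [pos l] minus [neg l] exhibits the value as a squared distance. *)
Let pair_ge0 l : 0 <= pair l l.
Proof.
have := act_dist (pos_nonneg l) (neg_nonneg l).
rewrite !pair_pos_negl !pair_pos_negr (pairC (neg l) l) => h.
apply: le_trans (sqr_ge0 (d (act (pos l) p) (act (neg l) p))) _; rewrite h.
by apply: eq_ler; ring.
Qed.

Let pair_null l c : pair l l = 0 -> pair l c = 0.
Proof.
move=> l0; apply/eqP; apply: contraT => lc0.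
(* With this [r] the form takes the value -1 at [scale r l ++ c]. *)
pose r := - (pair c c + 1) / (2 * pair l c).
have := pair_ge0 (scale r l ++ c).
rewrite pair_catl !pair_catr !pair_scalel !pair_scaler l0 (pairC c l).
have : r * pair l c = - (pair c c + 1) / 2 by rewrite /r; field.
by move: (r * _) => z ->; lra.
Qed.

Variable N : nat.
Hypothesis packing : packing_bound N.

Let orthonormal j (e : 'I_j -> combo) := forall i k, pair (e i) (e k) = (i == k)%:R.

(** Adding one large combination [n] makes every [e i] nonnegative without changing differences. The
    points [act (L i) p] are then at distance 1 from [act n p] and sqrt 2 from one another. *)
Let orthonormal_bound j (e : 'I_j -> combo) : orthonormal e -> (j <= N)%N.
Proof.
move=> eo.
have cat_nonneg (s : seq combo) : all nonneg s -> nonneg (flatten s).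
  by elim: s => //= l s IH /andP[l0 /IH]; rewrite /nonneg all_cat => ->; rewrite andbT.
have lin_flatten (r : seq 'I_j) (P : pred 'I_j) (F : 'I_j -> combo) h :
    lin (flatten [seq F i | i <- r & P i]) h = \sum_(i <- r | P i) lin (F i) h.
  elim: r => [|i r IH]; first by rewrite big_nil /lin big_nil.
  by rewrite big_cons /=; case: (P i) => //=; rewrite lin_cat IH.
pose n := flatten [seq neg (e i) | i <- enum 'I_j & true].
pose L i := pos (e i) ++ flatten [seq neg (e k) | k <- enum 'I_j & k != i].
have n0 : nonneg n by apply: cat_nonneg; rewrite all_map; apply/allP => i _; exact: neg_nonneg.
have L0 i : nonneg (L i).
  rewrite /nonneg all_cat [all _ _]pos_nonneg /=; apply: cat_nonneg.
  by rewrite all_map; apply/allP => k _; exact: neg_nonneg.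
have linL i h : lin (L i) h = lin n h + lin (e i) h.
  rewrite lin_cat !lin_flatten lin_pos_neg [X in _ = X + _](bigD1_seq i) ?mem_enum ?enum_uniq//=.
  by ring.
have pairLl i c : pair (L i) c = pair n c + pair (e i) c by exact: linL.
have pairLr i c : pair c (L i) = pair c n + pair c (e i) by rewrite !(pairC c) pairLl.
apply: (packing (s := fun i => act (L i) p) (c := act n p)).
  move=> i; rewrite -ler_sqr ?nnegrE ?mdist_ge0// expr1n act_dist// pairLl !pairLr.
  by rewrite eo eqxx (pairC (e i) n) mulr1n; lra.
move=> i k ik; rewrite -[leRHS](ger0_norm (mdist_ge0 _ _)) -[leLHS](ger0_norm ler01).
rewrite -ler_sqr ?nnegrE// !real_normK ?num_real// expr1n act_dist// !pairLl !pairLr.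
rewrite !eo !eqxx (negbTE ik) (pairC (e i) n) (pairC (e k) n) mulr1n mulr0n; lra.
Qed.

(** The packing bound makes the dimension finite, and a single direction, which has norm 1, makes it
    positive. *)
Let maximal_orthonormal : exists j (e : 'I_j -> combo), [/\ (0 < j)%N, orthonormal e &
  forall a, (forall i, pair a (e i) = 0) -> pair a a = 0].
Proof.
have [w0 [w0U fw0]] := ultraFilterLemma full_proper.
pose w : Omega := exist _ w0 (conj w0U fw0).
pose P j := `[< exists e : 'I_j -> combo, orthonormal e >].
have P1 : P 1%N.
  apply/asboolP; exists (fun=> [:: (1, w)]) => i k.
  by rewrite /pair /lin !big_seq1 /= gram1 !mulr1 !ord1 eqxx.
have PN j : P j -> (j <= N)%N by move=> /asboolP[e /orthonormal_bound].
have [j /asboolP[e eo] jmax] := ex_maxnP (ex_intro P _ P1) PN.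
exists j, e; split => //; first exact: jmax.
move=> a ae; apply/eqP; apply: contraT => a0.
have a_gt0 : 0 < pair a a by rewrite lt_neqAle eq_sym a0 pair_ge0.
pose a' := scale (Num.sqrt (pair a a))^-1 a.
suff /jmax : P j.+1 by rewrite ltnn.
apply/asboolP; exists (fun i => if unlift ord0 i is Some i' then e i' else a') => i k.
have [i' ->|->] := unliftP ord0 i; have [k' ->|->] := unliftP ord0 k.
- by rewrite eo (inj_eq (@lift_inj _ _)).
- by rewrite pairC pair_scalel ae mulr0 eq_sym (negbTE (neq_lift _ _)).
- by rewrite pair_scalel ae mulr0 (negbTE (neq_lift _ _)).
- rewrite pair_scalel pair_scaler eqxx mulrA -invfM -expr2 sqr_sqrtr ?ltW//.
  by rewrite mulVf.
Qed.

(* Since [mean Theta = 0], a function with nonnegative limits at infinity has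
   only zero limits. *)
Let mean_zero (Theta : X -> R) : bounded_fun Theta -> mean Theta = 0 ->
  (forall w (l : R), Theta q @[q --> sval w] --> l -> 0 <= l) ->
  forall w (l : R), Theta q @[q --> sval w] --> l -> l <= 0.
Proof.
move=> TB T0 Tge w l Tl.
have null_neg e : 0 < e -> null [set q | Theta q <= - e].
  move=> e0; apply: contrapT => nn.
  have FP : ProperFilter full by exact: full_proper.
  have PF : ProperFilter (within [set q | Theta q <= - e] full).
    apply: Build_ProperFilter_ex => A; rewrite /within /full /= => nA.
    apply: contrapT => /forallNP nex; apply: nn; apply: null_sub nA => h /= Th.
    by move/(_ Th); exact: nex.
  have [v [vU sv]] := ultraFilterLemma PF.
  have vI : at_infinity v.
    by split => // A fA; apply: sv; apply: filterS fA => q Aq _.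
  have [M TM] := TB; have [l' _ Tl'] := bounded_ultra_cvg vU (filterE _ TM).
  have := Tge (exist _ v vI) l' Tl'; apply/negP; rewrite -ltNge.
  apply: (@le_lt_trans _ _ (- e)); last by rewrite oppr_lt0.
  by apply: (cvgr_to_le Tl'); apply: sv; rewrite /within /=; apply: filterE.
apply/ler_addgt0Pr => e e0; rewrite add0r; apply: (cvgr_to_le Tl).
suff : null [set q | e <= Theta q].
  move=> Nu; apply: OmF; apply: null_sub Nu => h /= nh.
  by rewrite leNgt; apply/negP => /ltW.
apply: null_le; apply: (@le0_of_small _ _ e^-1) => t /andP[t0 t1].
have tB : bounded_fun (fun q => 1 * Theta q + t) by apply: bounded_comb.
have [M TM] := TB.
(* [Theta + t] is almost everywhere nonnegative and has mean [t]. *)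
pose f q := e * ind [set q | e <= Theta q] q + (- M - t) * ind [set q | Theta q <= - t] q.
have fB : bounded_fun f.
  apply: bounded_comb => //; have [K hK] := ind_bounded [set q | Theta q <= - t].
  by exists (`|- M - t| * K) => q; rewrite normrM ler_wpM2l.
have : mean f <= mean (fun q => 1 * Theta q + t).
  apply: mean_le => // h; rewrite /f mul1r; set q := rho h x0.
  have := TM q; rewrite ler_norml => /andP[TM1 TM2].
  have [qe|qe] := pselect (e <= Theta q).
    rewrite (@indT [set q | e <= Theta q])// (@indF [set q | Theta q <= - t]); last by rewrite /=; lra.
    by rewrite mulr0 addr0 mulr1; lra.
  rewrite (@indF [set q | e <= Theta q])// mulr0 add0r.
  have [qt|qt] := pselect (Theta q <= - t).
    by rewrite (@indT [set q | Theta q <= - t])// mulr1; lra.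
  rewrite (@indF [set q | Theta q <= - t])// mulr0; move/negP: qt; rewrite -ltNge; lra.
rewrite mean_lin// mean_cst T0 mulr0 add0r /f.
have -> : (fun q => e * ind [set q | e <= Theta q] q + (- M - t) * ind [set q | Theta q <= - t] q) =
   (fun q => e * ind [set q | e <= Theta q] q + ((- M - t) * ind [set q | Theta q <= - t] q + 0)).
  by apply/funext => q; rewrite addr0.
rewrite mean_lin//; last by apply: bounded_comb.
by rewrite mean_lin// (null_neg _ t0) mulr0 mean_cst !addr0 mulrC ler_pdivlMr// mulrC.
Qed.

(** A priori the points [act l p] only fill a cone. Its closure is all of [R^j] because the
    directions are balanced: [meanF] being constant on [C], a linear functional has mean 0 over the
    directions and cannot be nonnegative on all of them without vanishing. *)
Lemma minimum_set_flat : exists j (f : 'rV[R]_j -> X), [/\ (0 < j)%N, flat f,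
    forall v, Y (f v), f 0 = p &
    forall g, exists A A', rotation_pair A A' /\
      forall v, d (rho g (f v)) (f (A v)) <= d (rho g (f 0)) (f 0)].
Proof.
have [j [e [j0 eo emax]]] := maximal_orthonormal.
pose pr a : 'rV[R]_j := \row_i pair a (e i).
have prE a i : pr a 0 i = pair a (e i) by rewrite mxE.
have pr_cat a c : pr (a ++ c) = pr a + pr c by apply/rowP => i; rewrite !mxE pair_catl.
have pr_scale r a : pr (scale r a) = r *: pr a by apply/rowP => i; rewrite !mxE pair_scalel.
pose recons (v : 'rV[R]_j) : combo := flatten [seq scale (v 0 i) (e i) | i <- enum 'I_j].
have lin_recons v h : lin (recons v) h = \sum_i v 0 i * lin (e i) h.
  rewrite /recons -[RHS]big_enum /=; elim: (enum _) => [|i r IH]; first by rewrite big_nil /lin big_nil.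
  by rewrite big_cons /= lin_cat lin_scale IH.
have pair_recons v a : pair (recons v) a = dot v (pr a).
  rewrite /pair lin_recons dotE; apply: eq_bigr => i _; rewrite prE pairC //.
have pr_recons v : pr (recons v) = v.
  apply/rowP => k; rewrite prE pair_recons dotE (bigD1 k)//= prE eo eqxx mulr1 big1 ?addr0// => i ik.
  by rewrite prE eo eq_sym (negbTE ik) mulr0.
(* [a] minus its projection is orthogonal to every [e i], hence null by maximality, hence in the
   radical of the form. *)
have pairE a c : pair a c = dot (pr a) (pr c).
  pose a' := a ++ scale (-1) (recons (pr a)).
  have a'0 : pair a' a' = 0.
    apply: emax => i; rewrite pair_catl pair_scalel -!prE pr_recons mulN1r subrr//.
  have := pair_null c a'0; rewrite pair_catl pair_scalel pair_recons; lra.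
have dist_pr l l' : nonneg l -> nonneg l' -> d (act l p) (act l' p) = enorm (pr l - pr l').
  move=> l0 l'0; apply/eqP; rewrite -(@eqrXn2 _ 2) ?mdist_ge0 ?enorm_ge0//.
  rewrite act_dist// enorm_sqr !pairE dotBl !dotBr (dotC (pr l') (pr l)).
  by apply/eqP; ring.
have pr_nil : pr [::] = 0 by apply/rowP => i; rewrite !mxE /pair /lin big_nil.
(* The functional is the limit of [Theta] in each direction, and [Theta] has mean 0; by [mean_zero]
   it vanishes on every direction. *)
have dual0 u : (forall w, 0 <= dot u (pr [:: (1, w)])) -> u = 0.
  move=> u0; pose a := recons u.
  pose Th (s : combo) q := \sum_(x <- s) x.1 * (horo q p - horo q (flow x.2 1 p)).
  have Th_nil : Th [::] = fun=> 0 by apply/funext => q; rewrite /Th big_nil.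
  have Th_cons x s : Th (x :: s) =
      (fun q => x.1 * ((-1) * horo q (flow x.2 1 p) + horo q p) + Th s q).
    by apply/funext => q; rewrite /Th big_cons; congr (_ * _ + _); ring.
  pose Theta := Th a.
  have Tcvg w : Theta q @[q --> sval w] --> dot u (pr [:: (1, w)]).
    rewrite -pair_recons -/a /pair /Theta; elim: (a) => [|x s IH].
      by rewrite Th_nil /lin big_nil; exact: cvg_cst.
    rewrite Th_cons /lin big_cons big_seq1 mul1r gramC; apply: cvgD IH.
    apply: cvgM; first exact: cvg_cst.
    have -> : gram w x.2 = (-1) * buse w (flow x.2 1 p) + buse w p by rewrite /gram; ring.
    have c1 : (-1) * horo q (flow x.2 1 p) @[q --> sval w] --> (-1) * buse w (flow x.2 1 p).
      by apply: cvgM; [exact: cvg_cst | exact: buse_cvg].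
    by apply: (cvgD c1); exact: buse_cvg.
  have TB : bounded_fun Theta /\ mean Theta = 0.
    rewrite /Theta; elim: (a) => [|x s [sB s0]].
      by rewrite Th_nil mean_cst; split => //; exact: bounded_cst.
    have hB : bounded_fun (fun q => (-1) * horo q (flow x.2 1 p) + horo q p).
      by apply: bounded_comb; exact: horo_bounded.
    rewrite Th_cons; split; first exact: bounded_comb.
    rewrite mean_lin// s0 mean_lin; do ?exact: horo_bounded.
    rewrite -/(meanF _) -/(meanF p) CF; last exact: flow_C.
    by ring.
  have [TBd Tm] := TB.
  have Tge w (l : R) : Theta q @[q --> sval w] --> l -> 0 <= l.
    by move=> Tl; rewrite (cvg_unique (@Rhausdorff R) Tl (Tcvg w)).
  have dz w : dot u (pr [:: (1, w)]) = 0.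
    by apply/eqP; rewrite eq_le u0 andbT; apply: (mean_zero TBd Tm Tge (Tcvg w)).
  apply: dotvv_eq0; rewrite -[X in dot u X](pr_recons u) -/a.
  elim: (a) => [|x s IH]; first by rewrite pr_nil dot0r.
  have -> : x :: s = scale x.1 [:: (1, x.2)] ++ s by case: x => r w /=; rewrite mulr1.
  by rewrite pr_cat pr_scale dotDr IH dotZr dz mulr0 addr0.
(* Projection to the closed convex cone: along a minimising sequence the residuals [pr l - v] tend
   to a vector [u], which the first variation shows to be nonnegative on every direction; so [u = 0]
   by [dual0]. *)
have dense v ep : 0 < ep -> exists2 l, nonneg l & enorm (pr l - v) <= ep.
  move=> ep0; apply: contrapT => nl.
  have far l : nonneg l -> ep < enorm (pr l - v).
    by move=> l0; rewrite ltNge; apply/negP => h; apply: nl; exists l.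
  pose S := [set enorm (pr l - v) ^+ 2 | l in [set l | nonneg l]].
  have Sinf : has_inf S.
    split; first by exists (enorm (pr [::] - v) ^+ 2); exists [::].
    by exists 0 => _ [l l0 <-]; exact: sqr_ge0.
  have Hseq (n : nat) : exists l, nonneg l /\ enorm (pr l - v) ^+ 2 < inf S + n.+1%:R^-1.
    have [|_ [l l0 <-] ?] := @inf_adherent _ S (n.+1%:R^-1) _ Sinf; first by rewrite invr_gt0.
    by exists l.
  have [ls lsP] := choice Hseq.
  have [w [wU sw]] := ultraFilterLemma (eventually_filter : ProperFilter eventually).
  have harm : (n.+1%:R^-1 : R) @[n --> w] --> (0 : R).
    exact: cvg_trans (cvg_app _ sw) (@cvg_harmonic R).
  have bnd n : enorm (pr (ls n) - v) ^+ 2 <= inf S + 1.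
    have [_ /ltW h] := lsP n; apply: le_trans h _; rewrite lerD2l invf_le1 ?ler1n//.
  have limi i : exists l : R, (pr (ls n) - v) 0 i @[n --> w] --> l.
    have [|l _ ?] := @bounded_ultra_cvg R nat w (fun n => (pr (ls n) - v) 0 i) (inf S + 2) wU; last by exists l.
    apply: filterE => n; have := bnd n; rewrite enorm_sqr dotE (bigD1 i)//= => h.
    have : 0 <= \sum_(k < j | k != i) (pr (ls n) - v) 0 k * (pr (ls n) - v) 0 k.
      by apply: sumr_ge0 => k _; rewrite -expr2 sqr_ge0.
    move: h; set t := (pr _ - v) 0 i; set s := (\sum_(_ | _) _) => h s0.
    have : `|t| ^+ 2 <= inf S + 1 by rewrite real_normK ?num_real// expr2; lra.
    have := sqr_ge0 (`|t| - 1); have := sqr_ge0 `|t|.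
    have -> : (`|t| - 1) ^+ 2 = `|t| ^+ 2 - 2 * `|t| + 1 by ring.
    by lra.
  have [uf uP] := choice limi; pose u : 'rV[R]_j := \row_i uf i.
  have dotu z : dot (pr (ls n) - v) z @[n --> w] --> dot u z.
    rewrite dotE; under eq_fun do rewrite dotE.
    apply: cvg_sumr => i; apply: cvgM; last exact: cvg_cst.
    by rewrite mxE; exact: uP.
  have uu : enorm (pr (ls n) - v) ^+ 2 @[n --> w] --> dot u u.
    under eq_fun do rewrite enorm_sqr dotE; rewrite dotE.
    by apply: cvg_sumr => i; apply: cvgM; rewrite mxE; exact: uP.
  have ud w' : 0 <= dot u (pr [:: (1, w')]).
    set z := pr _; rewrite -oppr_le0; apply: (@le0_of_small _ _ (dot z z / 2)) => t /andP[t0 t1].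
    suff : 0 <= 2 * t * dot u z + t ^+ 2 * dot z z + 0.
      have -> : 2 * t * dot u z + t ^+ 2 * dot z z + 0 = t * (2 * dot u z + t * dot z z) by ring.
      by rewrite pmulr_rge0//; lra.
    have c1 : 2 * t * dot (pr (ls n) - v) z + t ^+ 2 * dot z z + n.+1%:R^-1 @[n --> w] -->
       2 * t * dot u z + t ^+ 2 * dot z z + 0.
      apply: cvgD harm; apply: cvgD; last exact: cvg_cst.
      by apply: cvgM; [exact: cvg_cst | exact: dotu].
    apply: (cvgr_to_ge c1); apply: filterE => n; have [ln0 lnS] := lsP n.
    have : inf S <= enorm (pr (ls n ++ scale t [:: (1, w')]) - v) ^+ 2.
      apply: ge_inf; first by case: Sinf.
      by exists (ls n ++ scale t [:: (1, w')]) => //=; rewrite /nonneg all_cat [all _ _]ln0 /= mulr1 (ltW t0).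
    rewrite pr_cat pr_scale -/z addrAC; move: lnS; rewrite !enorm_sqr.
    move: (pr (ls n) - v) => b.
    rewrite dotDl !dotDr !dotZl !dotZr (dotC z).
    by move: (dot b b) (dot b z) (dot z z) (inf S) (n.+1%:R^-1) => x1 x2 x3 x4 x5; lra.
  have u0 := dual0 u ud; rewrite u0 dot0l in uu.
  have : ep ^+ 2 <= 0.
    apply: (cvgr_to_ge uu); apply: filterE => n; have [ln0 _] := lsP n.
    by rewrite ler_sqr ?nnegrE ?(ltW ep0) ?enorm_ge0// ltW// far.
  by rewrite leNgt exprn_gt0.
(* A limit of points [act (ls n) p] with [pr (ls n)] tending to [v], characterised by its distances
   to the points of the cone. *)
have Hf v : exists y, C y /\ forall l, nonneg l -> d y (act l p) = enorm (v - pr l).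
  have Hn (n : nat) : exists l, nonneg l /\ enorm (pr l - v) <= n.+1%:R^-1.
    have [|l l0 lv] := dense v (n.+1%:R^-1); last by exists l.
    by rewrite invr_gt0 ltr0n.
  have [ls lsP] := choice Hn.
  have [w [wU sw]] := ultraFilterLemma (eventually_filter : ProperFilter eventually).
  have harm : (n.+1%:R^-1 : R) @[n --> w] --> (0 : R).
    exact: cvg_trans (cvg_app _ sw) (@cvg_harmonic R).
  have [|y _ yl] := @proper_ultra_cvg R X nat w (fun n => act (ls n) p) p (enorm v + 1) X_proper wU.
    apply: filterE => n; have [ln0 lnv] := lsP n.
    rewrite -[X in d X _]/(act [::] p) dist_pr// pr_nil sub0r enormN.
    have := enormD (pr (ls n) - v) v; rewrite subrK => /le_trans; apply.
    rewrite addrC lerD2l (le_trans lnv)// invf_le1 ?ler1n//.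
  exists y; split.
    by apply: (closed_cvg C C_closed _ _ yl); apply: filterE => n; have [ln0 _] := lsP n; exact: act_C.
  move=> l l0.
  have c1 : d (act (ls n) p) (act l p) @[n --> w] --> d y (act l p).
    by apply: mdist_cvg; [exact: yl | exact: cvg_cst].
  suff c2 : d (act (ls n) p) (act l p) @[n --> w] --> enorm (v - pr l).
    exact: (cvg_unique (@Rhausdorff R) c1 c2).
  apply/cvgrPdist_le => ep ep0.
  move/cvgrPdist_le: (harm) => /(_ _ ep0); apply: filterS => n; rewrite sub0r normrN => hn.
  have [ln0 lnv] := lsP n; rewrite dist_pr//.
  have h1 := enormB_triangle (pr (ls n)) v (pr l).
  have h2 := enormB_triangle v (pr (ls n)) (pr l).
  rewrite -[enorm (v - pr (ls n))]enormN opprB in h2.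
  have {hn lnv} h3 : enorm (pr (ls n) - v) <= ep := le_trans lnv (le_trans (ler_norm _) hn).
  by rewrite ler_norml; apply/andP; split; lra.
have [f fP] := choice Hf.
have fC v : C (f v) by case: (fP v).
have fd v l : nonneg l -> d (f v) (act l p) = enorm (v - pr l) by case: (fP v) => _; exact.
have f_flat : flat f.
  move=> v v'; apply/eqP; rewrite -subr_eq0 -normr_le0; apply/ler_addgt0Pr => ep ep0.
  rewrite add0r; have [l l0 lv] := dense v (ep / 2) (divr_gt0 ep0 (ltr0Sn _ 1)).
  have h1 := metric_triangle (f v) (act l p) (f v').
  have h2 := metric_triangle (act l p) (f v) (f v').
  rewrite [d (act l p) (f v')]metric_sym [d (act l p) (f v)]metric_sym !fd// in h1 h2.
  have h3 := enormB_triangle v' v (pr l); have h4 := enormB_triangle v' (pr l) v.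
  rewrite -[enorm (v' - v)]enormN opprB in h3 h4.
  rewrite -[enorm (v - pr l)]enormN opprB in h1 h2 h3.
  by rewrite ler_norml; apply/andP; split; lra.
have f0 : f 0 = p.
  apply: mdist_positivity; have := fd 0 [::] isT; rewrite /= => ->.
  by rewrite pr_nil subrr enorm0.
exists j, f; split => //; first by move=> v; exact: CY.
move=> g; pose shift h l : combo := [seq (x.1, actO h x.2) | x <- l].
have pair_shift h a c : pair (shift h a) (shift h c) = pair a c.
  rewrite /pair /lin big_map; apply: eq_bigr => x _; rewrite big_map /=; congr (_ * _).
  by apply: eq_bigr => z _; rewrite gram_act.
have shift_pr h a c : pr a = pr c -> pr (shift h a) = pr (shift h c).
  move=> ac; apply/eqP; rewrite -subr_eq0; apply/eqP/dotvv_eq0.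
  rewrite dotBl !dotBr -!pairE !pair_shift !pairE ac; ring.
(* [rho] is an action on [Y] only, but [Y] contains the orbit of [x0] and so belongs to every
   [w]. *)
have Om_sub w B B' : sval w B -> (forall q, Y q -> B q -> B' q) -> sval w B'.
  move=> wB BB'; have OY : sval w Y by apply: Om_orbit => k; exact: rho_Y.
  by apply: (@filterS _ _ _ _ _ _ (filterI wB OY)) => q [Bq Yq]; exact: BB'.
have Om_inj w w' : sval w = sval w' -> w = w'.
  by case: w w' => [w wI] [w' wI'] /= ww'; exact: eq_exist.
have actO_mul h h' w : actO h (actO h' w) = actO (h * h')%g w.
  apply: Om_inj; apply/seteqP; split => B hB.
    by apply: (Om_sub w (rho h' @^-1` (rho h @^-1` B)) (rho (h * h')%g @^-1` B) hB) => q Yq /=; rewrite rhoM.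
  by apply: (Om_sub w (rho (h * h')%g @^-1` B) (rho h' @^-1` (rho h @^-1` B)) hB) => q Yq /=; rewrite rhoM.
have actO1 w : actO 1%g w = w.
  apply: Om_inj; apply/seteqP; split => B hB.
    by apply: (Om_sub w (rho 1%g @^-1` B) B hB) => q Yq /=; rewrite rho1.
  by apply: (Om_sub w B (rho 1%g @^-1` B) hB) => q Yq /=; rewrite rho1.
have shift_mul h h' l : shift h (shift h' l) = shift (h * h')%g l.
  by rewrite /shift -map_comp; apply: eq_map => x /=; rewrite actO_mul.
have shift1 l : shift 1%g l = l.
  by rewrite /shift -[RHS]map_id; apply: eq_map => -[r w] /=; rewrite actO1.
pose A h v := pr (shift h (recons v)).
have Apr h l : A h (pr l) = pr (shift h l) by apply: shift_pr; rewrite pr_recons.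
have AK h h' : (h * h')%g = 1%g -> cancel (A h') (A h).
  by move=> hh v; rewrite /A -/(A h _) Apr shift_mul hh shift1 pr_recons.
exists (A g), (A g^-1%g); split.
  split; [|by rewrite -[X in A g X]pr_nil Apr|exact/AK/mulVg|exact/AK/mulgV].
  move=> v v'; apply/eqP; rewrite -(@eqrXn2 _ 2) ?enorm_ge0// !enorm_sqr.
  rewrite !dotBl !dotBr /A -!pairE !pair_shift !pairE !pr_recons//.
(* [rho g] carries [act l p] to [act (shift g l) (rho g p)], whose distance to [act (shift g l) p]
   is that of [rho g p] to [p]. By density, [l] may be taken with [pr l] close to [v]. *)
move=> v; rewrite f0; apply/ler_addgt0Pr => ep ep0.
have [l l0 lv] := dense v (ep / 2) (divr_gt0 ep0 (ltr0Sn _ 1)).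
have sl0 : nonneg (shift g l) by rewrite /nonneg all_map.
have rho_act y : C y -> rho g (act l y) = act (shift g l) (rho g y).
  move=> Cy; elim: (l) l0 => [//|x s IH] /= /andP[x0' s0].
  by rewrite flow_rho ?IH//; exact: act_C.
have Cg := C_rho g Cp.
apply: le_trans (metric_triangle _ (act (shift g l) (rho g p)) _) _.
rewrite -rho_act// rho_isometric; [|exact: CY|by apply: CY; exact: act_C].
rewrite fd//; apply: le_trans (lerD (lexx _) (metric_triangle _ (act (shift g l) p) _)) _.
rewrite rho_act// act_isometric// [d _ (f _)]metric_sym fd// -Apr.
have -> : enorm (A g v - A g (pr l)) = enorm (v - pr l).
  apply/eqP; rewrite -(@eqrXn2 _ 2) ?enorm_ge0// !enorm_sqr.
  rewrite !dotBl !dotBr /A -!pairE !pair_shift !pairE !pr_recons//.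
rewrite -[enorm (v - _)]enormN opprB; lra.
Qed.

End MinimumSet.

Lemma amenable_trichotomy N : packing_bound N ->
  [\/ exists2 y, Y y & forall g, rho g y = y,
      forall n : R, exists2 T, nonexpansive_on T & n <= d x0 (T x0) |
      exists j (f : 'rV[R]_j -> X), [/\ (0 < j)%N, flat f,
        forall v, Y (f v), forall g, rho g x0 = x0 -> rho g (f 0) = f 0 &
        forall g, exists A A', rotation_pair A A' /\
          forall v, d (rho g (f v)) (f (A v)) <= d (rho g (f 0)) (f 0)]].
Proof.
move=> pN; have [[B orbB]|unb] := pselect (exists B, forall g, d (rho g x0) x0 <= B).
  apply: Or31.
  have [y Yy yfix] : exists2 y, Y y & forall g, setT g -> rho g y = y.
    apply: (@bounded_orbit_fixed_point R X X_Hadamard X_proper Gam rho setT Y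
      Y_closed Y_convex _ _ _ _ rhoM _ x0 B) => // [g y _|g y z _].
      exact: rho_Y.
    exact: rho_isometric.
  by exists y => // g; exact: yfix.
have {}unb B : exists g, B < d (rho g x0) x0.
  apply: contrapT => nB; apply: unb; exists B => g.
  by rewrite leNgt; apply/negP => h; apply: nB; exists g.
have [?|[p [Yp pmin pfix]]] := resolvent_dichotomy; first by apply: Or32.
apply: Or33; have [j [f [j0 ff fY f0 fA]]] := minimum_set_flat Yp pmin unb pN.
by exists j, f; split => //; rewrite f0.
Qed.

End AmenableAction.

(** * Totally disconnected groups *)

Definition is_subgroup (G : groupType) (V : set G) :=
  [/\ V 1%g, forall x y, V x -> V y -> V (x * y)%g & forall x, V x -> V x^-1%g].

Lemma is_subgroupP (G : groupType) (V : set G) : is_subgroup V <-> group_closed [in V].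
Proof.
split=> [[V1 VM VV]|VG].
  split; first by rewrite in_setE.
  by move=> x y; rewrite !in_setE => Vx Vy; apply: VM => //; exact: VV.
split; first by have [] := VG; rewrite in_setE.
- by move=> x y Vx Vy; apply: set_mem; apply: (group_closedM VG); exact: mem_set.
- by move=> x Vx; apply: set_mem; apply: (group_closedV VG); exact: mem_set.
Qed.

Lemma subgroup_is_subgroup (G : groupType) (H : subgroup G) : is_subgroup (H : set G).
Proof. exact/is_subgroupP/subgroup_closed. Qed.

Lemma generated_is_subgroup (G : groupType) (S : set G) : is_subgroup (generated S).
Proof.
split=> [A [/is_subgroupP[A1 _ _] _]//|x y Sx Sy A AS|x Sx A AS].
  by have [/is_subgroupP[_ AM _] _] := AS; apply: AM; [exact: Sx | exact: Sy].
by have [/is_subgroupP[_ _ AV] _] := AS; apply: AV; exact: Sx.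
Qed.

Lemma sub_generated (G : groupType) (S : set G) : S `<=` generated S.
Proof. exact: sub_smallest. Qed.

Lemma generated_sub (G : groupType) (S V : set G) :
  is_subgroup V -> S `<=` V -> generated S `<=` V.
Proof. by move=> /is_subgroupP VG SV; apply: smallest_sub. Qed.

Lemma is_subgroupI (G : groupType) (V W : set G) :
  is_subgroup V -> is_subgroup W -> is_subgroup (V `&` W).
Proof.
move=> [V1 VM VV] [W1 WM WV]; split => //.
  by move=> x y [Vx Wx] [Vy Wy]; split; [exact: VM | exact: WM].
by move=> x [Vx Wx]; split; [exact: VV | exact: WV].
Qed.

Definition setmul (G : groupType) (A B : set G) : set G := [set (u.1 * u.2)%g | u in A `*` B].

Lemma compact_finite_cover (T : topologicalType) (I : eqType) (K : set T)
    (D : set I) (f : I -> set T) :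
  compact K -> (forall i, D i -> open (f i)) ->
  (forall x, K x -> exists2 i, D i & f i x) ->
  exists s : seq I, (forall i, i \in s -> D i) /\
    forall x, K x -> exists2 i, i \in s & f i x.
Proof.
move=> /compact_near_coveringP cK fo Kf.
pose F := filter_from [set s : seq I | forall i, i \in s -> D i]
  (fun s => [set s' : seq I | {subset s <= s'}]).
have FF : Filter F.
  apply: filter_from_filter; first by exists [::].
  move=> s t Ds Dt; exists (s ++ t) => [i|s' /= st].
    by rewrite mem_cat => /orP[/Ds|/Dt].
  by split => i it; apply: st; rewrite mem_cat it ?orbT.
have [|s Ds sK] := cK _ F (fun s x => exists2 i, i \in s & f i x) FF.
  move=> x Kx; have [i Di fix_] := Kf x Kx.
  exists (f i, [set s : seq I | i \in s]); last by move=> [y s] [/= fy si]; exists i.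
  split; first by apply: open_nbhs_nbhs; split => //; exact: fo.
  exists [:: i] => [j|s /= si]; first by rewrite inE => /eqP ->.
  by apply: si; rewrite mem_head.
by exists s; split => //; exact: sK.
Qed.

Section TopologicalGroup.
Context {G : topologicalGroupType}.
Implicit Types (A B K O U V W S : set G) (g h x y : G).

Lemma near_mulg x y O : nbhs (x * y)%g O -> \forall x' \near x & y' \near y, O (x' * y')%g.
Proof. by move=> xyO; exact: (@mulg_continuous G (x, y)). Qed.

Lemma near_invg x O : nbhs x^-1%g O -> \forall y \near x, O y^-1%g.
Proof. exact: invg_continuous. Qed.

Lemma near_lmul g x O : nbhs (g * x)%g O -> \forall y \near x, O (g * y)%g.
Proof.
move=> /near_mulg[[A B] /= [nA nB] AB]; near=> y.
by apply: (AB (g, y)); split => /=; [exact: nbhs_singleton | near: y].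
Unshelve. all: by end_near. Qed.

Lemma near_rmul g x O : nbhs (x * g)%g O -> \forall y \near x, O (y * g)%g.
Proof.
move=> /near_mulg[[A B] /= [nA nB] AB]; near=> y.
by apply: (AB (y, g)); split => /=; [near: y | exact: nbhs_singleton].
Unshelve. all: by end_near. Qed.

Lemma near_conj g x O : nbhs (g * x * g^-1)%g O -> \forall y \near x, O (g * y * g^-1)%g.
Proof. by move=> /near_rmul /near_lmul. Qed.

Lemma openP O : open O <-> forall x, O x -> nbhs x O.
Proof. by split=> [oO x Ox|H]; [exact: open_nbhs_nbhs | rewrite openE]. Qed.

Lemma setmul_open A W : open W -> open (setmul A W).
Proof.
move=> oW; apply/openP => _ [[a w] [/= Aa Ww] <-].
have : nbhs (a^-1 * (a * w))%g W by rewrite mulKg; exact: open_nbhs_nbhs.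
move=> /near_lmul; apply: filterS => y /= Wy.
by exists (a, (a^-1 * y)%g) => //=; rewrite mulVKg.
Qed.

Lemma setmul_compact A B : compact A -> compact B -> compact (setmul A B).
Proof.
move=> cA cB; apply: continuous_compact; last exact: compact_setX.
by apply: continuous_subspaceT => u; exact: mulg_continuous.
Qed.

Lemma subgroup_open V : is_subgroup V -> nbhs (1%g : G) V -> open V.
Proof.
move=> [V1 VM VV] nV; apply/openP => x Vx.
have : nbhs (x^-1 * x)%g V by rewrite mulVg.
by move=> /near_lmul; apply: filterS => y /= /(VM _ _ Vx); rewrite mulVKg.
Qed.

Lemma open_subgroup_closed V : is_subgroup V -> open V -> closed V.
Proof.
move=> [V1 VM VV] oV x cx.
have : nbhs x (setmul [set x] V).
  by apply: open_nbhs_nbhs; split; [exact: setmul_open | exists (x, 1%g) => //=; rewrite mulg1].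
move=> /cx [y [Vy [[_ v] [/= -> Vv] xv]]].
have -> : x = (y * v^-1)%g by rewrite -xv mulgK.
by apply: VM => //; exact: VV.
Qed.

Lemma closure_subgroup V : is_subgroup V -> is_subgroup (closure V).
Proof.
move=> [V1 VM VV]; split; first exact: subset_closure.
- move=> x y cx cy O /near_mulg[[A B] /= [nA nB] AB].
  have [u [Vu Au]] := cx _ nA; have [v [Vv Bv]] := cy _ nB.
  by exists (u * v)%g; split; [exact: VM | exact: (AB (u, v))].
- move=> x cx O /near_invg /cx [u [Vu Ou]]; exists u^-1%g; split => //; exact: VV.
Qed.

Lemma compact_lmul_near K O : compact K -> open O -> K `<=` O ->
  \forall g \near (1%g : G), forall x, K x -> O (g * x)%g.
Proof.
move=> /compact_near_coveringP cK oO KO.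
apply: (cK _ (nbhs (1%g : G)) (fun g x => O (g * x)%g)) => x Kx.
have : nbhs (1 * x)%g O by rewrite mul1g; apply: open_nbhs_nbhs; split => //; exact: KO.
move=> /near_mulg[[A B] /= [nA nB] AB]; by exists (B, A) => // -[y g] [/= By Ag]; exact: (AB (g, y)).
Qed.

Lemma compact_rmul_near K O : compact K -> open O -> K `<=` O ->
  \forall g \near (1%g : G), forall x, K x -> O (x * g)%g.
Proof.
move=> /compact_near_coveringP cK oO KO.
apply: (cK _ (nbhs (1%g : G)) (fun g x => O (x * g)%g)) => x Kx.
have : nbhs (x * 1)%g O by rewrite mulg1; apply: open_nbhs_nbhs; split => //; exact: KO.
move=> /near_mulg[[A B] /= [nA nB] AB]; by exists (A, B) => // -[y g] [/= Ay Bg]; exact: (AB (y, g)).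
Qed.

Lemma directed_compact (E : set (set G)) K : compact K -> E !=set0 ->
  (forall A, E A -> closed A) -> (forall A B, E A -> E B -> E (A `&` B)) ->
  (forall x, K x -> exists2 A, E A & ~ A x) -> exists2 A, E A & A `&` K = set0.
Proof.
move=> cK [A0 EA0] Ecl EI KE; apply: contrapT => nE.
pose F := filter_from E (fun A => A `&` K).
have FP : ProperFilter F.
  apply: filter_from_proper => [|A EA].
    apply: filter_from_filter; first by exists A0.
    move=> A B EA EB; exists (A `&` B); first exact: EI.
    by move=> x [[Ax Bx] Kx].
  apply/set0P/negP => /eqP AK; by apply: nE; exists A.
have FK : F K by exists A0 => // x [].
have [x [Kx Fx]] := cK F FP FK.
have [A EA nAx] := KE x Kx; apply: nAx; apply: (Ecl A EA) => B nB.
have FA : F (A `&` K) by exists A.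
by have [y [[Ay _] By]] := Fx _ _ FA nB; exists y.
Qed.

Hypothesis G_td : totally_disconnected [set: G].

Lemma td_set1_closed x : closed [set x].
Proof. by rewrite -(G_td (x := x) I); apply: component_closed; exact: closedT. Qed.

(** Points are components, hence closed; in a group this separates them, since [p^-1 * q] has a
    neighbourhood that avoids 1. *)
Lemma td_hausdorff : hausdorff_space G.
Proof.
move=> p q pq; apply: contrapT => npq.
have : nbhs (p^-1 * q)%g (~` [set 1%g]).
  apply: open_nbhs_nbhs; split; first by apply: closed_openC; exact: td_set1_closed.
  by move=> /= e; apply: npq; rewrite -[q](mulVKg p) e mulg1.
move=> /near_mulg[[A B] /= [nA nB] AB].
have nA' : \forall y \near p, A y^-1%g by exact: near_invg.
have [u [Au Bu]] := pq _ _ nA' nB.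
by apply: (AB (u^-1%g, u)) => //=; rewrite mulVg.
Qed.

(* The component of 1 in a compact neighbourhood is the intersection of the
   relatively clopen sets containing it. *)
Lemma compact_open_nbhs K O : compact K -> nbhs (1%g : G) K -> nbhs (1%g : G) O ->
  exists W, [/\ compact W, open W, W 1%g & W `<=` O].
Proof.
move=> cK nK nO; have Gh := td_hausdorff.
have Kcl : closed K by exact: compact_closed.
pose E A := [/\ closed A, closed (K `\` A), A `<=` K & A 1%g].
have EK : E K by split => //; [rewrite setDv; exact: closed0 | exact: nbhs_singleton].
have EI A B : E A -> E B -> E (A `&` B).
  move=> [cA cA' AK A1] [cB cB' BK B1]; split => //; first exact: closedI.
    by rewrite setDIr; exact: closedU.
  by move=> x [/AK].
pose Q := [set x | forall A, E A -> A x].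
have Q1 : Q 1%g by move=> A [].
have Qcl : closed Q.
  move=> x cx A EA; have [cA _ _ _] := EA; apply: cA.
  by move=> B /cx [y [Qy By]]; exists y; split => //; exact: Qy.
have Qcompact : compact Q.
  by apply: (subclosed_compact Qcl cK) => x /(_ K EK).
have out L : compact L -> L `<=` K -> L `&` Q = set0 -> exists2 A, E A & A `&` L = set0.
  move=> cL LK LQ; apply: directed_compact => //; first by exists K.
    by move=> A [].
  move=> x Lx; apply: contrapT => nx.
  suff : (L `&` Q) x by rewrite LQ.
  by split => // A EA; apply: contrapT => nAx; apply: nx; exists A.
have Qdisc B1 B2 : closed B1 -> closed B2 -> Q = B1 `|` B2 -> B1 `&` B2 = set0 ->
    B1 1%g -> B2 = set0.
  move=> cB1 cB2 QB B12 B11.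
  have B1K : B1 `<=` Q by rewrite QB => x; left.
  have B2K : B2 `<=` Q by rewrite QB => x; right.
  have kB1 : compact B1 by exact: (subclosed_compact cB1 Qcompact B1K).
  have kB2 : compact B2 by exact: (subclosed_compact cB2 Qcompact B2K).
  (* Multiplication takes the place of normality: for a small [W] the sets [B1 W] and [B2 W] are
     disjoint. A relatively clopen set contained in their union then splits, and its part in [B1 W]
     is still one of the sets containing [Q]. *)
  have : \forall g \near (1%g : G), forall x, B1 x -> (~` B2) (x * g)%g.
    apply: compact_rmul_near => //; first exact: closed_openC.
    by move=> x B1x B2x; have : (B1 `&` B2) x by []; rewrite B12.
  rewrite -{1}(mulgV (1%g : G)) => /near_mulg[[A1 A2] /= [nA1 nA2] AA].
  have nA2' : \forall y \near (1%g : G), A2 y^-1%g by apply: near_invg; rewrite invg1 in nA2 *.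
  have : nbhs (1%g : G) (A1 `&` [set y | A2 y^-1%g]) by exact: filterI.
  rewrite nbhsE => -[W [oW W1] WA].
  have U12 x : setmul B1 W x -> setmul B2 W x -> False.
    move=> [[b w] [/= B1b Ww] <-] [[c v] [/= B2c Wv] e].
    have [A1w _] := WA _ Ww; have [_ A2v] := WA _ Wv.
    have := AA (w, v^-1%g) (conj A1w A2v) b B1b; apply.
    by rewrite /= mulgA -e mulgK.
  have oU1 : open (setmul B1 W) by exact: setmul_open.
  have oU2 : open (setmul B2 W) by exact: setmul_open.
  have sU B : B `<=` setmul B W by move=> x Bx; exists (x, 1%g) => //=; rewrite mulg1.
  have [|||A EA AL] := out (K `\` (setmul B1 W `|` setmul B2 W)).
  - apply: (subclosed_compact _ cK); last by move=> x [].
    by rewrite setDE; apply: closedI => //; apply: open_closedC; exact: openU.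
  - by move=> x [].
  - apply/seteqP; split => // x [[_ nU] Qx]; apply: nU.
    by move: Qx; rewrite QB => -[/sU|/sU]; [left | right].
  have AU x : A x -> setmul B1 W x \/ setmul B2 W x.
    move=> Ax; apply: contrapT => nU; have [_ _ AK _] := EA.
    suff : (A `&` (K `\` (setmul B1 W `|` setmul B2 W))) x by rewrite AL.
    by split => //; split => //; exact: AK.
  have EA1 : E (A `&` setmul B1 W).
    have [cA cA' AK A1'] := EA; split.
    - rewrite (_ : _ `&` _ = A `\` setmul B2 W).
        by rewrite setDE; apply: closedI => //; exact: open_closedC.
      apply/seteqP; split => x [Ax]; first by move=> U1; split => // /(U12 _ U1).
      by move=> nU2; split => //; case: (AU x Ax).
    - rewrite (_ : K `\` _ = (K `\` A) `|` (A `\` setmul B1 W)).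
        apply: closedU => //; rewrite setDE; apply: closedI => //.
        exact: open_closedC.
      apply/seteqP; split => x.
        move=> [Kx nA]; have [Ax|] := pselect (A x); last by left.
        by right; split => // U1; apply: nA.
      by move=> [[Kx nAx]|[Ax nU]]; split => //; [case|exact: AK|case].
    - by move=> x [/AK].
    - by split => //; exact: sU.
  apply/seteqP; split => // x B2x; have := B2K _ B2x _ EA1.
  by move=> [_ U1]; exact: U12 U1 (sU _ _ B2x).
have Qconn : connected Q.
  move=> B [b Bb] [C1 oC1 BC1] [C2 cC2 BC2].
  have cB : closed B by rewrite BC2; exact: closedI.
  have cB' : closed (Q `\` B).
    rewrite (_ : Q `\` B = Q `&` ~` C1); first by apply: closedI => //; exact: open_closedC.
    apply/seteqP; split => x [Qx nx]; split => //; first by move=> C1x; apply: nx; rewrite BC1.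
    by rewrite BC1 => -[].
  have BQ : B `<=` Q by rewrite BC1 => x [].
  have QBB : Q = B `|` (Q `\` B) by rewrite setDUK.
  have [B1|nB1] := pselect (B 1%g).
    by rewrite QBB (Qdisc B (Q `\` B))// ?setU0// setDIK.
  exfalso; have : B b := Bb; rewrite (Qdisc (Q `\` B) B) ?setDKI//.
  by rewrite setUC.
have Q1E : Q = [set 1%g].
  apply/seteqP; split; last by move=> _ ->.
  by rewrite -(G_td (x := 1%g) I); apply: connected_component_max.
have [|||A EA AL] := out (K `\` (K° `&` O°)).
- apply: (subclosed_compact _ cK); last by move=> x [].
  rewrite setDE; apply: closedI => //; apply: open_closedC.
  by apply: openI; exact: open_interior.
- by move=> x [].
- by apply/seteqP; split => // x [[_ nU]]; rewrite Q1E => x1; apply: nU; rewrite x1; split.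
have [cA cA' AK A1] := EA.
have AKO : A `<=` K° `&` O°.
  move=> x Ax; apply: contrapT => nx.
  suff : (A `&` (K `\` (K° `&` O°))) x by rewrite AL.
  by split => //; split => //; exact: AK.
exists A; split => //.
- exact: (subclosed_compact cA cK AK).
- rewrite (_ : A = K° `&` ~` (K `\` A)).
    by apply: openI; [exact: open_interior | exact: closed_openC].
  apply/seteqP; split => x; first by move=> Ax; split; [case: (AKO _ Ax) | case].
  move=> [/interior_subset Kx nx]; apply: contrapT => nA; exact: nx.
- by move=> x /AKO [_ /interior_subset].
Qed.

(* V is the stabiliser of the compact open set K W. *)
Lemma compact_open_subgroup C K O : compact C -> nbhs (1%g : G) C ->
  compact K -> is_subgroup K -> open O -> K `<=` O ->
  exists V, [/\ is_subgroup V, compact V, open V, K `<=` V & V `<=` O].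
Proof.
move=> cC nC cK [K1 KM KV] oO KO.
have [W [cW oW W1 WO]] := compact_open_nbhs cC nC (compact_rmul_near cK oO KO).
pose Q := setmul K W.
have oQ : open Q by exact: setmul_open.
have cQ : compact Q by exact: setmul_compact.
have KQ k x : K k -> Q x -> Q (k * x)%g.
  by move=> Kk [[k' w] [/= Kk' Ww] <-]; exists ((k * k')%g, w); [split => //; exact: KM | rewrite /= mulgA].
pose V := [set g | (forall x, Q x -> Q (g * x)%g) /\ (forall x, Q x -> Q (g^-1 * x)%g)].
have VG : is_subgroup V.
  split.
  - by split=> x; rewrite ?invg1 mul1g.
  - move=> g h [g1 g2] [h1 h2]; split => x Qx; first by rewrite -mulgA; exact/g1/h1.
    by rewrite invgM -mulgA; exact/h2/g2.
  - by move=> g [g1 g2]; split => //; rewrite invgK.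
have nV : nbhs (1%g : G) V.
  have h := compact_lmul_near cQ oQ (@subset_refl _ Q).
  have h' : \forall g \near (1%g : G), forall x, Q x -> Q (g^-1 * x)%g.
    by apply: (@near_invg 1%g [set g | forall x, Q x -> Q (g * x)%g]); rewrite invg1.
  exact: filterI.
have oV := subgroup_open VG nV.
have Q1 : Q 1%g by exists (1%g, 1%g) => //=; rewrite mulg1.
have VQ : V `<=` Q by move=> g [/(_ _ Q1)]; rewrite mulg1.
exists V; split => //.
- exact: (subclosed_compact (open_subgroup_closed VG oV) cQ VQ).
- by move=> k Kk; split => x; apply: KQ => //; exact: KV.
- by move=> g /VQ [[k w] [/= Kk Ww] <-]; exact: WO.
Qed.

Lemma generated_closure_compact S V : is_subgroup V -> compact V -> S `<=` V ->
  compact (closure (generated S)).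
Proof.
move=> VG cV SV; apply: (subclosed_compact (@closed_closure _ _) cV).
have Vcl := compact_closed td_hausdorff cV.
by rewrite (closure_id V).1//; apply: closureS; exact: generated_sub.
Qed.

(* With W a compact open subgroup, Q lies in W T W = T1 W for finite subsets T
   and T1 of N, and then [generated T1 * W] is a group. *)
Lemma loc_finite_generated W (N Q : set G) :
  is_subgroup W -> compact W -> open W -> is_subgroup N -> @top_loc_finite G N ->
  compact Q -> Q `<=` closure N -> compact (closure (generated Q)).
Proof.
move=> WG cW oW NG Ntlf cQ QN; have [W1 WM WV] := WG; have [N1 NM NV] := NG.
pose L := closure N; have LG : is_subgroup L := closure_subgroup NG.
have [L1 LM LV] := LG; pose WL := W `&` L.
have WLG : is_subgroup WL by exact: is_subgroupI.
have [WL1 WLM WLV] := WLG.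
have Lcl : closed L by exact: closed_closure.
have cWL : compact WL by exact: compact_closedI.
have LNW l : L l -> exists n w, [/\ N n, WL w & l = (n * w)%g].
  move=> Ll; have : nbhs l (setmul [set l] W).
    apply: open_nbhs_nbhs; split; first exact: setmul_open.
    by exists (l, 1%g) => //=; rewrite mulg1.
  move=> /Ll [n [Nn [[_ w] [/= -> Ww] nE]]]; exists n, w^-1%g.
  have Ln : L n by exact: subset_closure.
  have wE : w^-1%g = (n^-1 * l)%g by rewrite -nE invgM mulgVK.
  by split=> //; [split; [exact: WV | rewrite wE; exact: LM (LV _ Ln) Ll] | rewrite wE mulVKg].
have cover P : compact P -> P `<=` L ->
    exists T, [/\ finite_set T, T `<=` N & forall x, P x -> exists t w, [/\ T t, WL w & x = (t * w)%g]].
  move=> cP PL; have [|x Px|T [TN TP]] := @compact_finite_cover G G P N (fun n => setmul [set n] W) cP.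
  - by move=> n _; exact: setmul_open.
  - have [n [w [Nn [Ww _] ->]]] := LNW x (PL x Px).
    by exists n => //; exists (n, w).
  exists [set` T]; split; [exact: finite_seq | exact: TN |].
  move=> x Px; have [n Tn [[_ w] [/= -> Ww] e]] := TP x Px.
  exists n, w; split => //; split => //.
  have -> : w = (n^-1 * x)%g by rewrite -e mulKg.
  by apply: LM (PL _ Px); apply: LV; apply: subset_closure; exact: TN.
have [T0 [fT0 T0N T0Q]] := cover Q cQ QN.
pose T0s := T0 `|` [set t^-1%g | t in T0] `|` [set 1%g].
have fT0s : finite_set T0s.
  by rewrite !finite_setU; split; [split => //; exact: finite_image | exact: finite_set1].
have T0sN : T0s `<=` N.
  by move=> x [[/T0N//|[t /T0N Nt <-]]|->//]; exact: NV.
have T0sV t : T0s t -> T0s t^-1%g.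
  move=> [[Tt|[s Ts <-]]|->]; [left; right; exists t => //|left; left|right].
    by rewrite invgK.
  by rewrite /= invg1.
pose Z := setmul (setmul WL T0s) WL.
have cZ : compact Z by apply: setmul_compact => //; apply: setmul_compact => //; exact: finite_compact.
have ZP x : Z x <-> exists w t v, [/\ WL w, T0s t, WL v & x = (w * t * v)%g].
  split=> [[[y v] [/= [[w t] [/= Ww Tt] <-] Wv] <-]|[w [t [v [Ww Tt Wv ->]]]]].
    by exists w, t, v.
  by exists ((w * t)%g, v) => //; split => //=; exists (w, t).
have ZL : Z `<=` L.
  move=> x /ZP [w [t [v [[_ Lw] Tt [_ Lv] ->]]]]; apply: (LM _ _ _ Lv); apply: (LM _ _ Lw).
  exact/subset_closure/T0sN.
have ZV x : Z x -> Z x^-1%g.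
  move=> /ZP [w [t [v [Ww Tt Wv ->]]]]; apply/ZP; exists v^-1%g, t^-1%g, w^-1%g.
  by split; [exact: WLV|exact: T0sV|exact: WLV|rewrite !invgM mulgA].
have WZ w x : WL w -> Z x -> Z (w * x)%g.
  move=> Ww /ZP [u [t [v [Wu Tt Wv ->]]]]; apply/ZP; exists (w * u)%g, t, v.
  by split => //; [exact: WLM | rewrite !mulgA].
have ZW w x : WL w -> Z x -> Z (x * w)%g.
  move=> Ww /ZP [u [t [v [Wu Tt Wv ->]]]]; apply/ZP; exists u, t, (v * w)%g.
  by split => //; [exact: WLM | rewrite !mulgA].
have [T1 [fT1 T1N T1Z]] := cover Z cZ ZL.
pose T2 := T1 `&` Z.
have T2Z x : Z x -> exists t w, [/\ T2 t, WL w & x = (t * w)%g].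
  move=> Zx; have [t [w [Tt Ww xE]]] := T1Z x Zx; exists t, w; split => //; split => //.
  have -> : t = (x * w^-1)%g by rewrite xE mulgK.
  by apply: ZW => //; exact: WLV.
pose D := generated T2.
have [D1 DM DV] := generated_is_subgroup T2 : is_subgroup D.
(* The property that [w * t] stays in [setmul D WL] for all [w] in [WL] passes to products; imposed
   on [t] and on its inverse it defines a subgroup, so generators suffice. *)
have WD : D `<=` [set t | (forall w, WL w -> setmul D WL (w * t)%g) /\
                       (forall w, WL w -> setmul D WL (w * t^-1)%g)].
  apply: generated_sub.
    have step g h : (forall w, WL w -> setmul D WL (w * g)%g) ->
        (forall w, WL w -> setmul D WL (w * h)%g) -> forall w, WL w -> setmul D WL (w * (g * h))%g.
      move=> g1 h1 w Ww; have [[s v] [/= Ds Wv e1]] := g1 _ Ww.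
      have [[r u] [/= Dr Wu e2]] := h1 _ Wv.
      exists ((s * r)%g, u); first by split => //; exact: DM.
      by rewrite /= -mulgA e2 mulgA e1 mulgA.
    split.
    - by split=> w Ww; exists (1%g, w) => //=; rewrite ?invg1 mul1g mulg1.
    - move=> g h [g1 g2] [h1 h2]; split; first exact: step.
      by rewrite invgM; exact: step.
    - by move=> g [g1 g2]; split => //; rewrite invgK.
  move=> t [Tt Zt]; split => w Ww.
    have [s [v [Ts Wv ->]]] := T2Z _ (WZ _ _ Ww Zt).
    by exists (s, v) => //; split => //; exact: sub_generated.
  have [s [v [Ts Wv ->]]] := T2Z _ (WZ _ _ Ww (ZV _ Zt)).
  by exists (s, v) => //; split => //; exact: sub_generated.
have DWG : is_subgroup (setmul D WL).
  split.
  - by exists (1%g, 1%g) => //=; rewrite mulg1.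
  - move=> _ _ [[t w] [/= Dt Ww] <-] [[s v] [/= Ds Wv] <-].
    have [h1 _] := WD _ Ds; have [[r u] [/= Dr Wu e]] := h1 _ Ww.
    exists ((t * r)%g, (u * v)%g); first by split; [exact: DM | exact: WLM].
    by rewrite /= -!mulgA [(w * _)%g]mulgA -e -mulgA.
  - move=> _ [[t w] [/= Dt Ww] <-]; rewrite invgM.
    by have [_ h2] := WD _ Dt; apply: h2; exact: WLV.
have cD : compact (closure D).
  apply: Ntlf; first exact: finite_setIl.
  by move=> t [/T1N].
have cDW : compact (setmul (closure D) WL) by exact: setmul_compact.
apply: (subclosed_compact (@closed_closure _ _) cDW).
have cl := compact_closed td_hausdorff cDW.
rewrite ((closure_id _).1 cl); apply: closureS.
apply: (@subset_trans _ (setmul D WL)).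
  apply: generated_sub => // x Qx; have [t [w [Tt Ww xE]]] := T0Q x Qx.
  have Zx : Z x.
    by apply/ZP; exists 1%g, t, w; split => //; [left; left | rewrite mul1g].
  have [s [v [Ts Wv ->]]] := T2Z _ Zx.
  by exists (s, v) => //; split => //; exact: sub_generated.
move=> _ [[t w] [/= Dt Ww] <-]; exists (t, w) => //; split => //; exact: subset_closure.
Qed.

End TopologicalGroup.

(** * Cocompact actions: closed balls are compact and packings are bounded *)

Section CocompactAction.
Context {R : realType} {X : metricType R}.
Hypothesis X_Hadamard : Hadamard X.
Hypothesis X_locally_compact : locally_compact [set: X].
Context {G : topologicalGroupType} (a : isometric_action G X).
Hypothesis a_cocompact : cocompact_action a.
Local Notation d := (@mdist R X).

Lemma actVK g x : a g^-1%g (a g x) = x.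
Proof. by rewrite -actM mulVg act1. Qed.

Lemma actKV g x : a g (a g^-1%g x) = x.
Proof. by rewrite -actM mulgV act1. Qed.

Definition mball (x : X) (r : R) : set X := [set y | d x y <= r].

Lemma mball_closed x r : closed (mball x r).
Proof.
move=> y cy; apply/ler_addgt0Pr => e e0.
have [z xz yz] := (closureP _ _).1 cy e e0.
apply: le_trans (metric_triangle _ z _) _; rewrite [d z y]metric_sym; apply: lerD => //.
exact: ltW.
Qed.

Lemma mball_sub_compact x y r s : d x y + s <= r ->
  compact (mball x r) -> compact (mball y s).
Proof.
move=> rs cx; apply: (subclosed_compact (@mball_closed _ _) cx) => z yz.
by apply: le_trans rs; apply: le_trans (metric_triangle _ y _) _; rewrite lerD2l.
Qed.

Lemma small_compact_mball x : exists2 r, 0 < r & compact (mball x r).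
Proof.
have [K nK [cK _]] := X_locally_compact (x := x) I.
move: nK; rewrite withinET -metricType_numDomainType.nbhs_nbhs_mdist => -[r /= r0 rK].
exists (r / 2); first by rewrite divr_gt0.
apply: (subclosed_compact (@mball_closed _ _) cK) => y xy; apply: rK => /=.
by apply: le_lt_trans xy _; rewrite ltr_pdivrMr// ltr_pMr// ltr1n.
Qed.

Lemma act_cont g : continuous (a g).
Proof.
move=> x B; rewrite -!metricType_numDomainType.nbhs_nbhs_mdist => -[r /= r0 rB].
by exists r => // y xy; apply: rB => /=; rewrite act_isometry.
Qed.

Lemma mball_act_compact g x r : compact (mball (a g x) r) -> compact (mball x r).
Proof.
move=> cB; rewrite (_ : mball x r = a g^-1%g @` mball (a g x) r).
  apply: continuous_compact cB; apply: continuous_subspaceT; exact: act_cont.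
apply/seteqP; split=> [y xy|_ [y xy <-]].
  by exists (a g y); rewrite ?actVK// /mball /= act_isometry.
by rewrite /mball /= -(act_isometry a g) actKV.
Qed.

(** Near each orbit [P n] holds for all large [n]; compactness of the orbit space gives one [n] for
    all orbits. *)
Lemma cocompact_uniform x1 : exists r0 e0, [/\ 0 < e0,
  forall x, exists g, d x1 (a g x) <= r0 & forall x, compact (mball x e0)].
Proof.
pose pi : X -> orbit_space a := \pi_(orbit_space a)%qT.
have pi_eq x y : pi x = pi y -> exists g, a g x = y.
  by move=> /eqmodP /asboolP[g gx]; exists g.
pose P (n : nat) (q : orbit_space a) := exists x, [/\ pi x = q,
  compact (mball x n.+1%:R^-1) & d x1 x <= n%:R].
have [N _ NP] : \forall n \near \oo, setT `<=` P n.
  apply: ((compact_near_coveringP _).1 a_cocompact) => q _.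
  have [r r0 cr] := small_compact_mball (repr q).
  pose x := repr q.
  pose O := [set q' | exists x', pi x' = q' /\ d x x' < r / 2].
  have oO : open O.
    rewrite /open /= /quotient_open; rewrite openE => y [x' [/pi_eq [g gy] xx']].
    rewrite /interior -metricType_numDomainType.nbhs_nbhs_mdist.
    exists (r / 2 - d x x') => [|z /= yz]; first by rewrite /= subr_gt0.
    exists (a g^-1%g z); split.
      by apply/eqmodP/asboolP; exists g; rewrite actKV.
    apply: le_lt_trans (metric_triangle _ x' _) _.
    by rewrite addrC -ltrBrDr -(act_isometry a g x') actKV gy.
  have qO : O q by exists x; rewrite /pi /x reprK mdistxx; split => //; rewrite divr_gt0.
  have nO : nbhs q O by exact: open_nbhs_nbhs.
  exists (O, [set n | n.+1%:R^-1 < r / 2 /\ d x1 x + r / 2 <= n%:R]).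
    split => //; apply: filterI; last exact: nbhs_infty_ger.
    have r2 : 0 < r / 2 by rewrite divr_gt0.
    exact: (near_infty_natSinv_lt (interval_inference.PosNum r2)).
  move=> [_ n] [/= [x' [<- xx']] [nr nx]]; exists x'; split => //.
    by apply: (mball_sub_compact _ cr); rewrite [r]splitr lerD// ltW.
  by apply: le_trans (metric_triangle _ x _) _; apply: le_trans nx; rewrite lerD2l ltW.
have {}NP q : P N q by apply: (NP N) => /=.
exists N%:R, N.+1%:R^-1; split; first by rewrite invr_gt0 ltr0n.
  by move=> x; have [y [/esym/pi_eq[g <-] _ xy]] := NP (pi x); exists g.
move=> x; have [y [/esym/pi_eq[g <-] cy _]] := NP (pi x).
exact: mball_act_compact cy.
Qed.

Lemma cobounded x1 : exists r0, forall x, exists g, d x1 (a g x) <= r0.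
Proof. by have [r0 [e0 [_ h _]]] := cocompact_uniform x1; exists r0. Qed.

(** As in the Hopf-Rinow theorem, radii grow by steps of [e / 2]. An ultrafilter on the larger ball
    is contracted into the smaller one along geodesics; if [z] is the limit there, the ultrafilter
    itself lives on the compact ball of radius [e] about [z]. *)
Lemma cocompact_proper_space : proper_space (X := X).
Proof.
have [[x1 _] _ _] := X_Hadamard.
have [_ [e [e0 _ ce]]] := cocompact_uniform x1.
have e2 : 0 < e / 2 by rewrite divr_gt0.
suff nball n x : compact (mball x (n%:R * (e / 2))).
  move=> x r; have [n nr] : exists n, r <= n%:R * (e / 2).
    exists (Num.bound `|r / (e / 2)|); rewrite -ler_pdivrMr//.
    by apply: le_trans (ler_norm _) _; apply/ltW/archi_boundP.
  by apply: (mball_sub_compact _ (nball n x)); rewrite mdistxx add0r.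
elim: n => [|n IH].
  by apply: (mball_sub_compact _ (ce x)); rewrite mdistxx add0r mul0r ltW.
rewrite compact_ultra => F FU Fx.
pose r : R := n%:R * (e / 2); have r0 : 0 <= r by rewrite mulr_ge0// ltW.
pose re := r + e / 2; have re0 : 0 < re by rewrite ltr_wpDl.
have reE : n.+1%:R * (e / 2) = re by rewrite /re /r -natr1 mulrDl mul1r.
pose t := r / re.
have t01 : 0 <= t <= 1.
  by rewrite /t; apply/andP; split; [rewrite divr_ge0// ltW | rewrite ler_pdivrMr// mul1r lerDl ltW].
pose h y := geo X_Hadamard x y t.
have FX : \forall y \near F, d x y <= re by apply: filterS Fx => y; rewrite /mball /= reE.
have [|z _ hz] := compact_ultra_cvg (f := h) FU IH.
  near=> y; have xy : d x y <= re by near: y; exact: FX.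
  rewrite /mball /= geo_distl// -/r (le_trans (ler_wpM2l _ xy))//; first by case/andP: t01.
  by rewrite /t divfK// gt_eqF.
have Fz : \forall y \near F, mball z e y.
  have hz' := cvg_mdist_lt hz e2; near=> y.
  have xy : d x y <= re by near: y; exact: FX.
  rewrite /mball /=; apply: le_trans (metric_triangle _ (h y) _) _.
  rewrite [leRHS]splitr; apply: lerD.
    by rewrite ltW//; near: y; exact: hz'.
  rewrite geo_distr//; apply: le_trans (ler_wpM2l _ xy) _.
    by rewrite subr_ge0; case/andP: t01.
  by rewrite mulrBl mul1r /t divfK ?gt_eqF// /re addrC addKr.
have [y _ Fy] := compact_ultra_cvg (f := id) FU (ce z) Fz.
exists y; split => //=.
apply: mball_closed => B /Fy FB.
by apply: (@filter_ex _ F); exact: (@filterI _ F _ _ _ Fx FB).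
Unshelve. all: by end_near. Qed.

Lemma mball_open x r : open [set y | d x y < r].
Proof.
rewrite openE => y xy; rewrite /interior -metricType_numDomainType.nbhs_nbhs_mdist.
exists (r - d x y) => [|z /= yz]; first by rewrite /= subr_gt0.
by apply: le_lt_trans (metric_triangle _ y _) _; rewrite addrC -ltrBrDr.
Qed.

(** The group moves the centre into a fixed compact ball, and 1-separated points cannot share a ball
    of radius 1/2 of a finite cover. *)
Lemma packing_bound_exists : exists N, packing_bound (X := X) N.
Proof.
have [[x1 _] _ _] := X_Hadamard.
have [r0 cov] := cobounded x1.
have half : 0 < 2^-1 :> R by rewrite invr_gt0.
have [||s [_ sP]] := @compact_finite_cover X X (mball x1 (r0 + 1)) setT
   (fun x => [set y | d x y < 2^-1]) (@cocompact_proper_space x1 (r0 + 1)).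
- by move=> x _; exact: mball_open.
- by move=> x _; exists x => //=; rewrite mdistxx.
exists (size s) => n p c cp pp; have [g cg] := cov c.
have near_s i : exists2 x, x \in s & d x (a g (p i)) < 2^-1.
  apply: sP; apply: le_trans (metric_triangle _ (a g c) _) _.
  by apply: lerD => //; rewrite act_isometry.
pose q i := projT1 (cid2 (near_s i)).
have qs i : q i \in s by rewrite /q; case: cid2.
have qp i : d (q i) (a g (p i)) < 2^-1 by rewrite /q; case: cid2.
have q_inj : injective q.
  move=> i j qij; apply/eqP; apply: contraT => /pp; rewrite -(act_isometry a g) leNgt.
  rewrite (le_lt_trans (metric_triangle _ (q i) _))// [ltRHS](splitr 1) !mul1r ltrD//.
    by rewrite metric_sym.
  by rewrite qij.
rewrite -[n]card_ord -(size_image q) /=; apply: uniq_leq_size.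
  by rewrite map_inj_uniq ?enum_uniq.
by move=> _ /mapP[i _ ->].
Qed.

End CocompactAction.

(** * Configurations: limits of conjugates preserving a flat up to bounded error *)

Section EuclideanLimits.
Context {R : realType} {k : nat}.
Implicit Types u v w : 'rV[R]_k.

Lemma enorm_coord u i : `|u 0 i| <= enorm u.
Proof.
rewrite -ler_sqr ?nnegrE ?enorm_ge0// real_normK ?num_real// enorm_sqr dotE.
rewrite (bigD1 i)//= -expr2 lerDl sumr_ge0// => j _; rewrite -expr2; exact: sqr_ge0.
Qed.

Lemma enormB u v : enorm (u - v) = enorm (v - u).
Proof. by rewrite -enormN opprB. Qed.

Lemma rv_ultra_cvg (I : Type) (F : set_system I) (u : I -> 'rV[R]_k) M :
  UltraFilter F -> (\forall i \near F, enorm (u i) <= M) ->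
  exists l, forall e, 0 < e -> \forall i \near F, enorm (u i - l) <= e.
Proof.
move=> FU uM.
have H j : exists l : R, u i 0 j @[i --> F] --> l.
  have [|l _ ul] := @bounded_ultra_cvg R I F (fun i => u i 0 j) M FU; last by exists l.
  by apply: filterS uM => i; apply: le_trans; exact: enorm_coord.
have [l ul] := choice H; exists (\row_j l j) => e e0.
have h : (\sum_j (u i 0 j - l j) ^+ 2) @[i --> F] --> (\sum_(j < k) (0 : R)).
  apply: cvg_sumr => j.
  have hj : (u i 0 j - l j) @[i --> F] --> (l j - l j : R).
    by apply: cvgB; [exact: ul | exact: cvg_cst].
  have := cvgM hj hj; rewrite subrr mulr0; apply.
rewrite big1 in h => //.
move/cvgrPdist_le/(_ _ (exprn_gt0 2 e0)) : h.
apply: filterS => i ie; rewrite -ler_sqr ?nnegrE ?enorm_ge0 ?(ltW e0)// enorm_sqr dotE.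
rewrite sub0r normrN in ie; apply: (le_trans _ ie); apply: (le_trans _ (ler_norm _)).
by apply: eq_ler; apply: eq_bigr => j _; rewrite !mxE -expr2.
Unshelve. all: by end_near. Qed.

End EuclideanLimits.

(** * Limits of conjugates and limits of configurations *)

Section LimitHomomorphisms.
Context {R : realType} {X : metricType R}.
Hypothesis X_proper : proper_space (X := X).
Context {G : topologicalGroupType} (a : isometric_action G X).
Hypothesis a_proper : proper_action a.
Hypothesis G_td : totally_disconnected [set: G].
Context {Gam : groupType} (iota : Gam -> G).
Local Notation d := (@mdist R X).

Lemma act_cvg (I : Type) (F : set_system I) {FF : ProperFilter F} (g : I -> G) (x : I -> X) h y :
  g i @[i --> F] --> h -> x i @[i --> F] --> y -> a (g i) (x i) @[i --> F] --> a h y.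
Proof.
move=> gh xy.
have : (g i, x i) @[i --> F] --> (h, y) by exact: cvg_pair.
move=> /(cvg_comp _ _) /(_ (@act_continuous _ _ _ a (h, y))); exact.
Qed.

Lemma mulg_cvg (I : Type) (F : set_system I) {FF : ProperFilter F} (g g' : I -> G) h h' :
  g i @[i --> F] --> h -> g' i @[i --> F] --> h' -> (g i * g' i)%g @[i --> F] --> (h * h')%g.
Proof.
move=> gh xy.
have : (g i, g' i) @[i --> F] --> (h, h') by exact: cvg_pair.
move=> /(cvg_comp _ _) /(_ (@mulg_continuous G (h, h'))); exact.
Qed.

Lemma displacement_compact x y r : compact [set g | d (a g x) y <= r].
Proof.
have cC : compact (mball x (r + d x y)) by exact: X_proper.
apply: (subclosed_compact _ (a_proper cC)).
  have -> : [set g | d (a g x) y <= r] = (fun g => a g x) @^-1` (mball y r).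
    by apply/seteqP; split => g; rewrite /mball /= metric_sym.
  apply: closed_comp; last exact: mball_closed.
  move=> g _; apply: (@act_cvg _ (nbhs g)); [exact: cvg_id | exact: cvg_cst].
move=> g /= gr; exists (a g x); split; last first.
  rewrite /mball /= (le_trans (metric_triangle _ y _))// addrC lerD2r.
  by rewrite metric_sym.
exists x => //; rewrite /mball /= mdistxx addr_ge0 ?mdist_ge0//.
exact: le_trans (mdist_ge0 _ _) gr.
Qed.

(* A homomorphism in the closure of the conjugates of [iota] for the topology
   of pointwise convergence. *)
Definition limhom (phi : Gam -> G) :=
  (forall h h', phi (h * h')%g = (phi h * phi h')%g) /\
  forall (s : seq Gam) (O : Gam -> set G), (forall h, nbhs (phi h) (O h)) ->
    exists g, forall h, h \in s -> O h (g * iota h * g^-1)%g.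

Lemma limhom1 phi : limhom phi -> phi 1%g = 1%g.
Proof. by move=> [phiM _]; apply: (mulgI (phi 1%g)); rewrite -phiM !mulg1. Qed.

Lemma limhom_cvg (I : Type) (F : set_system I) (phi : I -> Gam -> G) (g : I -> G) psi :
  UltraFilter F -> (forall i, limhom (phi i)) ->
  (forall h, (g i * phi i h * (g i)^-1)%g @[i --> F] --> psi h) -> limhom psi.
Proof.
move=> FU phil cpsi; split=> [h h'|s O nO].
  apply: (cvg_unique (td_hausdorff G_td) (cpsi (h * h')%g)).
  rewrite (_ : (fun i => _) = fun i => (g i * phi i h * (g i)^-1 * (g i * phi i h' * (g i)^-1))%g).
    by apply: mulg_cvg; exact: cpsi.
  by apply/funext => i; have [-> _] := phil i; rewrite !mulgA mulgVK.
have : \forall i \near F, forall h, h \in s -> (O h)° (g i * phi i h * (g i)^-1)%g.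
  elim: s => [|h s IH]; first by near=> i.
  have hh : \forall i \near F, (O h)° (g i * phi i h * (g i)^-1)%g.
    by apply: (cpsi h); exact: nbhs_interior.
  near=> i => h'; rewrite inE => /predU1P[->|]; first by near: i; exact: hh.
  by move: h'; near: i; exact: IH.
move=> /filter_ex [i Hi].
have [|g' g'P] := (phil i).2 s (fun h => [set x | h \in s -> O h (g i * x * (g i)^-1)%g]).
  move=> h; have [hs|hs] := boolP (h \in s); last exact: filterE.
  have nOh : nbhs (g i * phi i h * (g i)^-1)%g (O h) := Hi h hs.
  by apply: filterS (near_conj nOh) => x Ox _; exact: Ox.
exists (g i * g')%g => h hs; have := g'P h hs hs.
by rewrite invgM !mulgA.
Unshelve. all: by end_near. Qed.

Hypothesis a_cobounded : forall x : X, exists r, forall y, exists g, d x (a g y) <= r.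
Variable U : set Gam.

(** Up to a rotation, the displacement of the whole flat is bounded by that of its origin, so
    controlling the origin suffices in a limit. The rotation is chosen for each [h] separately. *)
Definition config k (phi : Gam -> G) (f : 'rV[R]_k -> X) :=
  [/\ limhom phi, flat f, forall u, U u -> a (phi u) (f 0) = f 0 &
    forall h, exists A A', rotation_pair A A' /\
      forall v, d (a (phi h) (f v)) (f (A v)) <= d (a (phi h) (f 0)) (f 0)].

(** Pointwise limits exist by boundedness, and the limits of the inverses provide the inverse. *)
Let small_rotation k (I : Type) (F : set_system I) (A A' : I -> 'rV[R]_k -> 'rV[R]_k) :
  UltraFilter F -> (forall i, rotation_pair (A i) (A' i)) ->
  exists B B', rotation_pair B B' /\
    forall v e, 0 < e -> \forall i \near F, enorm (A i v - B v) <= e.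
Proof.
move=> FU AA; have Ai i v : enorm (A i v) = enorm v.
  by have [iso A0 _ _] := AA i; rewrite -[A i v]subr0 -A0 iso subr0.
have A'i i v : enorm (A' i v) = enorm v by have [_ _ _ K] := AA i; rewrite -(Ai i) K.
have H v : exists l, forall e, 0 < e -> \forall i \near F, enorm (A i v - l) <= e.
  by apply: (@rv_ultra_cvg _ _ _ _ _ (enorm v)); near=> i; rewrite Ai.
have H' v : exists l, forall e, 0 < e -> \forall i \near F, enorm (A' i v - l) <= e.
  by apply: (@rv_ultra_cvg _ _ _ _ _ (enorm v)); near=> i; rewrite A'i.
have [B BP] := choice H; have [B' B'P] := choice H'; exists B, B'; split; last exact: BP.
have A'iso i v w : enorm (A' i v - A' i w) = enorm (v - w).
  by have [iso _ _ K] := AA i; rewrite -iso !K.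
have lim_iso (C : I -> 'rV[R]_k -> 'rV[R]_k) D :
    (forall i v w, enorm (C i v - C i w) = enorm (v - w)) ->
    (forall v e, 0 < e -> \forall i \near F, enorm (C i v - D v) <= e) ->
    forall v w, enorm (D v - D w) = enorm (v - w).
  move=> iso CD v w; apply/eqP; rewrite eq_le; apply/andP; split; apply/ler_addgt0Pr => e e0.
    have e2 : 0 < e / 2 by rewrite divr_gt0.
    have [i [iv iw]] := filter_ex (filterI (CD v _ e2) (CD w _ e2)).
    have := enormB_triangle (D v) (C i v) (D w); have := enormB_triangle (C i v) (C i w) (D w).
    by rewrite (enormB (D v) (C i v)) iso => h1 h2; move: iv iw h1 h2; lra.
  have e2 : 0 < e / 2 by rewrite divr_gt0.
  have [i [iv iw]] := filter_ex (filterI (CD v _ e2) (CD w _ e2)).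
  have := enormB_triangle (C i v) (D v) (C i w); have := enormB_triangle (D v) (D w) (C i w).
  by rewrite (enormB (D w) (C i w)) iso => h1 h2; move: iv iw h1 h2; lra.
have lim_id (C C' : I -> 'rV[R]_k -> 'rV[R]_k) D D' :
    (forall i v w, enorm (C i v - C i w) = enorm (v - w)) -> (forall i, cancel (C' i) (C i)) ->
    (forall v e, 0 < e -> \forall i \near F, enorm (C i v - D v) <= e) ->
    (forall v e, 0 < e -> \forall i \near F, enorm (C' i v - D' v) <= e) -> cancel D' D.
  move=> iso K CD CD' v; apply/eqP; rewrite -subr_eq0; apply/eqP/enorm_eq0.
  apply/eqP; rewrite eq_le enorm_ge0 andbT; apply/ler_addgt0Pr => e e0.
  have e2 : 0 < e / 2 by rewrite divr_gt0.
  have [i [iv iw]] := filter_ex (filterI (CD (D' v) _ e2) (CD' v _ e2)).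
  have := enormB_triangle (D (D' v)) (C i (D' v)) v.
  rewrite -[X in enorm (C i (D' v) - X)](K i v) iso (enormB (D _) (C i _)) (enormB (D' v) (C' i v)).
  by move: iv iw; lra.
split; first by apply: (lim_iso _ _ _ BP) => i; have [] := AA i.
- apply: enorm_eq0; apply/eqP; rewrite eq_le enorm_ge0 andbT; apply/ler_addgt0Pr => e e0.
  have [i] := filter_ex (BP 0 e e0); have [_ -> _ _] := AA i.
  by rewrite sub0r enormN add0r.
- by apply: (lim_id _ _ _ _ A'iso _ B'P BP) => i; have [] := AA i.
- by apply: (lim_id _ _ _ _ _ _ BP B'P) => i; have [] := AA i.
Unshelve. all: by end_near. Qed.

(** Conjugation by [c i] brings the base points into a bounded set, where properness of [X] and of
    the action provides limits. The maps [f i] are asked to be isometric eventually on each ball, so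
    that long segments may converge to lines. *)
Lemma config_limit (x0 : X) k (I : Type) (F : set_system I) (phi : I -> Gam -> G)
    (f : I -> 'rV[R]_k -> X) (A A' : I -> Gam -> 'rV[R]_k -> 'rV[R]_k) :
  UltraFilter F -> (forall i, limhom (phi i)) ->
  (forall r, \forall i \near F, forall v w, enorm v <= r -> enorm w <= r ->
    d (f i v) (f i w) = enorm (v - w)) ->
  (forall u, U u -> \forall i \near F, a (phi i u) (f i 0) = f i 0) ->
  (forall i h, rotation_pair (A i h) (A' i h)) ->
  (forall h v, \forall i \near F,
    d (a (phi i h) (f i v)) (f i (A i h v)) <= d (a (phi i h) (f i 0)) (f i 0)) ->
  (forall h, exists D, \forall i \near F, d (a (phi i h) (f i 0)) (f i 0) <= D) ->
  exists psi (g : 'rV[R]_k -> X), config psi g /\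
    forall h D, (\forall i \near F, d (a (phi i h) (f i 0)) (f i 0) <= D) ->
      d (a (psi h) (g 0)) (g 0) <= D.
Proof.
move=> FU phil ff Uf AA fA fD.
have [r0 cob0] := a_cobounded x0; have [cob cobP] := choice cob0.
pose c i := cob (f i 0).
have cP i : d x0 (a (c i) (f i 0)) <= r0 by exact: cobP.
have ff1 v w : \forall i \near F, d (f i v) (f i w) = enorm (v - w).
  have := ff (Num.max (enorm v) (enorm w)); apply: filterS => i H.
  by apply: H; rewrite le_max lexx ?orbT.
have G' v : exists l : X, a (c i) (f i v) @[i --> F] --> l.
  have [|l _ lv] := @proper_ultra_cvg _ _ _ F (fun i => a (c i) (f i v)) x0 (r0 + enorm v) X_proper FU; last by exists l.
  near=> i; apply: le_trans (metric_triangle _ (a (c i) (f i 0)) _) _.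
  rewrite act_isometry; apply: lerD => //; near: i; apply: filterS (ff1 0 v) => i ->.
  by rewrite sub0r enormN.
have [g gP] := choice G'.
have Psi h : exists l : G, (c i * phi i h * (c i)^-1)%g @[i --> F] --> l.
  have [D DP] := fD h.
  have [|l _ lv] := compact_ultra_cvg (f := fun i => (c i * phi i h * (c i)^-1)%g) FU
     (@displacement_compact x0 x0 (r0 + D + r0)); last by exists l.
  near=> i => /=; have iD : d (a (phi i h) (f i 0)) (f i 0) <= D by near: i.
  apply: le_trans (metric_triangle _ (a (c i) (f i 0)) _) _.
  apply: lerD; last by rewrite metric_sym.
  apply: le_trans (metric_triangle _ (a (c i * phi i h * (c i)^-1)%g (a (c i) (f i 0))) _) _.
  rewrite act_isometry; apply: lerD => //.
  by rewrite actM actVK actM act_isometry.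
have [psi psiP] := choice Psi.
have AA' h : exists B B', rotation_pair B B' /\
    forall v e, 0 < e -> \forall i \near F, enorm (A i h v - B v) <= e.
  by apply: (@small_rotation k I F (fun i => A i h) (fun i => A' i h)) => // i; exact: AA.
have cpsi h v : a (c i) (a (phi i h) (f i v)) @[i --> F] --> a (psi h) (g v).
  rewrite (_ : (fun i => _) = fun i => a (c i * phi i h * (c i)^-1)%g (a (c i) (f i v))).
    exact: act_cvg.
  by apply/funext => i; rewrite actM actVK actM.
have dpsi h : d (a (phi i h) (f i 0)) (f i 0) @[i --> F] --> d (a (psi h) (g 0)) (g 0).
  rewrite (_ : (fun i => _) = fun i => d (a (c i) (a (phi i h) (f i 0))) (a (c i) (f i 0))).
    exact: mdist_cvg.
  by apply/funext => i; rewrite act_isometry.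
exists psi, g; split; last first.
  by move=> h D hD; apply: (@cvg_le_to R I F _ _ (fun=> D) _ D (dpsi h) _ hD); exact: cvg_cst.
split.
- exact: limhom_cvg psiP.
- move=> v w; apply: (cvg_to_eq (mdist_cvg (gP v) (gP w))).
  by apply: filterS (ff1 v w) => i; rewrite act_isometry.
- move=> u Uu; apply: (metric_cvg_unique _ (cpsi u 0)).
  apply: cvg_trans (gP 0); apply: near_eq_cvg.
  by apply: filterS (Uf u Uu) => i ->.
- move=> h; have [B [B' [rB AB]]] := AA' h; exists B, B'; split => // v.
  apply/ler_addgt0Pr => e e0.
  have cR : d (a (phi i h) (f i 0)) (f i 0) + e @[i --> F] --> d (a (psi h) (g 0)) (g 0) + e.
    by apply: cvgD; [exact: dpsi | exact: cvg_cst].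
  apply: (cvg_le_to (mdist_cvg (cpsi h v) (gP (B v))) cR).
  near=> i; rewrite /= act_isometry.
  apply: le_trans (metric_triangle _ (f i (A i h v)) _) _; apply: lerD.
    by near: i; exact: fA.
  have -> : d (f i (A i h v)) (f i (B v)) = enorm (A i h v - B v).
    have Ai w : enorm (A i h w) = enorm w.
      by have [iso A0 _ _] := AA i h; rewrite -[A i h w]subr0 -A0 iso subr0.
    have Bn : enorm (B v) = enorm v.
      by have [iso B0 _ _] := rB; rewrite -[B v]subr0 -B0 iso subr0.
    have H : forall w w', enorm w <= enorm v -> enorm w' <= enorm v ->
        d (f i w) (f i w') = enorm (w - w') by near: i; exact: ff.
    by apply: H; rewrite ?Ai ?Bn.
  by near: i; exact: AB.
Unshelve. all: by end_near. Qed.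

Lemma flat_dim_bound N k (f : 'rV[R]_k -> X) : packing_bound (X := X) N -> flat f -> (k <= N)%N.
Proof.
move=> pN ff; apply: (pN _ (fun i => f (delta_mx 0 i)) (f 0)) => [i|i j ij].
  by rewrite ff sub0r enormN enorm_delta.
rewrite ff -ler_sqr ?nnegrE ?enorm_ge0 ?ler01// expr1n enorm_sqr dotBl !dotBr.
rewrite -!enorm_sqr !enorm_delta expr1n.
have dot0 (i' j' : 'I_k) : i' != j' -> dot (delta_mx 0 i') (delta_mx 0 j') = 0 :> R.
  move=> ij'; rewrite dotE big1// => l _; rewrite !mxE !eqxx /=.
  by have [->|_] := eqVneq l i'; rewrite ?mul0r// (negbTE ij') mulr0.
by rewrite !dot0 ?(eq_sym j)//; lra.
Qed.

(** Zorn's lemma for the pointwise order of displacements, among the configurations of maximal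
    dimension; a chain is bounded by a limit along an ultrafilter that refines its tails. *)
Lemma minimal_config (x0 : X) k0 phi0 (f0 : 'rV[R]_k0 -> X) N :
  packing_bound (X := X) N -> config phi0 f0 ->
  exists k phi (f : 'rV[R]_k -> X), [/\ config phi f,
    forall k' phi' (f' : 'rV[R]_k' -> X), config phi' f' -> (k' <= k)%N &
    forall phi' (f' : 'rV[R]_k -> X), config phi' f' ->
      (forall h, d (a (phi' h) (f' 0)) (f' 0) <= d (a (phi h) (f 0)) (f 0)) ->
      forall h, d (a (phi' h) (f' 0)) (f' 0) = d (a (phi h) (f 0)) (f 0)].
Proof.
move=> pN c0.
pose P k := `[< exists phi (f : 'rV[R]_k -> X), config phi f >].
have exP : exists k, P k by exists k0; apply/asboolP; exists phi0, f0.
have ubP k : P k -> (k <= N)%N by move=> /asboolP[phi [f [_ ff _ _]]]; exact: flat_dim_bound ff.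
case: (ex_maxnP exP ubP) => k /asboolP[phi1 [f1 c1]] kmax.
pose T := {c : (Gam -> G) * ('rV[R]_k -> X) | config c.1 c.2}.
pose disp (c : T) h := d (a ((sval c).1 h) ((sval c).2 0)) ((sval c).2 0).
pose r (c c' : T) := `[< forall h, disp c' h <= disp c h >].
have rr c : r c c by apply/asboolP.
have rt c c' c'' : r c c' -> r c' c'' -> r c c''.
  by move=> /asboolP h1 /asboolP h2; apply/asboolP => h; exact: le_trans (h2 h) (h1 h).
have [|C Ctot|[[phi f] /= cf] cmax] := @ZL_preorder T (exist _ (phi1, f1) c1) r rr.
- exact: rt.
- have [[c1' Cc1]|nC] := pselect (exists c, C c); last first.
    by exists (exist _ (phi1, f1) c1) => s Cs; case: nC; exists s.
  pose F0 := filter_from C (fun c => [set c' | r c c']).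
  have F0F : ProperFilter F0.
    apply: filter_from_proper => [|c Cc]; last by exists c; exact: rr.
    apply: filter_from_filter; first by exists c1'.
    move=> c c' Cc Cc'; have [h|h] := Ctot c c' Cc Cc'.
      by exists c' => // s /= h'; split=> //=; exact: rt h'.
    by exists c => // s /= h'; split=> //=; exact: rt h'.
  have [F [FU FF]] := ultraFilterLemma F0F.
  have H (ch : T * Gam) : exists AA : ('rV[R]_k -> 'rV[R]_k) * ('rV[R]_k -> 'rV[R]_k),
      rotation_pair AA.1 AA.2 /\ forall v, d (a ((sval ch.1).1 ch.2) ((sval ch.1).2 v)) ((sval ch.1).2 (AA.1 v)) <= disp ch.1 ch.2.
    by case: ch => [[c cc] h]; have [_ _ _ /(_ h)[A [A' AA]]] := cc; exists (A, A').
  have [AA AAP] := choice H.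
  have FC c h : C c -> \forall i \near F, disp i h <= disp c h.
    by move=> Cc; apply: FF; exists c => // s /asboolP; exact.
  have [||||||psi [g [cg gD]]] := @config_limit x0 k T F (fun c => (sval c).1) (fun c => (sval c).2)
    (fun c h => (AA (c, h)).1) (fun c h => (AA (c, h)).2) FU.
  + by move=> [c cc]; have [] := cc.
  + by move=> r'; apply: filterE => -[c cc] v w _ _; have [_ cfl _ _] := cc; exact: cfl.
  + by move=> u Uu; apply: filterE => -[c cc]; have [_ _ cU _] := cc; exact: cU.
  + by move=> c h; case: (AAP (c, h)).
  + by move=> h v; apply: filterE => c; case: (AAP (c, h)).
  + by move=> h; exists (disp c1' h); exact: FC.
  exists (exist _ (psi, g) cg) => s Cs; apply/asboolP => h.
  by apply: gD; exact: FC.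
exists k, phi, f; split => //.
  by move=> k' phi' f' c'; apply: kmax; apply/asboolP; exists phi', f'.
move=> phi' f' c' le h; apply/eqP; rewrite eq_le le /=.
have /asboolP := cmax (exist _ (phi', f') c') (asboolT le).
exact.
Qed.

End LimitHomomorphisms.

Section RotationSum.
Context {R : realType} {k j : nat}.
Implicit Types u v : 'rV[R]_(k + j).

Lemma dot_submx u v : dot u v = dot (lsubmx u) (lsubmx v) + dot (rsubmx u) (rsubmx v).
Proof.
by rewrite -{1}(hsubmxK u) -{1}(hsubmxK v) /dot tr_row_mx mul_row_col mxE.
Qed.

Lemma enorm_submx u : enorm u ^+ 2 = enorm (lsubmx u) ^+ 2 + enorm (rsubmx u) ^+ 2.
Proof. by rewrite !enorm_sqr dot_submx. Qed.

Lemma rotation_sum (A A' : 'rV[R]_k -> 'rV[R]_k) (B B' : 'rV[R]_j -> 'rV[R]_j) :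
  rotation_pair A A' -> rotation_pair B B' ->
  rotation_pair (fun u : 'rV[R]_(k + j) => row_mx (A (lsubmx u)) (B (rsubmx u)))
                (fun u => row_mx (A' (lsubmx u)) (B' (rsubmx u))).
Proof.
move=> [Aiso A0 AK AK'] [Biso B0 BK BK']; split.
- move=> u v; apply/eqP; rewrite -(@eqrXn2 _ 2) ?enorm_ge0//; apply/eqP.
  rewrite !enorm_submx opp_row_mx add_row_mx row_mxKl row_mxKr Aiso Biso.
  by rewrite !linearB.
- by rewrite !linear0 A0 B0 row_mx0.
- by move=> u; rewrite row_mxKl row_mxKr AK BK hsubmxK.
- by move=> u; rewrite row_mxKl row_mxKr AK' BK' hsubmxK.
Qed.

Lemma enorm_rsubmx u : enorm (rsubmx u) <= enorm u.
Proof.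
rewrite -ler_sqr ?nnegrE ?enorm_ge0// [leRHS]enorm_submx lerDr; exact: sqr_ge0.
Qed.

End RotationSum.

Lemma enorm_rV1 (R : realType) (w : 'rV[R]_1) : enorm w = `|w 0 0|.
Proof. by rewrite /enorm dotE big_ord1 -expr2 sqrtr_sqr. Qed.

Lemma rotation_enorm (R : realType) k (A A' : 'rV[R]_k -> 'rV[R]_k) v :
  rotation_pair A A' -> enorm (A v) = enorm v.
Proof. by move=> [iso A0 _ _]; rewrite -[A v]subr0 -A0 iso subr0. Qed.

(** * Consequences of maximal dimension and minimal displacement *)

Section ExtremalConfiguration.
Context {R : realType} {X : metricType R}.
Hypothesis X_Hadamard : Hadamard X.
Hypothesis X_proper : proper_space (X := X).
Variable N : nat.
Hypothesis X_packing : packing_bound (X := X) N.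
Context {G : topologicalGroupType} (a : isometric_action G X).
Hypothesis a_proper : proper_action a.
Hypothesis a_cobounded : forall x : X, exists r, forall y, exists g, mdist x (a g y) <= r.
Hypothesis G_td : totally_disconnected [set: G].
Context {Gam : topologicalGroupType} (iota : Gam -> G) (U : set Gam).
Hypothesis Gam_amenable : amenable R Gam.
Hypothesis U_subgroup : is_subgroup U.
Hypothesis U_open : open U.
Local Notation d := (@mdist R X).
Local Notation geo := (geo X_Hadamard).
Local Notation config := (config a iota U).

Variables (k : nat) (phi : Gam -> G) (f : 'rV[R]_k -> X).
Hypothesis f_config : config phi f.
Hypothesis dim_max : forall k' phi' (f' : 'rV[R]_k' -> X), config phi' f' -> (k' <= k)%N.
Hypothesis disp_min : forall phi' (f' : 'rV[R]_k -> X), config phi' f' ->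
  (forall h, d (a (phi' h) (f' 0)) (f' 0) <= d (a (phi h) (f 0)) (f 0)) ->
  forall h, d (a (phi' h) (f' 0)) (f' 0) = d (a (phi h) (f 0)) (f 0).

Local Notation x0 := (f 0).
Local Notation ph h := (act a (phi h)).
Local Notation C := (parallel_set f).
Local Notation Y := (fiber f x0).
Local Notation tau := (tau f).
Local Notation beta := (beta f).

Let f_flat : flat f. Proof. by case: f_config. Qed.

Let phi_limhom : limhom iota phi. Proof. by case: f_config. Qed.

Let Cx0 : C x0. Proof. exact: parallel_set_base. Qed.

Let Yx0 : Y x0. Proof. exact: fiber_base. Qed.

Let YC y : Y y -> C y. Proof. by case. Qed.

Let phM h h' x : ph (h * h')%g x = ph h (ph h' x).
Proof. by have [-> _] := phi_limhom; rewrite actM. Qed.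

Let ph1 x : ph 1%g x = x. Proof. by rewrite (limhom1 phi_limhom) act1. Qed.

Let linear_part : exists A A' : Gam -> 'rV[R]_k -> 'rV[R]_k, forall h,
  rotation_pair (A h) (A' h) /\ forall v, d (ph h (f v)) (f (A h v)) <= d (ph h x0) x0.
Proof.
have [_ _ _ H] := f_config.
have [A AP] := choice H; have [A' AAP] := choice AP.
by exists A, A'.
Qed.

Let A := projT1 (cid linear_part).
Let A' := projT1 (cid (projT2 (cid linear_part))).

Let AP h : rotation_pair (A h) (A' h).
Proof. by have [] := projT2 (cid (projT2 (cid linear_part))) h. Qed.

Let fA h v : d (ph h (f v)) (f (A h v)) <= d (ph h x0) x0.
Proof. by have [] := projT2 (cid (projT2 (cid linear_part))) h. Qed.

Let A'_iso h v w : enorm (A' h v - A' h w) = enorm (v - w).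
Proof. by have [iso _ _ K] := AP h; rewrite -iso !K. Qed.

Let A'0 h : A' h 0 = 0.
Proof. by have [iso A0 K _] := AP h; rewrite -{1}A0 K. Qed.

(** [phi h] moves [f (A' h v)] to within a fixed distance of [f v], so it permutes the flats
    parallel to [f] and acts on their parameters by [A h]. *)
Let ph_parallel h y : C y -> parallel_through f (ph h y) (fun w => ph h (tau (A' h w) y)).
Proof.
move=> Cy; split.
- by move=> v w; rewrite act_isometry tau_dist.
- by rewrite A'0 tau0.
- have [_ _ [M fM]] := tauP Cy.
  exists (M + d (ph h x0) x0) => v.
  apply: le_trans (metric_triangle _ (ph h (f (A' h v))) _) _; apply: lerD.
    by rewrite act_isometry.
  by have [_ _ _ K] := AP h; rewrite -{2}(K v).
Qed.

Lemma ph_parallel_set h y : C y -> C (ph h y).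
Proof. by move=> Cy; exists (fun w => ph h (tau (A' h w) y)); exact: ph_parallel. Qed.

Lemma ph_tau h v y : C y -> ph h (tau v y) = tau (A h v) (ph h y).
Proof.
move=> Cy; rewrite (tau_unique X_Hadamard (ph_parallel h Cy)).
by have [_ _ -> _] := AP h.
Qed.

Lemma ph_beta h y z : Y y -> Y z -> beta (ph h y) (ph h z) = 0.
Proof.
move=> Yy Yz; apply: dot_inj => w; rewrite dot0l.
have [Cy Cz] := (YC Yy, YC Yz).
have := tau_dist_beta X_Hadamard w (ph_parallel_set h Cy) (ph_parallel_set h Cz).
have [_ _ _ K] := AP h; rewrite -{1}(K w) -ph_tau// !act_isometry.
have {2}<- := tau0 Cy.
have := fiber_dist X_Hadamard 0 (A' h w) Cx0 Yy Yz; rewrite tau0// => ->.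
have -> : enorm (0 - A' h w) = enorm w.
  by rewrite -(A'0 h) A'_iso sub0r enormN.
rewrite enorm_sqr; lra.
Qed.

Definition shift h := beta (ph h x0) x0.

Lemma beta_ph h y : Y y -> beta (ph h y) x0 = shift h.
Proof.
move=> Yy; rewrite (beta_cocycle X_Hadamard (x := ph h x0)) ?ph_beta ?add0r//.
- exact: ph_parallel_set.
- exact/ph_parallel_set/YC.
Qed.

(** On the parallel set, [phi h] is a product: [A h] followed by the translation by [shift h] on
    [R^k], and [rho h] on the fiber; see [ph_tau] and [ph_rho]. *)
Definition rho h y := fiber_proj f x0 (ph h y).

Lemma ph_rho h y : Y y -> ph h y = tau (shift h) (rho h y).
Proof.
move=> Yy; rewrite -(beta_ph h Yy) /rho fiber_projK//.
exact/ph_parallel_set/YC.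
Qed.

Lemma rho_Y h y : Y y -> Y (rho h y).
Proof. by move=> Yy; apply: fiber_proj_fiber => //; exact/ph_parallel_set/YC. Qed.

Lemma rho1 y : Y y -> rho 1%g y = y.
Proof. by move=> Yy; rewrite /rho ph1 fiber_proj_id. Qed.

Lemma rhoM g h y : Y y -> rho (g * h)%g y = rho g (rho h y).
Proof.
move=> Yy; have Ch := ph_parallel_set h (YC Yy).
have -> : rho h y = tau (- beta (ph h y) x0) (ph h y) by [].
rewrite /rho phM ph_tau// fiber_proj_tau//.
exact: ph_parallel_set.
Qed.

Lemma rho_isometric h y z : Y y -> Y z -> d (rho h y) (rho h z) = d y z.
Proof.
move=> Yy Yz; rewrite /rho /fiber_proj !beta_ph// tau_isometric ?act_isometry//.
- exact/ph_parallel_set/YC.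
- exact/ph_parallel_set/YC.
Qed.

Lemma ph_disp h y : Y y -> d (ph h y) y ^+ 2 = enorm (shift h) ^+ 2 + d (rho h y) y ^+ 2.
Proof.
move=> Yy; rewrite (ph_rho h Yy) -{2}(tau0 (YC Yy)).
by rewrite (fiber_dist X_Hadamard _ _ Cx0)// ?subr0//; exact: rho_Y.
Qed.

Let Ufix u : U u -> ph u x0 = x0.
Proof. by case: f_config => _ _ + _; apply. Qed.

Lemma rho_fix u : U u -> rho u x0 = x0.
Proof. by move=> Uu; rewrite /rho Ufix// fiber_proj_id. Qed.

Lemma shift_fix u : U u -> shift u = 0.
Proof. by move=> Uu; rewrite /shift Ufix// betaxx. Qed.

(** The orbit map of [x0] is constant on the left cosets of [U], so any bounded function on [X]
    pulls back to a bounded continuous function on [Gam]. *)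
Lemma mean_orbit : exists mean : (X -> R) -> R, [/\
  forall c (F F' : X -> R), bounded_fun F -> bounded_fun F' ->
    mean (fun q => c * F q + F' q) = c * mean F + mean F',
  forall F : X -> R, bounded_fun F -> (forall h, 0 <= F (rho h x0)) -> 0 <= mean F,
  mean (fun=> 1) = 1 &
  forall (F : X -> R) h, bounded_fun F -> mean (fun q => F (rho h q)) = mean F].
Proof.
have [m [m_lin m_ge0 m1 m_inv]] := Gam_amenable.
have [U1 UM UV] := U_subgroup.
have bc (F : X -> R) : bounded_fun F -> bounded_continuous (fun h => F (rho h x0)).
  move=> [B FB]; split; last by exists B => h; exact: FB.
  move=> h; have nU : nbhs (h^-1 * h)%g U by rewrite mulVg; exact: open_nbhs_nbhs.
  apply: cvg_near_cst; apply: filterS (near_lmul nU) => h' Uh'.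
  by rewrite -[h'](mulVKg h) rhoM// rho_fix.
exists (fun F => m (fun h => F (rho h x0))); split => //.
- by move=> c F F' bF bF'; apply: m_lin; exact: bc.
- by move=> F bF F0; apply: m_ge0; [exact: bc | exact: F0].
- move=> F h bF; rewrite -(m_inv _ h (bc F bF)); congr m.
  by apply/funext => h'; rewrite rhoM.
Qed.

Lemma config_tau y : C y -> (forall u, U u -> ph u y = y) -> config phi (fun v => tau v y).
Proof.
move=> Cy Uy; split => //.
- by move=> v w; rewrite tau_dist.
- by move=> u Uu; rewrite tau0// Uy.
- move=> h; exists (A h), (A' h); split => // v.
  rewrite ph_tau// tau0// tau_isometric//; exact: ph_parallel_set.
Qed.

(* Replacing the base point of the configuration by [y] does not decrease the
   displacements, by minimality. *)
Lemma disp_const y : Y y -> (forall h, d (ph h y) y <= d (ph h x0) x0) ->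
  forall h, d (ph h y) y = d (ph h x0) x0.
Proof.
move=> Yy le; have Uy u : U u -> ph u y = y.
  move=> Uu; apply: mdist_positivity; apply/eqP; rewrite eq_le mdist_ge0 andbT.
  by apply: le_trans (le u) _; rewrite Ufix// mdistxx.
have := disp_min (config_tau (YC Yy) Uy); rewrite tau0; last exact: YC.
exact.
Qed.

Let ph_geo h y z t : 0 <= t <= 1 -> ph h (geo y z t) = geo (ph h y) (ph h z) t.
Proof.
move=> t01; apply: geo_unique => //.
  by rewrite !act_isometry geo_distl.
by rewrite !act_isometry geo_distr.
Qed.

(** Displacements are convex and at both ends bounded by those of [x0]; minimality turns the
    inequality into an equality. *)
Lemma disp_segment z t : 0 <= t <= 1 -> Y z -> (forall h, d (ph h z) z <= d (ph h x0) x0) ->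
  forall h, d (ph h (geo x0 z t)) (geo x0 z t) = d (ph h x0) x0.
Proof.
move=> t01 Yz le; apply: disp_const => [|h].
  by apply: (fiber_convex X_Hadamard Cx0).
rewrite ph_geo//; apply: le_trans (geo_convex _ _ _ _ _ t01) _.
have := le h; have /andP[t0 t1] := t01; nra.
Qed.

(** The product of [f] and [f'] would be a configuration of dimension [k + j]. *)
Lemma no_product_config j (f' : 'rV[R]_j -> X) : (0 < j)%N -> flat f' -> (forall v, Y (f' v)) ->
  (forall u, U u -> rho u (f' 0) = f' 0) ->
  (forall h, exists B B', rotation_pair B B' /\
     forall v, d (rho h (f' v)) (f' (B v)) <= d (rho h (f' 0)) (f' 0)) -> False.
Proof.
move=> j0 f'flat f'Y f'U f'rot.
suff c : config phi (fun u : 'rV[R]_(k + j) => tau (lsubmx u) (f' (rsubmx u))).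
  by have := dim_max c; rewrite -{2}[k]addn0 leq_add2l leqn0 => /eqP j0'; rewrite j0' in j0.
split => //.
- move=> u v; apply/eqP; rewrite -(@eqrXn2 _ 2) ?mdist_ge0 ?enorm_ge0//; apply/eqP.
  by rewrite (fiber_dist X_Hadamard _ _ Cx0)// f'flat enorm_submx !linearB.
- move=> u Uu; rewrite !linear0 tau0; last exact: YC.
  by rewrite ph_rho// shift_fix// tau0 ?f'U//; exact: YC.
- move=> h; have [B [B' [rB Brho]]] := f'rot h.
  exists (fun u : 'rV[R]_(k + j) => row_mx (A h (lsubmx u)) (B (rsubmx u))).
  exists (fun u : 'rV[R]_(k + j) => row_mx (A' h (lsubmx u)) (B' (rsubmx u))).
  split; first exact: rotation_sum.
  move=> u; rewrite row_mxKl row_mxKr ph_tau; last exact: YC.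
  rewrite !linear0 tau0; last exact: YC.
  rewrite tau_isometric//; [|exact/ph_parallel_set/YC|exact: YC].
  rewrite -ler_sqr ?nnegrE ?mdist_ge0// ph_disp// ph_rho// -(tau0 (YC (f'Y (B _)))).
  rewrite (fiber_dist X_Hadamard _ _ Cx0)//; last exact: rho_Y.
  by rewrite subr0 lerD2l ler_sqr ?nnegrE ?mdist_ge0.
Qed.

(** All displacements are constant along the segments from [x0] to [z n]. Centred at their midpoints
    and multiplied by the flat, these segments converge to a flat of dimension [k + 1]. *)
Lemma no_long_segments (z : nat -> X) : (forall n, Y (z n)) ->
  (forall n h, d (ph h (z n)) (z n) <= d (ph h x0) x0) ->
  (forall n, n%:R <= d x0 (z n)) -> False.
Proof.
move=> Yz zmin zL; pose L n := d x0 (z n).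
(* Clamping keeps [sig n] total; as soon as [n] is positive and at least [2 * r], it is inactive on
   parameters of absolute value at most [r]. *)
pose cl (t : R) := Num.max 0 (Num.min 1 t).
have cl01 t : 0 <= cl t <= 1 by rewrite /cl le_max lexx /= ge_max ler01 ge_min lexx.
pose sig n (s : R) := geo x0 (z n) (cl (2^-1 + s / L n)).
have Ysig n s : Y (sig n s) by apply: (fiber_convex X_Hadamard Cx0).
have sig_disp n s h : d (ph h (sig n s)) (sig n s) = d (ph h x0) x0.
  by apply: disp_segment => // h'; exact: zmin.
pose f' n (u : 'rV[R]_(k + 1)) := tau (lsubmx u) (sig n (rsubmx u 0 0)).
have f'0 n : f' n 0 = sig n 0 by rewrite /f' !linear0 mxE tau0//; exact: YC.
have rot h := rotation_sum (AP h) (And4 (fun v w => erefl) erefl (fun v => erefl) (fun v => erefl) :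
   rotation_pair (fun v : 'rV[R]_1 => v) (fun v => v)).
have [F [FU FF]] := ultraFilterLemma (@eventually_filter).
have [||||||psi [g [cg _]]] := @config_limit R X X_proper G a a_proper G_td Gam iota a_cobounded U
   x0 (k + 1) nat F (fun=> phi) f'
   (fun n h u => row_mx (A h (lsubmx u)) (rsubmx u)) (fun n h u => row_mx (A' h (lsubmx u)) (rsubmx u)) FU.
- by [].
- move=> r; apply: FF; have h1 := nbhs_infty_ger (2 * r); have h2 := nbhs_infty_gt 0.
  apply: filterS (filterI h1 h2) => n [rn n0] v w vr wr.
  have Ln : n%:R <= L n := zL n.
  have L0 : 0 < L n by apply: lt_le_trans Ln; rewrite ltr0n.
  have clE s : `|s| <= r -> cl (2^-1 + s / L n) = 2^-1 + s / L n.
    move=> sr; have : `|s / L n| <= 2^-1.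
      rewrite normrM normfV (gtr0_norm L0) ler_pdivrMr//; lra.
    rewrite ler_norml => /andP[s1 s2]; rewrite /cl min_r; last lra.
    by rewrite max_r//; lra.
  have bnd (u : 'rV[R]_(k + 1)) : enorm u <= r -> `|rsubmx u 0 0| <= r.
    by move=> ur; have := le_trans (enorm_rsubmx u) ur; rewrite enorm_rV1; exact.
  apply/eqP; rewrite -(@eqrXn2 _ 2) ?mdist_ge0 ?enorm_ge0//; apply/eqP.
  rewrite (fiber_dist X_Hadamard _ _ Cx0)// enorm_submx !linearB; congr (_ + _ ^+ 2).
  rewrite enorm_rV1 geo_dist// !clE ?bnd// opprD addrACA subrr add0r -mulrBl.
  by rewrite normrM normfV (gtr0_norm L0) divfK ?gt_eqF// !mxE.
- move=> u Uu; apply: filterE => n; apply: mdist_positivity.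
  by rewrite f'0 sig_disp Ufix// mdistxx.
- by move=> n h; exact: rot.
- move=> h v; apply: filterE => n; rewrite f'0 sig_disp /f' row_mxKl row_mxKr.
  rewrite ph_tau; last exact: YC.
  by rewrite tau_isometric//; [rewrite sig_disp|exact/ph_parallel_set/YC|exact: YC].
- by move=> h; exists (d (ph h x0) x0); apply: filterE => n; rewrite f'0 sig_disp.
by have := dim_max cg; rewrite addn1 ltnn.
Qed.

Theorem minimal_config_invariant_flat : exists (g : 'rV[R]_k -> X), [/\ flat g,
  forall u, U u -> ph u (g 0) = g 0 &
  forall h, exists B B' c, rotation_pair B B' /\ forall v, ph h (g v) = g (B v + c)].
Proof.
have [m [m_lin m_ge0 m1 m_inv]] := mean_orbit.
have [[y Yy yfix]|long|[j [f' [j0 f'flat f'Y f'U f'rot]]]] :=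
  amenable_trichotomy X_proper (fiber_closed X_Hadamard X_proper f_flat Cx0)
    (fiber_convex X_Hadamard Cx0) Yx0 rho_Y rho1 rhoM rho_isometric m_lin m_ge0 m1 m_inv X_packing.
- exists (fun v => tau v y); have Cy := YC Yy; split.
  + by move=> v w; rewrite tau_dist.
  + by move=> u Uu; rewrite tau0// ph_rho// shift_fix// yfix tau0.
  + move=> h; exists (A h), (A' h), (shift h); split => // v.
    by rewrite ph_tau// ph_rho// yfix tauD.
(* A nonexpansive map commuting with [rho] does not increase displacements, so [T x0] can be the end
   of a long segment. *)
- exfalso; have H n : exists z, [/\ Y z, forall h, d (ph h z) z <= d (ph h x0) x0 & n%:R <= d x0 z].
    have [T [TY Tne Trho] nT] := long n%:R; exists (T x0); split => //; first exact: TY.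
    move=> h; rewrite -ler_sqr ?nnegrE ?mdist_ge0// !ph_disp//; last exact: TY.
    rewrite lerD2l ler_sqr ?nnegrE ?mdist_ge0// -Trho//.
    by apply: Tne => //; exact: rho_Y.
  have [z zP] := choice H.
  by apply: (@no_long_segments z) => n; case: (zP n).
- exfalso; apply: (no_product_config j0 f'flat f'Y _ f'rot).
  by move=> u Uu; apply: f'U; exact: rho_fix.
Qed.

End ExtremalConfiguration.

(** * Discrete groups of Euclidean isometries *)

Section Frobenius.
Context {R : realType}.

Definition fnorm m n (B : 'M[R]_(m, n)) : R := enorm (mxvec B).

Lemma fnorm_sum m n (B : 'M[R]_(m, n)) : fnorm B ^+ 2 = \sum_i \sum_j B i j ^+ 2.
Proof.
rewrite enorm_sqr dotE (reindex _ (curry_mxvec_bij _ _)) /= pair_bigA.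
by apply: eq_bigr => -[i j] _ /=; rewrite mxvecE expr2.
Qed.

Lemma fnorm_row m n (B : 'M[R]_(m, n)) : fnorm B ^+ 2 = \sum_i enorm (row i B) ^+ 2.
Proof.
rewrite fnorm_sum; apply: eq_bigr => i _; rewrite enorm_sqr dotE.
by apply: eq_bigr => j _; rewrite mxE expr2.
Qed.

Lemma fnorm_tr m n (B : 'M[R]_(m, n)) : fnorm B ^+ 2 = \tr (B *m B^T).
Proof.
rewrite fnorm_sum; apply: eq_bigr => i _; rewrite mxE.
by apply: eq_bigr => j _; rewrite mxE expr2.
Qed.

Lemma fnorm_ge0 m n (B : 'M[R]_(m, n)) : 0 <= fnorm B.
Proof. exact: enorm_ge0. Qed.

Lemma fnorm_eq0 m n (B : 'M[R]_(m, n)) : fnorm B = 0 -> B = 0.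
Proof. by move=> /enorm_eq0 B0; rewrite -[B]mxvecK B0 linear0. Qed.

Lemma fnormT m n (B : 'M[R]_(m, n)) : fnorm B^T = fnorm B.
Proof.
apply/eqP; rewrite -(@eqrXn2 _ 2) ?fnorm_ge0// !fnorm_sum exchange_big /=; apply/eqP.
by apply: eq_bigr => i _; apply: eq_bigr => j _; rewrite mxE.
Qed.

Lemma fnormN m n (B : 'M[R]_(m, n)) : fnorm (- B) = fnorm B.
Proof. by rewrite /fnorm linearN enormN. Qed.

Lemma fnormB_sym m n (B C : 'M[R]_(m, n)) : fnorm (B - C) = fnorm (C - B).
Proof. by rewrite -fnormN opprB. Qed.

Lemma fnormD m n (B C : 'M[R]_(m, n)) : fnorm (B + C) <= fnorm B + fnorm C.
Proof. by rewrite /fnorm linearD enormD. Qed.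

Lemma fnormB_triangle m n (B C D : 'M[R]_(m, n)) :
  fnorm (B - D) <= fnorm (B - C) + fnorm (C - D).
Proof. by have := fnormD (B - C) (C - D); rewrite addrA subrK. Qed.

Lemma enorm_mulmx m n (v : 'rV[R]_m) (B : 'M[R]_(m, n)) : enorm (v *m B) <= enorm v * fnorm B.
Proof.
rewrite -ler_sqr ?nnegrE ?mulr_ge0 ?enorm_ge0 ?fnorm_ge0// exprMn -(fnormT B) fnorm_row.
rewrite [leLHS]enorm_sqr dotE mulr_sumr; apply: ler_sum => j _.
have -> : (v *m B) 0 j = dot v (row j B^T).
  by rewrite mxE dotE; apply: eq_bigr => i _; rewrite !mxE.
rewrite -expr2 -exprMn -real_normK ?num_real// ler_sqr ?nnegrE ?mulr_ge0 ?enorm_ge0//.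
rewrite ler_norml dot_enorm andbT lerNl -dotNl -(enormN v); exact: dot_enorm.
Qed.

Lemma fnormM m n p (B : 'M[R]_(m, n)) (C : 'M[R]_(n, p)) : fnorm (B *m C) <= fnorm B * fnorm C.
Proof.
rewrite -ler_sqr ?nnegrE ?mulr_ge0 ?fnorm_ge0// exprMn !(fnorm_row B) !(fnorm_row (B *m C)).
rewrite mulr_suml; apply: ler_sum => i _; rewrite row_mul -exprMn.
by rewrite ler_sqr ?nnegrE ?mulr_ge0 ?enorm_ge0 ?fnorm_ge0// enorm_mulmx.
Qed.

Lemma orth_enorm k (v : 'rV[R]_k) (Q : 'M[R]_k) : Q *m Q^T = 1%:M -> enorm (v *m Q) = enorm v.
Proof.
by move=> QQ; rewrite /enorm /dot trmx_mul mulmxA -(mulmxA v) QQ mulmx1.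
Qed.

Lemma fnorm_orthr m k (B : 'M[R]_(m, k)) (Q : 'M[R]_k) :
  Q *m Q^T = 1%:M -> fnorm (B *m Q) = fnorm B.
Proof.
move=> QQ; apply/eqP; rewrite -(@eqrXn2 _ 2) ?fnorm_ge0// !fnorm_row; apply/eqP.
by apply: eq_bigr => i _; rewrite row_mul orth_enorm.
Qed.

Lemma fnorm_orthl m k (B : 'M[R]_(k, m)) (Q : 'M[R]_k) :
  Q *m Q^T = 1%:M -> fnorm (Q *m B) = fnorm B.
Proof.
move=> QQ; rewrite -fnormT trmx_mul fnorm_orthr ?fnormT// trmxK.
exact: mulmx1C.
Qed.

Lemma mxvec_ultra_cvg k (I : Type) (F : set_system I) (u : I -> 'M[R]_k) :
  UltraFilter F -> (forall i, u i *m (u i)^T = 1%:M) ->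
  exists l, forall e, 0 < e -> \forall i \near F, fnorm (u i - l) <= e.
Proof.
move=> FU uo; have [|l lP] := @rv_ultra_cvg R (k * k) I F (fun i => mxvec (u i)) (fnorm (1%:M : 'M[R]_k)) FU.
  by apply: filterE => i; rewrite -/(fnorm (u i)) -(fnorm_orthl 1%:M (uo i)) mulmx1.
exists (vec_mx l) => e e0; apply: filterS (lP e e0) => i.
by rewrite /fnorm linearB /= vec_mxK.
Qed.

(** The orthogonal group is totally bounded, and the centres are taken in the family itself. Without
    such a cover, some ultrafilter would stay at distance more than [e] from each [u j], although
    [u] converges along it. *)
Lemma orth_finite_cover (I : eqType) k (u : I -> 'M[R]_k) e : 0 < e ->
  (forall i, u i *m (u i)^T = 1%:M) ->
  exists s : seq I, forall i, exists2 j, j \in s & fnorm (u i - u j) <= e.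
Proof.
move=> e0 uo; apply: contrapT => /forallNP ns.
have H (s : seq I) : exists i, forall j, j \in s -> e < fnorm (u i - u j).
  have /existsNP[i Hi] := ns s; exists i => j js; rewrite ltNge; apply/negP => le.
  by apply: Hi; exists j.
pose F0 := filter_from (@setT (seq I)) (fun s => [set i | forall j, j \in s -> e < fnorm (u i - u j)]).
have F0P : ProperFilter F0.
  apply: filter_from_proper => [|s _]; last exact: H.
  apply: filter_from_filter; first by exists [::].
  move=> s t _ _; exists (s ++ t) => // i /= st.
  by split => j js; apply: st; rewrite mem_cat js ?orbT.
have [F [FU FF]] := ultraFilterLemma F0P.
have [l lP] := mxvec_ultra_cvg FU uo.
have e2 : 0 < e / 2 by rewrite divr_gt0.
have /filter_ex[j jl] := lP _ e2.
have Fj : F [set i | e < fnorm (u i - u j)].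
  by apply: FF; exists [:: j] => // i /= ->//; rewrite inE.
have [i [il /= ij]] := filter_ex (filterI (lP _ e2) Fj).
have := fnormB_triangle (u i) l (u j); rewrite (fnormB_sym l).
by move: il jl ij; lra.
Qed.

Lemma rotation_mx k (A A' : 'rV[R]_k -> 'rV[R]_k) : rotation_pair A A' ->
  exists M : 'M[R]_k, M *m M^T = 1%:M /\ forall v, A v = v *m M.
Proof.
move=> rA; have [iso A0 K K'] := rA.
have Adot v w : dot (A v) (A w) = dot v w.
  have h u : dot (A u) (A u) = dot u u by rewrite -!enorm_sqr (rotation_enorm _ rA).
  have := iso v w => /(congr1 (fun x => x ^+ 2)); rewrite !enorm_sqr !dotBl !dotBr !h.
  rewrite (dotC (A w)) (dotC w); lra.
have AD v w : A (v + w) = A v + A w.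
  apply: dot_inj => u; rewrite -(K' u) dotDl !Adot dotDl; lra.
have AZ c v : A (c *: v) = c *: A v.
  by apply: dot_inj => u; rewrite -(K' u) dotZl !Adot dotZl.
pose M : 'M[R]_k := \matrix_i A (delta_mx 0 i).
have AM v : A v = v *m M.
  rewrite {1}(row_sum_delta v) (big_morph A AD A0) mulmx_sum_row; apply: eq_bigr => i _.
  by rewrite AZ rowK.
exists M; split => //; apply/matrixP => i j.
transitivity (dot (A (delta_mx 0 i)) (A (delta_mx 0 j))).
  by rewrite dotE mxE; apply: eq_bigr => l _; rewrite !mxE.
by rewrite Adot /dot trmx_delta mul_delta_mx_cond [RHS]mxE; case: (i == j); rewrite !mxE.
Qed.

End Frobenius.

Section CommutingRotations.
Context {R : realType} {k : nat}.
Implicit Types (A B K P Y : 'M[R]_k) (v t : 'rV[R]_k).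

Lemma tr_dot m n (B C : 'M[R]_(m, n)) : \tr (B *m C^T) = dot (mxvec B) (mxvec C).
Proof.
rewrite dotE (reindex _ (curry_mxvec_bij _ _)) /=.
rewrite (eq_bigr (fun p : 'I_m * 'I_n => B p.1 p.2 * C p.1 p.2)); last first.
  by move=> [i j] _; rewrite /= !mxvecE.
rewrite -(pair_bigA _ (fun i j => B i j * C i j)) /=; apply: eq_bigr => i _.
by rewrite mxE; apply: eq_bigr => j _; rewrite !mxE.
Qed.

(* With A' = B^T A B, which commutes with A, and P = A - A', one computes
   tr(P^T P B^T) = 0, whence |P|^2 = tr(P^T P (1 - B^T)) <= |P|^2 |1 - B|. *)
Lemma rotation_commute A B K : A *m A^T = 1%:M -> B *m B^T = 1%:M ->
  A *m B *m K = B *m A -> A *m K = K *m A -> fnorm (B - 1%:M) < 1 -> A *m B = B *m A.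
Proof.
move=> AA BB KE AK B1; have AA' := mulmx1C AA; have BB' := mulmx1C BB.
pose A' := B^T *m A *m B.
have A'B : B *m A' = A *m B by rewrite /A' !mulmxA BB mul1mx.
have KA' : K = A'^T *m A.
  rewrite /A' !trmx_mul trmxK -!mulmxA -KE.
  by rewrite (mulmxA A^T) (mulmxA A^T) AA' mul1mx !mulmxA BB' mul1mx.
have cA : A *m A'^T = A'^T *m A.
  have : A *m A'^T *m A = A'^T *m A *m A by rewrite -mulmxA -KA'.
  by move=> /(congr1 (mulmx^~ A^T)); rewrite -!mulmxA AA !mulmx1.
have A'A' : A' *m A'^T = 1%:M.
  by rewrite /A' !trmx_mul trmxK !mulmxA -(mulmxA _ B) BB mulmx1 -(mulmxA _ A) AA mulmx1.
pose P := A - A'.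
have PB : \tr (P^T *m P *m B^T) = 0.
  have trB Y Z : \tr (Y - Z) = \tr Y - \tr Z by rewrite linearB.
  have PT : P^T = A^T - A'^T by rewrite /P linearB.
  rewrite PT /P mulmxBl !mulmxBr AA' (mulmx1C A'A') !mulmxBl !mul1mx !trB.
  have -> : \tr (A^T *m A' *m B^T) = \tr B^T.
    rewrite /A' -!mulmxA BB mulmx1 mulmxA mxtrace_mulC !mulmxA AA mul1mx //.
  have -> : \tr (A'^T *m A *m B^T) = \tr B^T.
    rewrite -cA -mulmxA -trmx_mul A'B trmx_mul mulmxA mxtrace_mulC !mulmxA AA' mul1mx //.
  by rewrite !subrr.
have P0 : fnorm P = 0.
  have : fnorm P ^+ 2 <= fnorm P ^+ 2 * fnorm (B - 1%:M).
    have PE : fnorm P ^+ 2 = \tr (P *m (1%:M - B^T) *m P^T).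
      rewrite mxtrace_mulC mulmxA mulmxBr mulmx1 linearB /= PB subr0.
      by rewrite mxtrace_mulC fnorm_tr.
    rewrite {1}PE tr_dot; apply: le_trans (dot_enorm _ _) _.
    rewrite -!/(fnorm _) expr2 mulrAC ler_wpM2r ?fnorm_ge0//.
    have BT : B^T - 1%:M = (B - 1%:M)^T by rewrite linearB /= trmx1.
    by rewrite -(fnormT (B - _)) -BT (fnormB_sym B^T) fnormM.
  rewrite -subr_ge0 -[X in _ - X]mulr1 -mulrBr => h.
  apply/eqP; rewrite -sqrf_eq0 eq_le sqr_ge0 andbT.
  by move: h; rewrite -subr_lt0 in B1; rewrite nmulr_lge0.
by rewrite -A'B -(subr0_eq (fnorm_eq0 P0)).
Qed.

Lemma dot_orth v t A : A *m A^T = 1%:M -> dot (v *m A) (t *m A) = dot v t.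
Proof. by move=> AA; rewrite /dot trmx_mul mulmxA -(mulmxA v) AA mulmx1. Qed.

(** [w] is fixed by [A] and equal to [v *m A - v]; fixed vectors are orthogonal to such
    differences. *)
Lemma orth_ker_sqr v A : A *m A^T = 1%:M ->
  v *m (A - 1%:M) *m (A - 1%:M) = 0 -> v *m (A - 1%:M) = 0.
Proof.
move=> AA; set w := v *m _; rewrite mulmxBr mulmx1 => /subr0_eq wA.
by apply: dotvv_eq0; rewrite {1}/w mulmxBr mulmx1 dotBl -{1}wA dot_orth// subrr.
Qed.

Lemma orth_ker_iter n v A : A *m A^T = 1%:M ->
  iter n (mulmx^~ (A - 1%:M)) v = 0 -> v *m A = v.
Proof.
move=> AA; case: n => [/= ->|n]; first by rewrite mul0mx.
elim: n => [|n IH] /=; first by rewrite mulmxBr mulmx1 => /subr0_eq.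
by move/(orth_ker_sqr AA)/IH.
Qed.

End CommutingRotations.

Lemma exists_expr2_ge (R : realType) (x y : R) : 0 < y -> exists n, x <= y * 2 ^+ n.
Proof.
move=> y0; exists (Num.bound `|x / y|).
rewrite mulrC -ler_pdivrMr//; apply: le_trans (ler_norm _) _.
apply: le_trans (ltW (archi_boundP (normr_ge0 _))) _.
by rewrite -natrX ler_nat ltnW// ltn_expl.
Qed.

(** * Bieberbach's argument for discrete groups of Euclidean isometries *)

Section Bieberbach.
Context {R : realType} {k : nat} {Gam : groupType}.
(** [h] acts by [v |-> v *m M h + c h]. Matrices multiply row vectors on the right, hence the
    reversed order in [MM] and [cM]. *)
Variables (M : Gam -> 'M[R]_k) (c : Gam -> 'rV[R]_k).
Hypothesis M_orth : forall h, M h *m (M h)^T = 1%:M.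
Hypothesis MM : forall h g, M (h * g)%g = M g *m M h.
Hypothesis cM : forall h g, c (h * g)%g = c g *m M h + c h.
Variable e0 : R.
Hypothesis e0_gt0 : 0 < e0.
Hypothesis discrete : forall h, fnorm (M h - 1%:M) <= e0 -> enorm (c h) <= e0 ->
  M h = 1%:M /\ c h = 0.

Definition commut (h g : Gam) := (h * g * h^-1 * g^-1)%g.

Let commutM h g : (commut h g * (g * h))%g = (h * g)%g.
Proof. by rewrite /commut mulgA mulgVK mulgVK. Qed.

Let M_commut h g : M h *m M g *m M (commut h g) = M g *m M h.
Proof. by rewrite -!MM commutM. Qed.

Let c_commut h g : c (commut h g) =
  c g *m (M h - M (commut h g)) + c h *m (1%:M - M g *m M (commut h g)).
Proof.
have := congr1 c (commutM h g); rewrite !cM mulmxDl !mulmxBr mulmx1 mulmxA.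
move: (commut h g) => K.
move: (c h *m M g *m M K) (c g *m M K) (c g *m M h) (c h) (c K) => u v w x y e.
by apply/rowP => i; move: e => /rowP/(_ i); rewrite !mxE; lra.
Qed.

Let M_commut_le h g : fnorm (M (commut h g) - 1%:M) <=
  2 * fnorm (M h - 1%:M) * fnorm (M g - 1%:M).
Proof.
rewrite -(fnorm_orthl _ (M_orth g)) -(fnorm_orthl _ (M_orth h)) mulmxA mulmxBr mulmx1.
rewrite M_commut.
have -> : M g *m M h - M h *m M g =
    (M g - 1%:M) *m (M h - 1%:M) - (M h - 1%:M) *m (M g - 1%:M).
  rewrite !mulmxBl !mulmxBr !mulmx1 !mul1mx.
  move: (M g *m M h) (M h *m M g) (M g) (M h) => u v w x.
  by apply/matrixP => i j; rewrite !mxE; ring.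
apply: le_trans (fnormD _ _) _; rewrite fnormN -mulrA mulr_natl mulr2n; apply: lerD.
  by rewrite mulrC fnormM.
exact: fnormM.
Qed.

(** The rotation and translation parts of the iterated commutators with [h] decay like powers of
    1/2, so discreteness makes one of them trivial; [rotation_commute] then descends to the first
    one. *)
Lemma commut_trivial h g : fnorm (M h - 1%:M) <= 4^-1 -> fnorm (M g - 1%:M) <= 4^-1 ->
  M (commut h g) = 1%:M.
Proof.
move=> h4 g4; pose gn n := iter n (commut h) g.
have Mgn n : 2 ^+ n * fnorm (M (gn n) - 1%:M) <= 4^-1.
  elim: n => [|n IH]; first by rewrite expr0 mul1r.
  apply: le_trans IH; rewrite exprSr -mulrA ler_pM2l ?exprn_gt0//.
  have := M_commut_le h (gn n); rewrite -/(gn n.+1).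
  have := fnorm_ge0 (M (gn n) - 1%:M); have := fnorm_ge0 (M h - 1%:M); nra.
have Mgn1 n : fnorm (M (gn n) - 1%:M) <= 4^-1.
  apply: le_trans (Mgn n); rewrite ler_peMl ?fnorm_ge0// exprn_ege1//; lra.
(* The recursion [le1] bounds the next term by 3/4 of [D] plus 3/4 of [enorm (c h)]; the coefficient
   3 makes this at most [D]. *)
pose D := enorm (c g) + 3 * enorm (c h).
have cgn n : 2 ^+ n * enorm (c (gn n)) <= D.
  elim: n => [|n IH].
    by rewrite expr0 mul1r lerDl mulr_ge0// enorm_ge0.
  have le1 : enorm (c (gn n.+1)) <= enorm (c (gn n)) * (4^-1 + 8^-1) +
      enorm (c h) * (3 / 2 * fnorm (M (gn n) - 1%:M)).
    rewrite /gn /= -/(gn n) c_commut; apply: le_trans (enormD _ _) _.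
    have le2 := M_commut_le h (gn n).
    have f0 := fnorm_ge0 (M (gn n) - 1%:M).
    have le3 : 2 * fnorm (M h - 1%:M) * fnorm (M (gn n) - 1%:M) <= 2^-1 * fnorm (M (gn n) - 1%:M).
      by apply: ler_wpM2r => //; lra.
    apply: lerD; apply: le_trans (enorm_mulmx _ _) _; apply: ler_wpM2l; rewrite ?enorm_ge0//.
      apply: le_trans (fnormB_triangle _ 1%:M _) _; apply: lerD => //.
      by rewrite fnormB_sym; have := Mgn1 n; lra.
    rewrite fnormB_sym.
    have -> : M (gn n) *m M (commut h (gn n)) - 1%:M =
        M (gn n) *m (M (commut h (gn n)) - 1%:M) + (M (gn n) - 1%:M).
      by rewrite mulmxBr mulmx1 addrA subrK.
    by apply: le_trans (fnormD _ _) _; rewrite fnorm_orthl//; lra.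
  have p2 : 0 < 2 ^+ n :> R by rewrite exprn_gt0.
  have := ler_wpM2l (ltW p2) le1; rewrite exprSr.
  have := Mgn n; have := enorm_ge0 (c h); have := enorm_ge0 (c g); rewrite /D in IH *.
  move: IH; move: (fnorm _) (enorm (c (gn n))) (enorm (c (gn n.+1))) (enorm (c h)) (enorm (c g)) (2 ^+ n).
  move=> p q r s t w; nra.
have [n Mn1] : exists n, M (gn n.+1) = 1%:M.
  have [n nD] := @exists_expr2_ge R (D + 4^-1) e0 e0_gt0; exists n.
  have p2 : 0 < 2 ^+ n.+1 :> R by rewrite exprn_gt0.
  have nD' : D + 4^-1 <= 2 ^+ n.+1 * e0.
    apply: le_trans nD _; rewrite mulrC ler_wpM2r ?(ltW e0_gt0)// exprS ler_peMl ?exprn_ge0//; lra.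
  have D0 : 0 <= D by rewrite addr_ge0 ?mulr_ge0 ?enorm_ge0.
  have [] // := @discrete (gn n.+1).
  - by rewrite -(ler_pM2l p2); apply: le_trans (Mgn _) (le_trans _ nD'); lra.
  - by rewrite -(ler_pM2l p2); apply: le_trans (cgn _) (le_trans _ nD'); lra.
(* If [M (gn n.+2)] is 1, then [M (gn n.+1)] commutes with [M h]; by [rotation_commute] so does
   [M (gn n)], and the commutator of these two is [M (gn n.+1)]. *)
elim: n Mn1 => [//|n IH] Mn2; apply: IH.
have c1 : M h *m M (gn n.+1) = M (gn n.+1) *m M h.
  by have := M_commut h (gn n.+1); rewrite -/(gn n.+2) Mn2 mulmx1.
have c2 := M_commut h (gn n); rewrite -/(gn n.+1) in c2.
have c3 : M h *m M (gn n) = M (gn n) *m M h.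
  by apply: rotation_commute c2 c1 _ => //; apply: le_lt_trans (Mgn1 n) _; lra.
have o : (M h *m M (gn n))^T *m (M h *m M (gn n)) = 1%:M.
  by apply: mulmx1C; rewrite trmx_mul mulmxA -(mulmxA (M h)) M_orth mulmx1 M_orth.
move: c2; rewrite -c3; move: (M h *m M (gn n)) o => Q o /(congr1 (mulmx Q^T)).
by rewrite mulmxA o mul1mx.
Qed.

Let commut_translation h g : M g = 1%:M -> M (commut h g) = 1%:M /\
  c (commut h g) = c g *m (M h - 1%:M).
Proof.
move=> g1; have M1 : M (commut h g) = 1%:M.
  have := M_commut h g; rewrite g1 mulmx1 mul1mx => /(congr1 (mulmx (M h)^T)).
  by rewrite mulmxA (mulmx1C (M_orth h)) mul1mx.
by split => //; rewrite c_commut M1 g1 mulmx1 subrr mulmx0 addr0.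
Qed.

(** Iterated commutators of the translation [g] with [h] are translations by [c g] times powers of
    [M h - 1]. They tend to 0, so by discreteness some power kills [c g], and then the first power
    does. *)
Let translation_fixed h g : M g = 1%:M -> fnorm (M h - 1%:M) <= 4^-1 -> c g *m M h = c g.
Proof.
move=> g1 h4; pose gn n := iter n (commut h) g.
have gP n : M (gn n) = 1%:M /\ c (gn n) = iter n (mulmx^~ (M h - 1%:M)) (c g).
  elim: n => [//|n [Mn cn]]; have [M' c'] := commut_translation h Mn.
  by split => //=; rewrite -cn -c'.
have [n nD] := @exists_expr2_ge R (enorm (c g)) e0 e0_gt0.
have cle m : 2 ^+ m * enorm (c (gn m)) <= enorm (c g).
  elim: m => [|m IH]; first by rewrite expr0 mul1r.
  apply: le_trans IH; rewrite exprSr -mulrA ler_pM2l ?exprn_gt0//.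
  have [Mm _] := gP m; have [_] := commut_translation h Mm.
  rewrite -/(gn m.+1) => ->; have := enorm_mulmx (c (gn m)) (M h - 1%:M).
  have := enorm_ge0 (c (gn m)); nra.
apply: (@orth_ker_iter _ _ n) => //; rewrite -(gP n).2.
have p2 : 0 < 2 ^+ n :> R by rewrite exprn_gt0.
have [] // := @discrete (gn n); first by rewrite (gP n).1 subrr /fnorm linear0 enorm0 (ltW e0_gt0).
by rewrite -(ler_pM2l p2) [leRHS]mulrC; exact: le_trans (cle n) nD.
Qed.

(** The translation of the commutator is fixed by both rotations, and it is a sum of vectors in the
    images of [M h - 1] and [1 - M g], which are orthogonal to fixed vectors; so it is orthogonal to
    itself. *)
Lemma small_rotations_commute h g : fnorm (M h - 1%:M) <= 4^-1 -> fnorm (M g - 1%:M) <= 4^-1 ->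
  M (commut h g) = 1%:M /\ c (commut h g) = 0.
Proof.
move=> h4 g4; have K1 := commut_trivial h4 g4; split => //.
have tA := translation_fixed K1 h4; have tB := translation_fixed K1 g4.
have tE := c_commut h g; rewrite K1 mulmx1 in tE.
apply: dotvv_eq0; rewrite {1}tE dotDl !mulmxBr !mulmx1 !dotBl.
rewrite -{1}tA dot_orth// subrr add0r -{2}tB dot_orth// subrr //.
Qed.

End Bieberbach.

Lemma fnorm_le_sum (R : realType) m n (B : 'M[R]_(m, n)) : fnorm B <= \sum_i enorm (row i B).
Proof.
have s0 (r : seq 'I_m) : 0 <= \sum_(i <- r) enorm (row i B).
  by rewrite sumr_ge0// => i _; exact: enorm_ge0.
rewrite -ler_sqr ?nnegrE ?fnorm_ge0 ?s0// fnorm_row.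
elim: (index_enum _) => [|i r IH]; first by rewrite !big_nil expr0n.
rewrite !big_cons sqrrD -addrA lerD2l (le_trans IH)// lerDr mulrn_wge0// mulr_ge0 ?s0//.
exact: enorm_ge0.
Qed.

(** * The action on an invariant flat: discreteness and kernel *)

Section InvariantFlat.
Context {R : realType} {X : metricType R}.
Hypothesis X_proper : proper_space (X := X).
Context {G : topologicalGroupType} (a : isometric_action G X).
Hypothesis a_proper : proper_action a.
Hypothesis G_td : totally_disconnected [set: G].
Context {Gam : topologicalGroupType} (iota : Gam -> G) (U : set Gam).
Hypothesis Gam_td : totally_disconnected [set: Gam].
Hypothesis iotaM : forall h h', iota (h * h')%g = (iota h * iota h')%g.
Hypothesis iota_proper : forall C, compact C -> compact (iota @^-1` C).
Hypothesis U_subgroup : is_subgroup U.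
Hypothesis U_open : open U.
Hypothesis U_compact : compact U.
Local Notation d := (@mdist R X).
Variables (k : nat) (phi : Gam -> G) (g : 'rV[R]_k -> X).
Hypothesis phi_limhom : limhom iota phi.
Hypothesis g_flat : flat g.
Hypothesis Ufix : forall u, U u -> a (phi u) (g 0) = g 0.
Variables (M : Gam -> 'M[R]_k) (c : Gam -> 'rV[R]_k).
Hypothesis M_orth : forall h, M h *m (M h)^T = 1%:M.
Hypothesis phi_g : forall h v, a (phi h) (g v) = g (v *m M h + c h).

Let g_inj v w : g v = g w -> v = w.
Proof.
by move=> vw; apply/eqP; rewrite -subr_eq0; apply/eqP/enorm_eq0; rewrite -g_flat vw mdistxx.
Qed.

Let phiM h h' : phi (h * h')%g = (phi h * phi h')%g. Proof. by case: phi_limhom. Qed.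

Let cM h h' : c (h * h')%g = c h' *m M h + c h.
Proof.
have := phi_g (h * h')%g 0; rewrite phiM actM !phi_g !mul0mx !add0r => /g_inj.
exact: esym.
Qed.

Let MM h h' : M (h * h')%g = M h' *m M h.
Proof.
apply/row_matrixP => i; rewrite !rowE.
have := phi_g (h * h')%g (delta_mx 0 i); rewrite phiM actM !phi_g => /g_inj.
by rewrite cM mulmxDl -addrA => /addIr <-; rewrite mulmxA.
Qed.

Let M1 : M 1%g = 1%:M.
Proof.
have := MM 1 1; rewrite mulg1 => /(congr1 (mulmx (M 1%g)^T)).
by rewrite mulmxA (mulmx1C (M_orth _)) mul1mx => <-.
Qed.

Let c1 : c 1%g = 0.
Proof. by have := cM 1 1; rewrite mulg1 M1 mulmx1 -[LHS]add0r => /addIr. Qed.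

Let MV h : M h *m M h^-1%g = 1%:M. Proof. by rewrite -MM mulVg M1. Qed.

Let basis : seq 'rV[R]_k := 0 :: [seq delta_mx 0 i | i <- enum 'I_k].

(** Total displacement of the origin and the basis vectors of the flat. It is a continuous function
    on all of [G]; at [phi h] it is comparable to the sizes of [M h - 1] and [c h], by [disp_c],
    [disp_M] and [disp_le]. *)
Let disp (x : G) := \sum_(v <- basis) d (a x (g v)) (g v).

Let dispE x : disp x = d (a x (g 0)) (g 0) + \sum_i d (a x (g (delta_mx 0 i))) (g (delta_mx 0 i)).
Proof. by rewrite /disp /basis big_cons big_map enumT. Qed.

Let disp_continuous : continuous disp.
Proof.
move=> x; apply: (@cvg_sumr R G _ (nbhs x) _ basis (fun v x => d (a x (g v)) (g v)) (fun v => d (a x (g v)) (g v))) => v.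
apply: mdist_cvg; last exact: cvg_cst.
by apply: act_cvg; [exact: cvg_id | exact: cvg_cst].
Qed.

Let disp_le0 x : disp x <= 0 <-> forall v, v \in basis -> a x (g v) = g v.
Proof.
split=> [x0 v vb|H]; last first.
  rewrite /disp big_seq big1// => v vb; by rewrite H// mdistxx.
have : disp x == 0 by rewrite eq_le x0 /disp sumr_ge0// => w _; exact: mdist_ge0.
rewrite psumr_eq0 => [/allP/(_ v vb)/eqP|w _]; last exact: mdist_ge0.
exact: mdist_positivity.
Qed.

Let disp_base x : d (a x (g 0)) (g 0) <= disp x.
Proof. by rewrite dispE lerDl sumr_ge0// => i _; exact: mdist_ge0. Qed.

Let disp_c h : enorm (c h) <= disp (phi h).
Proof.
apply: le_trans (disp_base _).
by rewrite phi_g mul0mx add0r g_flat subr0.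
Qed.

Let disp_M h : fnorm (M h - 1%:M) <= k.+1%:R * disp (phi h).
Proof.
have row_le i : enorm (row i (M h - 1%:M)) <=
    d (a (phi h) (g (delta_mx 0 i))) (g (delta_mx 0 i)) + enorm (c h).
  rewrite phi_g g_flat rowE mulmxBr mulmx1.
  have -> : delta_mx 0 i *m M h - delta_mx 0 i = (delta_mx 0 i *m M h + c h - delta_mx 0 i) - c h.
    by rewrite addrAC addrK.
  by apply: le_trans (enormD _ _) _; rewrite enormN.
apply: le_trans (_ : \sum_i enorm (row i (M h - 1%:M)) <= _).
  exact: fnorm_le_sum.
apply: le_trans (ler_sum _ (fun i _ => row_le i)) _.
rewrite big_split /= sumr_const card_ord -[_ *+ k]mulr_natl -natr1 mulrDl mul1r [leLHS]addrC.
apply: lerD; first by rewrite ler_wpM2l// disp_c.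
by rewrite dispE lerDr mdist_ge0.
Qed.

Let disp_le h : disp (phi h) <= k.+1%:R * (fnorm (M h - 1%:M) + enorm (c h)).
Proof.
have vle v : enorm v <= 1 -> d (a (phi h) (g v)) (g v) <= fnorm (M h - 1%:M) + enorm (c h).
  move=> v1; rewrite phi_g g_flat.
  have -> : v *m M h + c h - v = v *m (M h - 1%:M) + c h by rewrite mulmxBr mulmx1 addrAC.
  apply: le_trans (enormD _ _) _; rewrite lerD2r; apply: le_trans (enorm_mulmx _ _) _.
  by rewrite ler_piMl// fnorm_ge0.
rewrite dispE -natr1 mulrDl mul1r addrC; apply: lerD; last by apply: vle; rewrite enorm0.
apply: le_trans (_ : \sum_(i < k) (fnorm (M h - 1%:M) + enorm (c h)) <= _).
  by apply: ler_sum => i _; apply: vle; rewrite enorm_delta.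
by rewrite sumr_const card_ord mulr_natl.
Qed.

Definition flat_kernel : set Gam := [set h | M h = 1%:M /\ c h = 0].
Local Notation N0 := flat_kernel.

Let N0_disp h : N0 h <-> disp (phi h) <= 0.
Proof.
split=> [[Mh ch]|d0].
  by apply/disp_le0 => v _; rewrite phi_g Mh ch mulmx1 addr0.
split; last by apply: enorm_eq0; apply/eqP; rewrite eq_le enorm_ge0 (le_trans (disp_c h)).
apply: subr0_eq; apply: fnorm_eq0; apply/eqP; rewrite eq_le fnorm_ge0 andbT.
by apply: le_trans (disp_M h) _; rewrite mulr_ge0_le0.
Qed.

Let N0_subgroup : is_subgroup N0.
Proof.
split=> [|h h' [Mh ch] [Mh' ch']|h [Mh ch]]; first by split.
  by split; rewrite ?MM ?cM ?Mh ?Mh' ?ch ?ch' ?mulmx1 ?addr0.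
have MhV : M h^-1%g = 1%:M by have := MV h; rewrite Mh mul1mx.
split => //; have := cM h h^-1%g; rewrite mulgV c1 Mh mulmx1 ch addr0; exact: esym.
Qed.

Let N0_normal x h : N0 x -> N0 (h * x * h^-1)%g.
Proof.
move=> [Mx cx]; have Mhx : M (h * x)%g = M h by rewrite MM Mx mul1mx.
have chx : c (h * x)%g = c h by rewrite cM cx mul0mx add0r.
by split; [rewrite MM Mhx -MM mulgV M1 | rewrite cM Mhx chx -cM mulgV c1].
Qed.

Let K := [set x : G | disp x <= 0].

Let K_subgroup : is_subgroup K.
Proof.
split=> [|x y Kx Ky|x Kx]; apply/disp_le0 => v vb; first by rewrite act1.
  by rewrite actM (disp_le0 y).1// (disp_le0 x).1.
by rewrite -{1}((disp_le0 x).1 Kx v vb) actVK.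
Qed.

Let disp_closed e : closed [set x : G | disp x <= e].
Proof.
have -> : [set x | disp x <= e] = disp @^-1` [set r | r <= e] by [].
by apply: closed_comp; [move=> x _; exact: disp_continuous | exact: closed_le].
Qed.

Let disp_open e : open [set x : G | disp x < e].
Proof.
have -> : [set x | disp x < e] = disp @^-1` [set r | r < e] by [].
by apply: open_comp; [move=> x _; exact: disp_continuous | exact: open_lt].
Qed.

Let base_compact := @displacement_compact R X X_proper G a a_proper (g 0) (g 0) 1.

Let K_compact : compact K.
Proof.
apply: (subclosed_compact (@disp_closed _) base_compact) => x /= Kx.
by rewrite (le_trans (disp_base x))// (le_trans Kx).
Qed.

Let base_nbhs : nbhs (1%g : G) [set x | d (a x (g 0)) (g 0) <= 1].
Proof.
have : nbhs (1%g : G) [set x | disp x < 1].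
  apply: open_nbhs_nbhs; split; first exact: disp_open.
  apply: le_lt_trans ltr01; apply/disp_le0 => v _; exact: act1.
by apply: filterS => x /= x1; rewrite (le_trans (disp_base x))// ltW.
Qed.

(* No small subgroups: the displacement of the powers of [h] stays bounded. *)
Let trivial_of_subgroup V h : is_subgroup V ->
  V `<=` [set x | disp x < (2 * k.+1%:R)^-1] -> V (phi h) -> N0 h.
Proof.
move=> [V1 VM VV] VO Vh; pose hn n := iter n (fun x => (x * x)%g) h.
have Vn n : V (phi (hn n)) by elim: n => [//|n IH]; rewrite /hn /= phiM; exact: VM.
have k0 : 0 < k.+1%:R :> R by rewrite ltr0n.
have dn n : k.+1%:R * disp (phi (hn n)) < 2^-1.
  by have := VO _ (Vn n); rewrite /= invfM ltr_pdivlMr// mulrC.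
have Mn n : fnorm (M (hn n) - 1%:M) < 2^-1 by exact: le_lt_trans (disp_M _) (dn n).
have cn n : enorm (c (hn n)) < 2^-1.
  apply: le_lt_trans (dn n); apply: le_trans (disp_c _) _.
  rewrite ler_peMl ?ler1n//; exact: le_trans (enorm_ge0 _) (disp_c (hn n)).
have Mh : M h = 1%:M.
  apply: subr0_eq; apply: fnorm_eq0; apply/eqP; rewrite eq_le fnorm_ge0 andbT.
  have grow n : 3 / 2 * fnorm (M (hn n) - 1%:M) <= fnorm (M (hn n.+1) - 1%:M).
    rewrite /hn /= -/(hn n) MM.
    have E : M (hn n) *m M (hn n) - 1%:M - (M (hn n) - 1%:M) *m (M (hn n) - 1%:M) =
        2 *: (M (hn n) - 1%:M).
      rewrite mulmxBl !mulmxBr mulmx1 !mul1mx.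
      move: (M (hn n) *m M (hn n)) (M (hn n)) => P Q.
      by apply/matrixP => i j; rewrite !mxE; ring.
    have := fnormD (M (hn n) *m M (hn n) - 1%:M) (- ((M (hn n) - 1%:M) *m (M (hn n) - 1%:M))).
    rewrite E fnormN {1}/fnorm linearZ /= enormZ ger0_norm// -/(fnorm _).
    have := fnormM (M (hn n) - 1%:M) (M (hn n) - 1%:M).
    have := Mn n; have := fnorm_ge0 (M (hn n) - 1%:M); nra.
  (* Squarings are taken in pairs because [(3 / 2) ^+ 2] is at least 2. *)
  have grow2 n : fnorm (M h - 1%:M) * 2 ^+ n <= fnorm (M (hn n.*2) - 1%:M).
    elim: n => [|n IH]; first by rewrite expr0 mulr1.
    have := grow n.*2; have := grow n.*2.+1; rewrite doubleS exprSr mulrA.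
    have := fnorm_ge0 (M (hn n.*2) - 1%:M); lra.
  rewrite leNgt; apply/negP => F0; have [n] := exists_expr2_ge 1 F0.
  by have := grow2 n; have := Mn n.*2; lra.
split => //; apply: enorm_eq0; apply/eqP; rewrite eq_le enorm_ge0 andbT leNgt; apply/negP => F0.
have hnE n : M (hn n) = 1%:M /\ enorm (c (hn n)) = enorm (c h) * 2 ^+ n.
  elim: n => [|n [IH1 IH2]]; first by rewrite expr0 mulr1.
  rewrite /hn /= -/(hn n) MM cM IH1 !mulmx1 exprSr mulrA -IH2; split => //.
  by rewrite -mulr2n -scaler_nat enormZ ger0_norm// mulrC.
have [n] := exists_expr2_ge 1 F0; rewrite -(hnE n).2.
by have := cn n; lra.
Qed.

(** Total disconnectedness enters here: the elements of small displacement include a whole open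
    subgroup [V] around [K], whereas the isometry group of [R^k] has no small subgroups. *)
Let trivial_nbhs : exists2 V, is_subgroup V /\ compact V /\ open V /\ K `<=` V &
  forall h, V (phi h) -> N0 h.
Proof.
have k0 : 0 < (2 * k.+1%:R)^-1 :> R by rewrite invr_gt0 mulr_gt0// ltr0n.
have KO : K `<=` [set x | disp x < (2 * k.+1%:R)^-1] by move=> x /= /le_lt_trans; apply.
have [V [VG cV oV KV VO]] :=
  compact_open_subgroup G_td base_compact base_nbhs K_compact K_subgroup (@disp_open _) KO.
by exists V => // h; exact: trivial_of_subgroup.
Qed.

(** Near the base point the compact sets [disp <= e] shrink to [K] as [e] decreases, so one of them
    is contained in [V]. *)
Lemma flat_discrete : exists2 e, 0 < e &
  forall h, fnorm (M h - 1%:M) <= e -> enorm (c h) <= e -> M h = 1%:M /\ c h = 0.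
Proof.
have [V [VG [cV [oV KV]]] VN] := trivial_nbhs.
pose E := [set A : set G | exists2 e, 0 < e & A = [set x | disp x <= e]].
have cK' : compact ([set x | d (a x (g 0)) (g 0) <= 1] `\` V).
  apply: (subclosed_compact _ base_compact); last by move=> x [].
  rewrite setDE; apply: closedI; last exact: open_closedC.
  exact: (compact_closed (td_hausdorff G_td) base_compact).
have [||||A [e e_gt0 ->] EK] := directed_compact (E := E) cK'.
- by exists [set x | disp x <= 1]; exists 1.
- by move=> A [e _ ->]; exact: disp_closed.
- move=> A B [e e_gt0 ->] [e' e'_gt0 ->]; exists (Num.min e e'); first by rewrite lt_min e_gt0.
  by apply/seteqP; split => x /=; rewrite le_min => /andP.
- move=> x [x1 nV]; have x0 : 0 < disp x by rewrite ltNge; apply/negP => /KV.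
  exists [set y | disp y <= disp x / 2]; first by exists (disp x / 2) => //; rewrite divr_gt0.
  by rewrite /= ler_pdivlMr//; lra.
(* [disp_le] turns the two bounds by [e1] into a displacement of at most [Num.min e 1]. *)
pose e1 := Num.min e 1 / (2 * k.+1%:R).
have k0 : 0 < k.+1%:R :> R by rewrite ltr0n.
have e1_gt0 : 0 < e1 by rewrite divr_gt0 ?mulr_gt0// lt_min e_gt0 ltr01.
exists e1 => // h Mh ch; apply: VN; apply: contrapT => nV.
have dle : disp (phi h) <= Num.min e 1.
  apply: le_trans (disp_le h) _; rewrite -ler_pdivlMl//.
  have -> : k.+1%:R^-1 * Num.min e 1 = e1 + e1.
    by rewrite /e1 invfM; move: (k.+1%:R^-1) (Num.min e 1) => p q; lra.
  exact: lerD.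
suff : ([set x | disp x <= e] `&` ([set x | d (a x (g 0)) (g 0) <= 1] `\` V)) (phi h) by rewrite EK.
have [de d1] : disp (phi h) <= e /\ disp (phi h) <= 1 by move: dle; rewrite le_min => /andP.
by split => //; split => //=; exact: le_trans (disp_base _) d1.
Qed.

Let iota1 : iota 1%g = 1%g.
Proof. by apply: (mulgI (iota 1%g)); rewrite -iotaM !mulg1. Qed.

Let iotaV h : iota h^-1%g = (iota h)^-1%g.
Proof. by apply: (mulgI (iota h)); rewrite -iotaM !mulgV. Qed.

Lemma flat_kernel_tlf : @top_loc_finite Gam N0.
Proof.
move=> S fS SN0; have [V [VG [cV [oV KV]]] _] := trivial_nbhs.
have /finite_seqP[s sS] := fS.
have Vphi h : h \in s -> nbhs (phi h) V.
  move=> hs; apply: open_nbhs_nbhs; split => //; apply: KV.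
  by apply/N0_disp; apply: SN0; rewrite sS.
have [x xs] : exists x, forall h, h \in s -> V (x * iota h * x^-1)%g.
  have [_ /(_ s (fun h => [set y | h \in s -> V y]))[|x xP]] := phi_limhom.
    move=> h; have [hs|hs] := boolP (h \in s); last exact: filterE.
    by apply: filterS (Vphi h hs) => y Vy _.
  by exists x => h hs; exact: xP.
pose W := [set h | V (x * iota h * x^-1)%g].
have WG : is_subgroup W.
  have [V1 VM VV] := VG; split; rewrite /W /=.
  - by rewrite iota1 mulg1 mulgV.
  - move=> h h' Wh Wh'; have := VM _ _ Wh Wh'.
    by rewrite iotaM !mulgA mulgVK.
  - by move=> h /VV; rewrite iotaV !invgM invgK mulgA.
apply: (generated_closure_compact Gam_td WG).
  have -> : W = iota @^-1` [set y | V (x * y * x^-1)%g] by [].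
  apply: iota_proper.
  have -> : [set y | V (x * y * x^-1)%g] = (fun y => x^-1 * y * x)%g @` V.
    apply/seteqP; split => [y Vy|_ [y Vy <-]] /=.
      by exists (x * y * x^-1)%g => //; rewrite !mulgA mulVg mul1g mulgVK.
    by rewrite !mulgA mulgV mul1g mulgK.
  apply: continuous_compact cV; apply: continuous_subspaceT => y O nO.
  exact: (near_lmul (near_rmul (nO : nbhs (x^-1 * y * x)%g O))).
by move=> h; rewrite sS; exact: xs.
Qed.

Let L := closure N0.

Let L_subgroup : is_subgroup L. Proof. exact: closure_subgroup. Qed.

Let L_normal x h : L x -> L (h * x * h^-1)%g.
Proof.
move=> Lx O /near_conj /Lx [y [Ny Oy]]; exists (h * y * h^-1)%g; split => //.
exact: N0_normal.
Qed.

Let L_tlf : @top_loc_finite Gam L.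
Proof.
move=> S fS SL; apply: (loc_finite_generated Gam_td U_subgroup U_compact U_open N0_subgroup) => //.
  exact: flat_kernel_tlf.
exact: finite_compact.
Qed.

Let c_fix u : U u -> c u = 0.
Proof.
by move=> Uu; have := phi_g u 0; rewrite Ufix// mul0mx add0r => /g_inj.
Qed.

(** [U] fixes [g 0], so it acts on the flat by a discrete, hence finite, group of rotations.
    Finitely many cosets of the closed subgroup [L] thus cover [U], and those other than [L] stay
    away from 1. *)
Let L_open : open L.
Proof.
apply: subgroup_open => //; have [e e_gt0 disc] := flat_discrete.
have [U1 UM UV] := U_subgroup; have [N1 NM NV] := N0_subgroup; have [L1 LM LV] := L_subgroup.
have [s sP] := @orth_finite_cover R (set_type U) k (fun u => M (val u)) e e_gt0 (fun u => M_orth _).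
have cover u : U u -> exists2 v, v \in s & N0 ((val v)^-1 * u)%g.
  move=> Uu; have [v vs uv] := sP (exist _ u (mem_set Uu)); exists v => //.
  have Uv : U (val v) by apply: set_mem; exact: valP.
  have cvu : c ((val v)^-1 * u)%g = 0 by apply: c_fix; apply: UM => //; exact: UV.
  apply: disc; last by rewrite cvu enorm0 ltW.
  have -> : M ((val v)^-1 * u)%g - 1%:M = (M u - M (val v)) *m M (val v)^-1%g.
    by rewrite mulmxBl MV MM.
  by rewrite fnorm_orthr.
have vL (y : Gam) : ~ L y -> nbhs (1%g : Gam) [set x | ~ L (y^-1 * x)%g].
  move=> nLv; apply: (@near_lmul _ _ _ (~` L)); rewrite mulg1; apply: open_nbhs_nbhs; split.
    by apply: closed_openC; exact: closed_closure.
  by move=> /= /LV; rewrite invgK.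
have nW : \forall x \near (1%g : Gam), forall v, v \in s -> ~ L (val v) -> ~ L ((val v)^-1 * x)%g.
  elim: s {sP cover} => [|v s IH]; first exact: filterE.
  have [Lv|nLv] := pselect (L (val v)).
    by apply: filterS IH => x H w; rewrite inE => /predU1P[->//|]; exact: H.
  have nv := vL _ nLv; apply: (filterS _ (filterI IH nv)) => x [H Hv] w.
  by rewrite inE => /predU1P[->//|]; exact: H.
have nU : nbhs (1%g : Gam) U by exact: open_nbhs_nbhs.
apply: filterS (filterI nW nU) => x [xW Ux]; have [v vs Nvx] := cover x Ux.
have Lvx : L ((val v)^-1 * x)%g by exact: subset_closure.
have Lv : L (val v) by apply: contrapT => nLv; exact: xW nLv Lvx.
by rewrite -[x](mulVKg (val v)); exact: LM.
Qed.

Theorem invariant_flat_radical : exists N : nsubgroup Gam,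
  [/\ open (N : set Gam), top_loc_finite N &
    exists (S : set Gam) (s : seq Gam),
      (forall x y, S x -> S y -> (N : set Gam) (x * y * x^-1 * y^-1)%g) /\
      forall h, exists2 h', h' \in s & S (h'^-1 * h)%g].
Proof.
have LG : group_closed [in L] by exact/is_subgroupP.
have Ln (x h : Gam) : L x -> L (x ^ h)%g.
  by move=> /(@L_normal _ h^-1%g); rewrite invgK /conjg mulgA.
exists (@NSubgroup _ (Subgroup LG) Ln); split; [exact: L_open | exact: L_tlf |].
have [e e_gt0 disc] := flat_discrete.
have q0 : 0 < 4^-1 :> R by rewrite invr_gt0.
have [s sP] := @orth_finite_cover R Gam k M 4^-1 q0 M_orth.
exists [set h | fnorm (M h - 1%:M) <= 4^-1], s; split.
  move=> x y Mx My; apply: subset_closure.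
  exact: (small_rotations_commute M_orth MM cM e_gt0 disc).
move=> h; have [v vs uv] := sP h; exists v => //=.
have -> : M (v^-1 * h)%g - 1%:M = (M h - M v) *m M v^-1%g by rewrite mulmxBl MV MM.
by rewrite fnorm_orthr.
Qed.

End InvariantFlat.

(** * The LF-radical *)

Section LFRadical.
Context {G : topologicalGroupType}.
Hypothesis G_td : totally_disconnected [set: G].

Lemma setmul_subgroup (M L : set G) : is_subgroup M -> is_subgroup L ->
  (forall m l, M m -> L l -> L (m * l * m^-1)%g) -> is_subgroup (setmul M L).
Proof.
move=> [M1 MM MV] [L1 LM LV] ML; split.
- by exists (1%g, 1%g) => //=; rewrite mulg1.
- move=> _ _ [[m l] [/= Mm Ll] <-] [[m' l'] [/= Mm' Ll'] <-].
  exists ((m * m')%g, (m'^-1 * l * m' * l')%g).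
    split => /=; first exact: MM.
    apply: (LM _ _ _ Ll'); have := ML _ _ (MV _ Mm') Ll; by rewrite invgK.
  by rewrite /= !mulgA mulgK.
- move=> _ [[m l] [/= Mm Ll] <-]; exists (m^-1%g, (m * l^-1 * m^-1)%g).
    by split => /=; [exact: MV | apply: ML => //; exact: LV].
  by rewrite /= !mulgA mulVg mul1g invgM.
Qed.

(* A finite subset of M L lies in D <P>, where D is generated by finitely many
   elements of M and P is the union of the conjugates by the compact group
   closure D of finitely many elements of L. *)
Lemma tlf_mul (W M L : set G) : is_subgroup W -> compact W -> open W ->
  is_subgroup M -> @top_loc_finite G M ->
  is_subgroup L -> closed L -> (forall l h, L l -> L (h * l * h^-1)%g) -> @top_loc_finite G L ->
  @top_loc_finite G (setmul M L).
Proof.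
move=> WG cW oW MG Mtlf LG Lcl Ln Ltlf S fS SML.
have H x : exists ml : G * G, S x -> [/\ M ml.1, L ml.2 & x = (ml.1 * ml.2)%g].
  have [Sx|nSx] := pselect (S x); last by exists (1%g, 1%g).
  by have [[m l] [/= Mm Ll] <-] := SML _ Sx; exists (m, l).
have [ml mlP] := choice H.
pose D := generated [set (ml x).1 | x in S]; have DG : is_subgroup D := generated_is_subgroup _.
have cD : compact (closure D).
  apply: Mtlf; first exact: finite_image.
  by move=> _ [x Sx <-]; have [] := mlP x Sx.
have DcG := closure_subgroup DG.
pose P := (fun u : G * G => u.1 * u.2 * u.1^-1)%g @` (closure D `*` [set (ml x).2 | x in S]).
have PL : P `<=` L.
  by move=> _ [[h _] [/= _ [x Sx <-]] <-]; apply: Ln; have [] := mlP x Sx.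
have cP : compact P.
  apply: continuous_compact; last first.
    by apply: compact_setX => //; apply: finite_compact; exact: finite_image.
  apply: continuous_subspaceT => -[h l]; apply: mulg_cvg; first exact: mulg_continuous.
  apply: (@cvg_comp _ _ _ _ (fun x => x^-1)%g); last exact: invg_continuous.
  exact: cvg_fst.
pose E := generated P; have EG : is_subgroup E := generated_is_subgroup _.
have cE : compact (closure E).
  apply: (loc_finite_generated G_td WG cW oW LG Ltlf cP).
  by apply: subset_trans PL _; exact: subset_closure.
have [D1 DM DV] := DG; have [Dc1 DcM DcV] := DcG.
have DE h e : D h -> E e -> E (h * e * h^-1)%g.
  move=> Dh; have : E `<=` [set e | E (h * e * h^-1)%g].
    have [E1 EM EV] := EG; apply: generated_sub; last first.
      move=> _ [[h' l] [/= Dh' Sl] <-]; apply: sub_generated.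
      exists ((h * h')%g, l); last by rewrite /= invgM !mulgA.
      by split => //=; apply: DcM => //; exact: subset_closure.
    split; rewrite /=; first by rewrite mulg1 mulgV.
      by move=> x y Ex Ey; have := EM _ _ Ex Ey; rewrite !mulgA mulgVK.
    by move=> x /EV; rewrite !invgM invgK mulgA.
  exact.
have DEG := setmul_subgroup DG EG DE.
have cDE : compact (setmul (closure D) (closure E)) by exact: setmul_compact.
apply: (subclosed_compact (@closed_closure _ _) cDE).
rewrite ((closure_id _).1 (compact_closed (td_hausdorff G_td) cDE)); apply: closureS.
apply: (@subset_trans _ (setmul D E)).
  apply: generated_sub => // x Sx; have [Mx Lx xE] := mlP x Sx.
  exists (ml x) => //; split; apply: sub_generated; first by exists x.
  by exists (1%g, (ml x).2); [split => //=; exists x | rewrite /= mul1g invg1 mulg1].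
by move=> _ [[h e] [/= Dh Ee] <-]; exists (h, e) => //; split; exact: subset_closure.
Qed.

Lemma nsubgroup_conj (N : nsubgroup G) x h : (N : set G) x -> (N : set G) (h * x * h^-1)%g.
Proof. by move=> /(@nsubgroup_normal _ N _ h^-1%g); rewrite /conjg invgK mulgA. Qed.

(** The radical is the union of the closed normal topologically locally finite subgroups containing
    [L]. This family is directed under products by [tlf_mul]; containing the open subgroup [L] keeps
    the products closed. *)
Lemma LF_radical_exists (W : set G) (L : nsubgroup G) : is_subgroup W -> compact W -> open W ->
  open (L : set G) -> top_loc_finite L -> exists N : nsubgroup G, is_LF_radical N.
Proof.
move=> WG cW oW oL Ltlf.
have Lcl : closed (L : set G) by apply: open_subgroup_closed => //; exact: subgroup_is_subgroup.
pose good (M : set G) := [/\ is_subgroup M, closed M, forall x h, M x -> M (h * x * h^-1)%g,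
  @top_loc_finite G M & (L : set G) `<=` M].
have join (M M' : set G) : is_subgroup M -> (forall x h, M x -> M (h * x * h^-1)%g) ->
    @top_loc_finite G M -> good M' -> exists M'', [/\ good M'', M `<=` M'' & M' `<=` M''].
  move=> MG Mn Mtlf [M'G M'cl M'n M'tlf LM']; exists (setmul M M').
  have [M1 MM MV] := MG; have [M'1 M'M M'V] := M'G.
  have sM : M `<=` setmul M M' by move=> x Mx; exists (x, 1%g) => //=; rewrite mulg1.
  have sM' : M' `<=` setmul M M' by move=> x Mx; exists (1%g, x) => //=; rewrite mul1g.
  have SG : is_subgroup (setmul M M') by apply: setmul_subgroup => // m l _ /M'n.
  split => //; split => //.
  - apply: open_subgroup_closed => //; apply: subgroup_open => //.
    apply: (@filterS _ (nbhs (1%g : G)) _ (L : set G)); first exact: subset_trans LM' sM'.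
    apply: open_nbhs_nbhs; split => //; by have [] := subgroup_is_subgroup L.
  - move=> _ h [[m l] [/= Mm Ml] <-]; exists ((h * m * h^-1)%g, (h * l * h^-1)%g).
      by split => /=; [exact: Mn | exact: M'n].
    by rewrite /= !mulgA mulgVK.
  - exact: (tlf_mul WG).
  - exact: subset_trans LM' sM'.
have Lgood : good L.
  split => //; [exact: subgroup_is_subgroup | by move=> x h; exact: nsubgroup_conj].
pose N := [set x | exists2 M, good M & M x].
have dir (M M' : set G) : good M -> good M' -> exists M'', [/\ good M'', M `<=` M'' & M' `<=` M''].
  by move=> [MG _ Mn Mtlf _]; exact: join.
have NG : is_subgroup N.
  split.
  - by exists (L : set G) => //; have [] := subgroup_is_subgroup L.
  - move=> x y [M gM Mx] [M' gM' M'y]; have [M'' [gM'' s s']] := dir _ _ gM gM'.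
    by exists M'' => //; have [[_ MM _] _ _ _ _] := gM''; apply: MM; [exact: s | exact: s'].
  - by move=> x [M gM Mx]; exists M => //; have [[_ _ MV] _ _ _ _] := gM; exact: MV.
have Nn (x h : G) : N x -> N (x ^ h)%g.
  move=> [M gM Mx]; exists M => //; have [_ _ Mn _ _] := gM.
  by have := Mn x h^-1%g Mx; rewrite invgK /conjg mulgA.
exists (@NSubgroup _ (Subgroup ((is_subgroupP N).1 NG)) Nn); split.
  move=> S fS SN; have /finite_seqP[s sS] := fS.
  have [M gM SM] : exists2 M, good M & S `<=` M.
    rewrite {fS}sS in SN *; elim: s SN => [|x s IH] SN; first by exists (L : set G).
    have [|M gM sM] := IH; first by move=> y ys; apply: SN; rewrite /= inE ys orbT.
    have [|M' gM' M'x] := SN x; first by rewrite /= mem_head.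
    have [M'' [gM'' s1 s2]] := dir _ _ gM gM'; exists M'' => // y /=.
    by rewrite inE => /predU1P[->|ys]; [exact: s2 | apply: s1; exact: sM].
  by have [_ _ _ Mtlf _] := gM; exact: Mtlf.
move=> M Mtlf x Mx.
have [|||M' [gM' MM' _]] := join (M : set G) (L : set G) _ _ _ Lgood => //.
- exact: subgroup_is_subgroup.
- by move=> y h; exact: nsubgroup_conj.
- by exists M' => //; exact: MM'.
Qed.

Lemma LF_radicalP : (exists N : nsubgroup G, is_LF_radical N) -> is_LF_radical (LF_radical G).
Proof. by move=> H; rewrite /LF_radical; case: pselect => // H'; case: cid. Qed.

(** This holds for the default value of [LF_radical] as well, so the converse implication does not
    depend on the existence of the radical. *)
Lemma LF_radical_tlf : top_loc_finite (LF_radical G).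
Proof.
rewrite /LF_radical; case: pselect => [H|_]; first by case: cid => N [].
move=> S fS S1; apply: (@generated_closure_compact _ G_td S [set 1%g]) => //.
  by apply/is_subgroupP; exact: trivial_group_closed.
exact: compact_set1.
Qed.

End LFRadical.

(** * Invariant means on extensions *)

Section Means.
Context {R : realType}.

(** The domain is all bounded functions, continuous or not, so that means can be composed whatever
    the regularity of the intermediate function. *)
Definition is_mean (T : Type) (m : (T -> R) -> R) := [/\
  forall c f g, bounded_fun f -> bounded_fun g ->
    m (fun x => c * f x + g x) = c * m f + m g,
  forall f, bounded_fun f -> (forall x, 0 <= f x) -> 0 <= m f &
  m (fun=> 1) = 1].

Lemma bounded_fun_cst (T : Type) (c : R) : bounded_fun (fun _ : T => c).
Proof. by exists `|c|. Qed.

Lemma bounded_fun_comp (T T' : Type) (f : T -> R) (h : T' -> T) :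
  bounded_fun f -> bounded_fun (fun x => f (h x)).
Proof. by move=> [B fB]; exists B. Qed.

Lemma bounded_fun_comb (T : Type) c (f g : T -> R) :
  bounded_fun f -> bounded_fun g -> bounded_fun (fun x => c * f x + g x).
Proof.
move=> [B fB] [B' gB]; exists (`|c| * B + B') => x; apply: le_trans (ler_normD _ _) _.
by rewrite normrM; apply: lerD => //; exact: ler_wpM2l.
Qed.

Lemma is_mean_cst (T : Type) (m : (T -> R) -> R) c : is_mean m -> m (fun=> c) = c.
Proof.
move=> [m_lin _ m1]; have b1 := @bounded_fun_cst T 1; have b0 := @bounded_fun_cst T 0.
have m0 : m (fun=> 0) = 0.
  have := m_lin 1 _ _ b0 b0; rewrite (_ : (fun=> _) = fun=> 0); last first.
    by apply/funext => x; rewrite mulr0 addr0.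
  by rewrite mul1r => /esym/(canRL (addrK _)); rewrite subrr.
have := m_lin c _ _ b1 b0; rewrite (_ : (fun=> _) = fun=> c); last first.
  by apply/funext => x; rewrite mulr1 addr0.
by rewrite m0 addr0 m1 mulr1.
Qed.

Lemma mean_sub_le (T : Type) (m : (T -> R) -> R) (f g : T -> R) e : is_mean m ->
  bounded_fun f -> bounded_fun g -> (forall x, `|f x - g x| <= e) -> `|m f - m g| <= e.
Proof.
move=> mm bf bg fg; have [m_lin m_ge0 m1] := mm.
have le h h' : bounded_fun h -> bounded_fun h' -> (forall x, h x <= h' x + e) -> m h <= m h' + e.
  move=> bh bh' hh; rewrite -subr_ge0.
  have be := @bounded_fun_comb T 1 _ _ bh' (bounded_fun_cst T e).
  have -> : m h' + e - m h = m (fun x => -1 * h x + (1 * h' x + e)).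
    rewrite m_lin// m_lin ?(is_mean_cst _ mm)//; last exact: bounded_fun_cst.
    by rewrite mulN1r mul1r addrC.
  apply: m_ge0 => [|x]; first exact: bounded_fun_comb.
  by have := hh x; lra.
have h1 : m f <= m g + e by apply: le => // x; have := fg x; rewrite ler_norml; lra.
have h2 : m g <= m f + e by apply: le => // x; have := fg x; rewrite ler_norml; lra.
by rewrite ler_norml; apply/andP; split; lra.
Qed.

Lemma mean_bound (T : Type) (m : (T -> R) -> R) (f : T -> R) B : is_mean m ->
  (forall x, `|f x| <= B) -> `|m f| <= B.
Proof.
move=> mm fB; have bf : bounded_fun f by exists B.
have := @mean_sub_le _ m f (fun=> 0) B mm bf (bounded_fun_cst _ 0).
by rewrite (is_mean_cst _ mm) subr0; apply => x; rewrite subr0.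
Qed.

Lemma eval_mean (T : Type) (x : T) : is_mean (fun f => f x).
Proof. by split => // f _; apply. Qed.

Lemma comp_mean (T T' : Type) (m : (T -> R) -> R) (m' : T -> (T' -> R) -> R) :
  is_mean m -> (forall x, is_mean (m' x)) -> is_mean (fun f => m (fun x => m' x f)).
Proof.
move=> mm mm'; have [m_lin m_ge0 m1] := mm.
have b' f : bounded_fun f -> bounded_fun (fun x => m' x f).
  by move=> [B fB]; exists B => x; exact: mean_bound.
split.
- move=> c f g bf bg; rewrite -m_lin; [|exact: b'|exact: b'].
  by congr m; apply/funext => x; have [-> //] := mm' x.
- move=> f bf f0; apply: m_ge0 => [|x]; first exact: b'.
  by have [_ p _] := mm' x; exact: p.
- by rewrite -[RHS]m1; congr m; apply/funext => x; have [_ _ ->] := mm' x.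
Qed.

Lemma map_mean (T T' : Type) (m : (T -> R) -> R) (h : T -> T') :
  is_mean m -> is_mean (fun f => m (fun x => f (h x))).
Proof.
move=> mm; exact: (@comp_mean T T' m (fun x f => f (h x)) mm (fun x => eval_mean (h x))).
Qed.

Definition average (T : Type) (s : seq T) (f : T -> R) : R :=
  (size s)%:R^-1 * \sum_(x <- s) f x.

Lemma average_mean (T : Type) (s : seq T) : (0 < size s)%N -> is_mean (average s).
Proof.
move=> s0; split.
- by move=> c f g _ _; rewrite /average big_split /= -mulr_sumr mulrDr mulrCA.
- move=> f _ f0; rewrite /average mulr_ge0 ?invr_ge0// sumr_ge0//.
- by rewrite /average big_const_seq count_predT iter_addr addr0 mulVf// pnatr_eq0 -lt0n.
Qed.

(** With [e = 0], the last clause turns asymptotic invariance of the [m i] into invariance of the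
    limit. *)
Lemma mean_lim (T I : Type) (F : set_system I) (m : I -> (T -> R) -> R) :
  UltraFilter F -> (\forall i \near F, is_mean (m i)) ->
  exists m', is_mean m' /\ forall f g e, bounded_fun f -> bounded_fun g ->
    (forall d, 0 < d -> \forall i \near F, `|m i f - m i g| <= e + d) -> `|m' f - m' g| <= e.
Proof.
move=> FU Fm.
have H f : exists l : R, bounded_fun f -> m i f @[i --> F] --> l.
  have [[B fB]|nb] := pselect (bounded_fun f); last by exists 0.
  have [|l _ ml] := @bounded_ultra_cvg R I F (fun i => m i f) B FU; last by exists l.
  by apply: filterS Fm => i mi; exact: mean_bound.
have [m' mm'] := choice H; exists m'; split.
  split.
  - move=> c f g bf bg.
    apply: (cvg_unique (@Rhausdorff R) (mm' _ (bounded_fun_comb c bf bg))).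
    have h : c * m i f + m i g @[i --> F] --> c * m' f + m' g.
      by apply: cvgD; [apply: cvgM; [exact: cvg_cst | exact: mm'] | exact: mm'].
    apply: cvg_trans h; apply: near_eq_cvg; apply: filterS Fm => i [m_lin _ _].
    by rewrite m_lin.
  - move=> f bf f0; apply: (@cvg_le_to R I F _ (fun=> 0) (m^~ f) 0 (m' f)).
    + exact: cvg_cst.
    + exact: mm'.
    + by apply: filterS Fm => i [_ p _]; exact: p.
  - apply: (cvg_to_eq (mm' _ (bounded_fun_cst T 1))).
    by apply: filterS Fm => i [].
move=> f g e bf bg fg; apply/ler_addgt0Pr => d0 d0_gt0.
apply: (@cvg_le_to R I F _ (fun i => `|m i f - m i g|) (fun=> e + d0) _ _ _ _ (fg _ d0_gt0)).
  by apply: cvg_norm; apply: cvgB; exact: mm'.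
exact: cvg_cst.
Qed.

End Means.

(** [r] picks one representative in each coset; left translation by [g] permutes the cosets, and
    [sig] is the induced permutation of the representatives. *)
Lemma coset_transversal (Gam : groupType) (K B : set Gam) (t : seq Gam) :
  is_subgroup K -> is_subgroup B -> (forall k, K k -> exists2 c, c \in t & K c /\ B (c^-1 * k)%g) ->
  exists s : seq Gam, [/\ (0 < size s)%N, forall c, c \in s -> K c &
    forall g, K g -> exists sig : Gam -> Gam, perm_eq (map sig s) s /\
      forall c, c \in s -> B ((sig c)^-1 * (g * c))%g].
Proof.
move=> [K1 KM KV] [B1 BM BV] cover.
pose r x := xget 1%g [set y | K y /\ B (y^-1 * x)%g].
have rP x : K x -> K (r x) /\ B ((r x)^-1 * x)%g.
  by move=> Kx; have := @xgetPex _ 1%g [set y | K y /\ B (y^-1 * x)%g]; apply; exists x; rewrite /= mulVg.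
have r_eq x y : B (x^-1 * y)%g -> r x = r y.
  move=> Bxy; rewrite /r; congr xget; apply/seteqP; split => z /= [Kz Bz]; split => //.
    by have := BM _ _ Bz Bxy; rewrite mulgA mulgK.
  by have := BM _ _ Bz (BV _ Bxy); rewrite invgM invgK mulgA mulgK.
pose s := undup [seq r c | c <- t & `[< K c >]].
have s_r k : K k -> r k \in s.
  move=> Kk; have [c ct [Kc Bck]] := cover k Kk; rewrite mem_undup -(r_eq _ _ Bck).
  by apply: map_f; rewrite mem_filter ct andbT; exact/asboolP.
have sP c : c \in s -> K c /\ r c = c.
  rewrite mem_undup => /mapP[x]; rewrite mem_filter => /andP[/asboolP Kx _] ->.
  by have [Krx Brx] := rP x Kx; split => //; exact: r_eq.
exists s; split => [|c /sP[]//|g Kg].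
  by have := s_r _ K1; case: (s).
exists (fun c => r (g * c)%g); split; last first.
  by move=> c /sP[Kc _]; have [] := rP (g * c)%g (KM _ _ Kg Kc).
have sig_s : {subset [seq r (g * c)%g | c <- s] <= s}.
  by move=> _ /mapP[c /sP[Kc _] ->]; apply: s_r; exact: KM.
have us : uniq s by exact: undup_uniq.
have sig_inj : uniq [seq r (g * c)%g | c <- s].
  rewrite map_inj_in_uniq// => c c' /sP[Kc rc] /sP[Kc' rc'] e.
  have [_ h] := rP _ (KM _ _ Kg Kc); have [_ h'] := rP _ (KM _ _ Kg Kc').
  rewrite -rc -rc'; apply: r_eq.
  have := BM _ _ (BV _ h) (_ : B ((r (g * c)%g)^-1 * (g * c'))%g); rewrite e => /(_ h').
  by rewrite !invgM !invgK -!mulgA mulVKg mulKg.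
apply: uniq_perm => //; have [] := uniq_min_size sig_inj sig_s; by rewrite ?size_map.
Qed.

Section InvariantMeans.
Context {R : realType}.

Lemma average_perm (T : eqType) (s : seq T) (sig : T -> T) (f : T -> R) :
  perm_eq (map sig s) s -> average s (fun c => f (sig c)) = average s f.
Proof. by move=> p; rewrite /average -(big_map sig xpredT f) (perm_big _ p). Qed.

Lemma average_sub_le (T : eqType) (s : seq T) (f g : T -> R) e : 0 <= e ->
  (forall x, x \in s -> `|f x - g x| <= e) -> `|average s f - average s g| <= e.
Proof.
move=> e0 fg; rewrite /average -mulrBr -sumrB normrM ger0_norm ?invr_ge0//.
have [s0|s0] := posnP (size s); first by rewrite s0 invr0 mul0r.
rewrite ler_pdivrMl ?ltr0n//; apply: le_trans (ler_norm_sum _ _ _) _.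
rewrite big_seq; apply: le_trans (ler_sum _ fg) _.
by rewrite -big_seq big_const_seq count_predT iter_addr addr0 mulr_natl.
Qed.

(** * Invariant means of compact and of topologically locally finite groups *)

Section TotallyDisconnected.
Context {Gam : topologicalGroupType}.
Hypothesis Gam_td : totally_disconnected [set: Gam].
Variable U : set Gam.
Hypothesis U_subgroup : is_subgroup U.
Hypothesis U_compact : compact U.
Hypothesis U_open : open U.

Let nbhs_subgroup O : nbhs (1%g : Gam) O -> exists V : set Gam, [/\ is_subgroup V, open V & V `<=` O].
Proof.
move=> nO; have nU : nbhs (1%g : Gam) U.
  by apply: open_nbhs_nbhs; split => //; case: U_subgroup.
have K1 : is_subgroup [set 1%g : Gam] by apply/is_subgroupP; exact: trivial_group_closed.
have [||V [VG _ oV _ VO]] := @compact_open_subgroup Gam Gam_td U [set 1%g] O° U_compact nU (@compact_set1 _ _) K1.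
- exact: open_interior.
- by move=> _ ->; exact: nO.
by exists V; split => //; exact: subset_trans VO (@interior_subset _ _).
Qed.

(** Averages over representatives of [K] modulo an open subgroup [V] are invariant up to the
    oscillation of [f] on cosets of [V], which is uniformly small on [K] as [V] shrinks to 1. *)
Lemma compact_mean (K : set Gam) : is_subgroup K -> compact K ->
  exists m : (Gam -> R) -> R, is_mean m /\
    forall k f, K k -> bounded_continuous f -> m (fun x => f (k * x)%g) = m f.
Proof.
move=> KG cK; pose sub (V : set Gam) := is_subgroup V /\ open V.
pose F0 := filter_from sub (fun V : set Gam => [set V' | sub V' /\ V' `<=` V]).
have F0P : ProperFilter F0.
  apply: filter_from_proper => [|V sV]; last by exists V; split.
  apply: filter_from_filter; first by exists U; split.
  move=> V V' [VG oV] [V'G oV']; exists (V `&` V').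
    by split; [exact: is_subgroupI | exact: openI].
  by move=> V'' [sV'' s]; split; split => // x /s[].
have [F [FU FF]] := ultraFilterLemma F0P.
have H V : exists s : seq Gam, sub V -> [/\ (0 < size s)%N, forall c, c \in s -> K c &
    forall g, K g -> exists sig : Gam -> Gam, perm_eq (map sig s) s /\
      forall c, c \in s -> V ((sig c)^-1 * (g * c))%g].
  have [[VG oV]|nV] := pselect (sub V); last by exists [::].
  have [||t [tK tP]] := @compact_finite_cover Gam Gam K K (fun c => setmul [set c] V) cK.
  - by move=> c _; exact: setmul_open.
  - move=> x Kx; exists x => //; exists (x, 1%g) => //=; last by rewrite mulg1.
    by split => //; case: VG.
  have [|s sP] := @coset_transversal Gam K V t KG VG; last by exists s.
  move=> k Kk; have [c ct [[_ v] [/= -> Vv] <-]] := tP k Kk.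
  by exists c => //; split; [exact: tK | rewrite mulKg].
have [s sP] := choice H.
have Fsub : F sub by apply: FF; exists setT => //; [split; [|exact: openT] | move=> V []].
have [|m [mm mP]] := @mean_lim R Gam (set Gam) F (fun V => average (s V)) FU.
  by apply: filterS Fsub => V /sP[s0 _ _]; exact: average_mean.
exists m; split => // k f Kk bf; have [fc [B fB]] := bf.
apply/eqP; rewrite -subr_eq0 -normr_le0; apply: mP => //.
- by exists B.
- by exists B.
move=> e e0.
have unif : \forall w \near (1%g : Gam), forall x, K x -> `|f (x * w)%g - f x| <= e.
  apply: ((compact_near_coveringP _).1 cK _ _ (fun w x => `|f (x * w)%g - f x| <= e)) => x Kx.
  have e2 : 0 < e / 2 by rewrite divr_gt0.
  have n1 : \forall x' \near x, `|f x' - f x| <= e / 2.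
    by have /cvgrPdist_le/(_ _ e2) := fc x; apply: filterS => y; rewrite distrC.
  have : nbhs (x * 1)%g [set y | `|f y - f x| <= e / 2] by rewrite mulg1.
  move=> /near_mulg[[A A'] /= [nA nA'] AA].
  exists (A `&` [set x' | `|f x' - f x| <= e / 2], A'); first by split => //; exact: filterI.
  move=> [x' w] [/= [Ax' fx'] A'w]; have := AA (x', w) (conj Ax' A'w) => /= h.
  rewrite [e]splitr -(subrK (f x) (f (x' * w)%g)) -addrA; apply: le_trans (ler_normD _ _) _.
  by rewrite lerD// distrC.
have [V [VG oV Vunif]] := nbhs_subgroup unif.
have FV : F [set V' | sub V' /\ V' `<=` V] by apply: FF; exists V => //; split.
apply: filterS FV => V' [sV' V'V].
have [s0 sK /(_ k Kk)[sig [psig sigP]]] := sP V' sV'.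
rewrite -(average_perm f psig) add0r; apply: average_sub_le; first exact: ltW.
move=> c cs; have /V'V /Vunif := sigP c cs; have Ks : K (sig c).
  by apply: sK; rewrite -(perm_mem psig); exact: map_f.
by move=> /(_ _ Ks); rewrite mulVKg.
Qed.

(** A limit, over the finite subsets of [N], of means of the compact groups that they topologically
    generate. *)
Lemma tlf_mean (N : set Gam) : is_subgroup N -> @top_loc_finite Gam N ->
  exists m : (Gam -> R) -> R, is_mean m /\
    forall n f, N n -> bounded_continuous f -> m (fun x => f (n * x)%g) = m f.
Proof.
move=> NG Ntlf; pose D (s : seq Gam) := [set` s] `<=` N.
pose F0 := filter_from D (fun s : seq Gam => [set s' | D s' /\ {subset s <= s'}]).
have F0P : ProperFilter F0.
  apply: filter_from_proper => [|s Ds]; last by exists s; split.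
  apply: filter_from_filter; first by exists [::] => x.
  move=> s t Ds Dt; exists (s ++ t) => [x|s' [Ds' st]].
    by rewrite /= mem_cat => /orP[/Ds|/Dt].
  by split; split => // x xs; apply: st; rewrite mem_cat xs ?orbT.
have [F [FU FF]] := ultraFilterLemma F0P.
have H s : exists m : (Gam -> R) -> R, D s -> is_mean m /\
    forall k f, k \in s -> bounded_continuous f -> m (fun x => f (k * x)%g) = m f.
  have [Ds|nD] := pselect (D s); last by exists (fun=> 0).
  have [||m [mm mP]] := @compact_mean (closure (generated [set` s])).
  - exact/closure_subgroup/generated_is_subgroup.
  - by apply: Ntlf => //; exact: finite_seq.
  exists m => _; split => // k f ks; apply: mP; apply: subset_closure; exact: sub_generated.
have [ms msP] := choice H.
have FD : F D by apply: FF; exists [::] => // s [].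
have [|m [mm mP]] := @mean_lim R Gam _ F ms FU.
  by apply: filterS FD => s /msP[].
exists m; split => // n f Nn bf.
apply/eqP; rewrite -subr_eq0 -normr_le0; have [_ [B fB]] := bf.
apply: mP => //; [by exists B | by exists B |] => e e0.
have Fn : F [set s | D s /\ {subset [:: n] <= s}].
  by apply: FF; exists [:: n] => // x /=; rewrite inE => /eqP ->.
apply: filterS Fn => s [Ds ns]; have [_ sP] := msP s Ds.
by rewrite sP ?subrr ?normr0 ?add0r ?ltW//; apply: ns; rewrite mem_head.
Qed.

End TotallyDisconnected.

(** * Invariant means of virtually abelian groups *)

Section DiscreteGroup.
Context {Q : groupType}.

(** The average over products of powers of the listed elements, with exponents from 0 to [n]; when
    these commute, such boxes are Folner sets. *)
Let box_mean (n : nat) : seq Q -> (Q -> R) -> R :=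
  foldr (fun x m F => average (iota 0 n.+1) (fun k => m (fun z => F (x ^+ k * z)%g))) (fun F => F 1%g).

Let box_mean_cons n x s F :
  box_mean n (x :: s) F = average (iota 0 n.+1) (fun k => box_mean n s (fun z => F (x ^+ k * z)%g)).
Proof. by []. Qed.

Let box_meanP n s : is_mean (box_mean n s).
Proof.
elim: s => [|x s IH]; first exact: eval_mean.
apply: (comp_mean (m' := fun k F => box_mean n s (fun z => F (x ^+ k * z)%g))).
  by apply: average_mean; rewrite size_iota.
by move=> k; apply: (map_mean (fun z => x ^+ k * z)%g).
Qed.

(** [y] commutes past the entries before its last occurrence in the list; there the sum over
    exponents telescopes and two of its terms remain. *)
Let box_mean_shift (A : set Q) n s y F B : (forall x x', A x -> A x' -> (x * x' = x' * x)%g) ->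
  (forall x, `|F x| <= B) -> (forall x, x \in s -> A x) -> y \in s -> A y ->
  `|box_mean n s (fun z => F (y * z)%g) - box_mean n s F| <= n.+1%:R^-1 * (2 * B).
Proof.
move=> Aab; have n0 : 0 < n.+1%:R :> R by rewrite ltr0n.
elim: s F => [//|x s IH] F FB sA; rewrite inE => ys Ay.
have B0 : 0 <= B by apply: le_trans (FB 1%g).
have sA' z : z \in s -> A z by move=> zs; apply: sA; rewrite inE zs orbT.
have [ys'|ys'] := boolP (y \in s).
  rewrite !box_mean_cons; apply: average_sub_le => [|k _]; first by rewrite mulr_ge0 ?invr_ge0 ?mulr_ge0 ?ler0n.
  have xy : (y * x ^+ k = x ^+ k * y)%g.
    have /commuteX : commute y x by apply: Aab => //; apply: sA; rewrite mem_head.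
    exact.
  rewrite (_ : (fun z => F (y * (x ^+ k * z))%g) = fun z => F (x ^+ k * (y * z))%g); last first.
    by apply/funext => z; rewrite !mulgA xy.
  by apply: (IH (fun z => F (x ^+ k * z)%g)) => // z; exact: FB.
have {ys ys'} -> : y = x by move: ys; rewrite (negbTE ys') orbF => /eqP.
rewrite !box_mean_cons /average size_iota -mulrBr normrM ger0_norm ?invr_ge0 ?ler0n//.
apply: ler_wpM2l; first by rewrite invr_ge0 ler0n.
pose G k := box_mean n s (fun z => F (x ^+ k * z)%g).
rewrite (_ : \sum_(_ <- _) _ = \sum_(0 <= k < n.+1) G k.+1); last first.
  rewrite /index_iota subn0; apply: eq_bigr => k _; rewrite /G; congr box_mean.
  by apply/funext => z; rewrite expgS !mulgA.
rewrite -[X in _ - X](_ : \sum_(0 <= k < n.+1) G k = _); last by rewrite /index_iota subn0.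
rewrite -sumrB telescope_sumr// (le_trans (ler_normB _ _))// mulr_natl mulr2n lerD//.
  by apply: mean_bound => // z; exact: FB.
by apply: mean_bound => // z; exact: FB.
Qed.

Lemma abelian_mean (A : set Q) : (forall x y, A x -> A y -> (x * y = y * x)%g) ->
  exists m : (Q -> R) -> R, is_mean m /\
    forall a F, A a -> bounded_fun F -> m (fun x => F (a * x)%g) = m F.
Proof.
move=> Aab; pose D (i : seq Q * nat) := [set` i.1] `<=` A.
pose F0 := filter_from D (fun i => [set i' | [/\ D i', {subset i.1 <= i'.1} & (i.2 <= i'.2)%N]]).
have F0P : ProperFilter F0.
  apply: filter_from_proper => [|i Di]; last by exists i; split.
  apply: filter_from_filter; first by exists ([::], 0%N) => x.
  move=> [s n] [s' n'] Ds Ds'; exists (s ++ s', maxn n n') => [x|i [Di /= st]].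
    by rewrite /= mem_cat => /orP[/Ds|/Ds'].
  rewrite geq_max => /andP[ni n'i].
  by split; split => // x xs; apply: st; rewrite mem_cat xs ?orbT.
have [F [FU FF]] := ultraFilterLemma F0P.
have [|m [mm mP]] := @mean_lim R Q _ F (fun i => box_mean i.2 i.1) FU.
  by apply: filterE => i; exact: box_meanP.
exists m; split => // a f Aa [B fB].
apply/eqP; rewrite -subr_eq0 -normr_le0; apply: mP; [by exists B | by exists B |].
move=> e e0; have [n Bn] : exists n : nat, n.+1%:R^-1 * (2 * B) <= e.
  exists (Num.bound `|(2 * B) / e|); rewrite ler_pdivrMl ?ltr0n// -ler_pdivrMr//.
  apply: le_trans (ler_norm _) _; apply: le_trans (ltW (archi_boundP (normr_ge0 _))) _.
  by rewrite ler_nat.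
have Fn : F [set i | [/\ D i, {subset [:: a] <= i.1} & (n <= i.2)%N]].
  by apply: FF; exists ([:: a], n) => // x /=; rewrite inE => /eqP ->.
apply: filterS Fn => -[s n'] [/= Ds as_ nn']; rewrite add0r; apply: le_trans Bn.
have as' : a \in s by apply: as_; rewrite mem_head.
apply: le_trans (box_mean_shift _ Aab fB Ds as' Aa) _.
have B0 : 0 <= B by apply: le_trans (fB 1%g).
by rewrite ler_wpM2r ?mulr_ge0// lef_pV2 ?posrE ?ltr0n// ler_nat.
Qed.

Lemma virtually_abelian_mean : virtually_abelian Q ->
  exists m : (Q -> R) -> R, is_mean m /\
    forall g F, bounded_fun F -> m (fun x => F (g * x)%g) = m F.
Proof.
move=> [A [Aab Afin]]; have AG := subgroup_is_subgroup A.
have [|mA [mm mAP]] := @abelian_mean (A : set Q).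
  by move=> x y Ax Ay; apply: Aab; rewrite inE.
have setTG : is_subgroup [set: Q] by [].
have [t tP] : exists t : seq Q, forall k, [set: Q] k -> exists2 c, c \in t & [set: Q] c /\ (A : set Q) (c^-1 * k)%g.
  have /finite_seqP[cs csE] := Afin.
  pose rp (C : set Q) := xget 1%g C.
  exists (map rp cs) => k _; have kcs : [set (k * x)%g | x in (A : set Q)] \in cs.
    have : [set` cs] [set (k * x)%g | x in (A : set Q)] by rewrite -csE; exists k.
    exact.
  exists (rp [set (k * x)%g | x in (A : set Q)]); first exact: map_f.
  split => //; have [A1 AM AV] := AG.
  have [x Ax <-] : [set (k * x)%g | x in (A : set Q)] (rp [set (k * x)%g | x in (A : set Q)]).
    by apply: xgetPex; exists (k * 1)%g; exists 1%g.
  by rewrite invgM mulgVK; exact: AV.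
have [s [s0 _ sP]] := coset_transversal setTG AG tP.
exists (fun F => average s (fun c => mA (fun x => F (c * x)%g))); split.
  apply: (comp_mean (m' := fun c F => mA (fun x => F (c * x)%g))); first exact: average_mean.
  by move=> c; apply: (map_mean (fun x => c * x)%g).
move=> g F bF; have [sig [psig sigP]] := sP g I.
rewrite -(average_perm (fun c => mA (fun x => F (c * x)%g)) psig) /average; congr (_ * _); rewrite !big_seq; apply: eq_bigr => c cs.
have Ac := sigP c cs; rewrite -[RHS](mAP _ (fun x => F (sig c * x)%g) Ac (bounded_fun_comp _ bF)); congr mA.
by apply/funext => x; rewrite -!mulgA mulVKg.
Qed.

End DiscreteGroup.

Lemma extension_amenable (Gam : topologicalGroupType) (U : set Gam) (N : nsubgroup Gam) :
  totally_disconnected [set: Gam] -> is_subgroup U -> compact U -> open U ->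
  top_loc_finite N -> virtually_abelian (quotg N) -> amenable R Gam.
Proof.
move=> Gam_td UG cU oU Ntlf Qab.
have NG := subgroup_is_subgroup N; have [N1 NM NV] := NG.
have [mN [mmN mNP]] := tlf_mean Gam_td UG cU oU NG Ntlf.
have [mQ [mmQ mQP]] := virtually_abelian_mean Qab.
pose m f := mQ (fun q => mN (fun x => f (repr q * x)%g)).
have mm : is_mean m.
  apply: (comp_mean (m' := fun q f => mN (fun x => f (repr q * x)%g))) => // q.
  exact: (map_mean (fun x => repr q * x)%g).
have [m_lin m_ge0 m1] := mm.
exists m; split => //.
- by move=> c f g [_ bf] [_ bg]; exact: m_lin.
- by move=> f [_ bf]; exact: m_ge0.
move=> f h [fc fb]; have [B fB] := fb.
have bc g : bounded_continuous (fun x => f (g * x)%g).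
  split; last by exists B.
  move=> x; apply: (@cvg_comp _ _ _ (fun x => g * x)%g f); last exact: fc.
  by move=> O nO; exact: near_lmul.
(* Invariance under [N] makes the inner mean a function of the coset, so the representative of a
   product may be replaced by the product of representatives. *)
have cosetE x y : \pi_(quotg N)%qT x = \pi_(quotg N)%qT y ->
    mN (fun z => f (x * z)%g) = mN (fun z => f (y * z)%g).
  move=> /quotgP; rewrite inE => /= Nxy.
  rewrite -[LHS](mNP _ _ Nxy (bc x)); congr mN; by apply/funext => z; rewrite -mulgA mulVKg.
have bF : bounded_fun (fun q : quotg N => mN (fun x => f (repr q * x)%g)).
  by exists B => q; apply: mean_bound => // x; exact: fB.
rewrite /m -(mQP (\pi_(quotg N)%qT h) _ bF); congr mQ; apply/funext => q.
rewrite (_ : (fun x => f (h * (repr q * x))%g) = fun x => f (h * repr q * x)%g).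
  by apply: cosetE; rewrite reprK pi_quotg_mul reprK.
by apply/funext => x; rewrite mulgA.
Qed.

End InvariantMeans.

(** * The theorem *)

Section ClosedSubgroup.
Context {G : topologicalGroupType} (H : subgroup G).
Local Notation T := (set_type (subgroup_set H)).

Lemma val_subgroup_continuous : continuous (val : T -> G).
Proof. exact: initial_continuous. Qed.

Lemma subgroup_td : totally_disconnected [set: G] -> totally_disconnected [set: T].
Proof.
move=> G_td x _; apply/seteqP; split => [y xy|_ ->]; last exact: connected_component_refl.
have [B [Bx _ Bc] By] := xy.
have cvB : connected (val @` B : set G).
  apply: connected_continuous_connected => //; apply: continuous_subspaceT.
  exact: val_subgroup_continuous.
have : connected_component [set: G] (val x) (val y).
  by exists (val @` B); [split => //; exists x | exists y].
by rewrite (G_td (val x) I) => /val_inj.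
Qed.

Lemma closed_val_compact C : closed (H : set G) -> compact C -> compact ((val : T -> G) @^-1` C).
Proof.
move=> Hcl; rewrite !compact_ultra => cC F FU FC.
have [p [Cp Fp]] := cC _ (fmap_ultra (val : T -> G) FU) FC.
have Hp : p \in (H : set G).
  rewrite inE; apply: Hcl => B /Fp FB.
  have [x Bx] := @filter_ex _ F _ _ FB.
  by exists (val x); split => //; apply: set_mem; exact: valP.
exists (exist _ p Hp); split => //= B.
rewrite nbhsE => -[_ [[O oO <-] Op] OB].
apply: (@filterS _ F _ _ _ OB); apply: (Fp O).
by apply: open_nbhs_nbhs.
Qed.

End ClosedSubgroup.

(** Centralisers are subgroups; this is used for each of the two variables in turn. *)
Lemma generated_commute (Q : groupType) (S : set Q) : (forall x y, S x -> S y -> commute x y) ->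
  forall x y, generated S x -> generated S y -> commute x y.
Proof.
move=> SS; have cent (A : set Q) : is_subgroup [set x | forall y, A y -> commute x y].
  split=> [y _|x x' Ax Ax' y Ay|x Ax y Ay]; first exact/commute_sym/commute1.
    by apply/commute_sym/commuteM; apply/commute_sym; [exact: Ax | exact: Ax'].
  by apply/commute_sym/commuteV/commute_sym; exact: Ax.
have h1 : generated S `<=` [set x | forall y, S y -> commute x y].
  by apply: generated_sub => // x Sx y Sy; exact: SS.
have h2 : generated S `<=` [set y | forall x, generated S x -> commute y x].
  by apply: generated_sub => // y Sy x gx; exact/commute_sym/h1.
by move=> x y gx gy; exact: h2.
Qed.

Lemma quotient_virtually_abelian (Gam : groupType) (N : nsubgroup Gam) (S : set Gam) (s : seq Gam) :
  (forall x y, S x -> S y -> (N : set Gam) (x * y * x^-1 * y^-1)%g) ->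
  (forall h, exists2 h', h' \in s & S (h'^-1 * h)%g) -> virtually_abelian (quotg N).
Proof.
move=> SN sS; pose p : Gam -> quotg N := \pi_(quotg N)%qT.
pose A := generated (p @` S); have AG : is_subgroup A := generated_is_subgroup _.
exists (Subgroup ((is_subgroupP A).1 AG)); split.
  move=> x y; rewrite !inE /= => Ax Ay; apply: (generated_commute _ Ax Ay).
  move=> _ _ [u Su <-] [v Sv <-].
  rewrite /commute -[LHS]pi_quotg_mul -[RHS]pi_quotg_mul; apply/esym/quotgP.
  (* [quotgP] asks for [(v * u)^-1 * (u * v)], which is a conjugate of the commutator. *)
  rewrite inE (_ : _ * _ = (u * v * u^-1 * v^-1) ^ (v * u))%g.
    by apply: nsubgroup_normal; exact: SN.
  by rewrite /conjg !mulgA mulgVK mulgVK.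
have /(sub_finite_set _) : finite_set ((fun q : quotg N => [set (q * x)%g | x in A]) @` (p @` [set` s])).
  by apply: finite_image; apply: finite_image; exact: finite_seq.
apply => _ [q _ <-]; have [v vs Sv] := sS (repr q).
exists (p v); first by exists v.
have [A1 AM AV] := AG.
have Avq : A ((p v)^-1 * q)%g.
  apply: sub_generated; exists (v^-1 * repr q)%g => //.
  have pVq : (p v * p (v^-1 * repr q))%g = q.
    by rewrite -[LHS]pi_quotg_mul mulVKg; exact: reprK.
  by rewrite -[in RHS]pVq mulKg.
apply/seteqP; split => _ [x Ax <-].
  exists (((p v)^-1 * q)^-1 * x)%g; last by rewrite invgM invgK !mulgA mulgV mul1g.
  by apply: AM => //; exact: AV.
exists ((p v)^-1 * q * x)%g; last by rewrite !mulgA mulgV mul1g.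
by apply: AM.
Qed.

Theorem theorem1p1 (R : realType) (X : metricType R)
    (X_Hadamard : Hadamard X)
    (X_locally_compact : locally_compact [set: X])
    (G : topologicalGroupType)
    (G_totally_disconnected : totally_disconnected [set: G])
    (a : isometric_action G X)
    (a_proper : proper_action a)
    (a_cocompact : cocompact_action a)
    (H : subgroup G)
    (H_closed : closed (H : set G)) :
  amenable R H <->
  open (LF_radical H : set H) /\ virtually_abelian (quotg (LF_radical H)).
Proof.
have Xp : proper_space (X := X) := cocompact_proper_space X_Hadamard X_locally_compact a_cocompact.
have [[x0 _] _ _] := X_Hadamard.
have Cc := @displacement_compact R X Xp G a a_proper x0 x0 1.
have oO : open [set g | mdist x0 (a g x0) < 1].
  have -> : [set g | mdist x0 (a g x0) < 1] = (fun g => a g x0) @^-1` [set y | mdist x0 y < 1] by [].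
  apply: open_comp; last exact: mball_open.
  by move=> g _; apply: (@act_cvg R X G a _ (nbhs g)); [exact: cvg_id | exact: cvg_cst].
have O1 : [set 1%g] `<=` [set g | mdist x0 (a g x0) < 1] by move=> _ -> /=; rewrite act1 mdistxx ltr01.
have nC : nbhs (1%g : G) [set g | mdist (a g x0) x0 <= 1].
  apply: (@filterS _ (nbhs (1%g : G)) _ [set g | mdist x0 (a g x0) < 1]).
    by move=> g /= /ltW; rewrite metric_sym.
  by apply: open_nbhs_nbhs; split => //; exact: O1.
have K1 : is_subgroup [set 1%g : G] by apply/is_subgroupP; exact: trivial_group_closed.
have [V [VG cV oV _ VO]] := compact_open_subgroup G_totally_disconnected Cc nC (@compact_set1 _ _) K1 oO O1.
have [V1 VM VV] := VG.
pose T := set_type (subgroup_set H); pose U : set T := val @^-1` V.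
have UG : is_subgroup U by split=> [|x y Ux Uy|x Ux]; [exact: V1|exact: VM|exact: VV].
have cU : compact U by exact: closed_val_compact.
have oU : open U.
  by apply: open_comp oV => x _; exact: val_subgroup_continuous.
have T_td : totally_disconnected [set: T] by exact: subgroup_td.
split; last first.
  by move=> [_]; apply: (extension_amenable T_td UG cU oU); exact: LF_radical_tlf.
move=> H_amenable.
(* [V] moves [x0] by less than 1, so it has a bounded orbit and fixes a point. *)
have [y _ yfix] : exists2 y, [set: X] y & forall g, V g -> a g y = y.
  apply: (@bounded_orbit_fixed_point R X X_Hadamard Xp G a V setT closedT (fun _ _ _ _ _ _ => I)
    V1 VV VM (fun _ _ _ _ => I) (fun g h z _ => actM a g h z)
    (fun g z w _ _ _ => act_isometry a g z w) x0 1 I).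
  by move=> g Vg; rewrite metric_sym; apply: ltW; exact: VO.
have cob x := @cobounded R X X_locally_compact G a a_cocompact x.
have [N XN] := packing_bound_exists X_Hadamard X_locally_compact a_cocompact.
(* The initial configuration: the inclusion, with the point [y] as a flat of dimension 0. *)
have c0 : config a (val : T -> G) U (val : T -> G) (fun _ : 'rV[R]_0 => y).
  split.
  - split=> // s O nO; exists 1%g => h _; rewrite mul1g invg1 mulg1; exact: nbhs_singleton.
  - by move=> v w; rewrite mdistxx (thinmx0 (v - w)) enorm0.
  - by move=> u Uu; exact: yfix.
  - by move=> h; exists id, id; split=> [|v]; [split | exact: lexx].
have [k [phi [f [cf kmax fmin]]]] := minimal_config Xp a_proper G_totally_disconnected cob y XN c0.
have [g [gflat gU gE]] := minimal_config_invariant_flat X_Hadamard Xp XN a_proper cob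
  G_totally_disconnected H_amenable UG oU cf kmax fmin.
have HMc h : exists Mc : 'M[R]_k * 'rV[R]_k,
    Mc.1 *m Mc.1^T = 1%:M /\ forall v, a (phi h) (g v) = g (v *m Mc.1 + Mc.2).
  have [B [B' [c [rB gB]]]] := gE h; have [M [MM BM]] := rotation_mx rB.
  by exists (M, c); split => // v; rewrite gB BM.
have [Mc McP] := choice HMc.
have phil : limhom (val : T -> G) phi by case: cf.
have [L [oL Ltlf [S [s [SL sS]]]]] := @invariant_flat_radical R X Xp G a a_proper G_totally_disconnected
  T (val : T -> G) U T_td (fun h h' => erefl) (fun C => closed_val_compact H_closed) UG oU cU k phi g
  phil gflat gU (fun h => (Mc h).1) (fun h => (Mc h).2) (fun h => (McP h).1) (fun h => (McP h).2).
have [radtlf radmax] := LF_radicalP (LF_radical_exists T_td UG cU oU oL Ltlf).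
(* [L] is merely contained in the radical, but openness and commutation modulo [L] pass to the
   larger group. *)
have LR := radmax L Ltlf; split.
  apply: subgroup_open; first exact: subgroup_is_subgroup.
  apply: (@filterS _ (nbhs (1%g : T)) _ (L : set T)) => //.
  by apply: open_nbhs_nbhs; split => //; have [] := subgroup_is_subgroup L.
by apply: quotient_virtually_abelian sS => u v Su Sv; apply: LR; exact: SL.
Qed.
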